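(* Let $s>1/2$, $T>0$, and let $u\in C([0,T];\Im_{s,2})$ be the real-valued solution of the initial value problem $$\partial_t u+\partial_x u+\mathcal H\partial_x\partial_t u+u\,\partial_x u=0,\qquad u(x,0)=\varphi(x),\qquad x\in\mathbb{R},\ t\in[0,T],$$ whose initial data $\varphi$ satisfies $\int_{\mathbb{R}}\varphi(x)\,dx\ge 0$. If there is a time $t_2$ with $0<t_2<T$ such that both $u(0)\in\Im_{s,5/2}$ and $u(t_2)\in \Im_{s,5/2}$, then $u$ is identically zero.
   Context: All functions are real-valued. $\mathcal H$ is the Hilbert transform on $\mathbb{R}$, i.e. the Fourier multiplier $\widehat{\mathcal H f}(\xi)=-i\,\mathrm{sgn}(\xi)\widehat f(\xi)$; thus $\mathcal H\partial_x$ has symbol $|\xi|$. $H^s(\mathbb{R})$ is the $L^2$-based Sobolev space with norm $\|\cdot\|_s$. $L^2_r(\mathbb{R})=\{f\in L^2(\mathbb{R}) : |x|^r f\in L^2(\mathbb{R})\}$, with $\|f\|_{L^2_r}=\||x|^r f\|_{L^2}$. $\Im_{s,r}=H^s(\mathbb{R})\cap L^2_r(\mathbb{R})$ is a Banach space with norm $\|f\|_{s,r}^2=\|f\|_s^2+\|f\|_{L^2_r}^2$. The initial value problem is understood through the equivalent integral equation $$u(t)=e^{tA}\varphi-\frac12\int_0^t e^{(t-\tau)A}\,\partial_x(1+\mathcal H\partial_x)^{-1}\big(u(\tau)^2\big)\,d\tau,\qquad A=-\partial_x(1+\mathcal H\partial_x)^{-1},$$ where $A$ is the Fourier multiplier with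 symbol $-i\xi/(1+|\xi|)$. *)

(* Defs.v *)
From mathcomp Require Import all_boot all_order all_algebra.
From mathcomp Require Import all_classical all_reals all_analysis.
From mathcomp Require Import complex.

Set Implicit Arguments.
Unset Strict Implicit.
Unset Printing Implicit Defensive.
Import Order.TTheory GRing.Theory Num.Theory.
Import numFieldNormedType.Exports.

Local Open Scope classical_set_scope.
Local Open Scope ring_scope.
Local Open Scope complex_scope.

(* Elements of L^2(R) are represented by measurable functions with finite
   L^2-norm; equality in L^2(R) is equality almost everywhere. *)

Section defs.
Context {R : realType}.
Local Notation mu := (@lebesgue_measure R).

Definition L2 : set (R -> R) := [set f | f \in Lfun mu 2%:E].

Definition L2_norm (f : R -> R) : \bar R := Lnorm mu 2%:E (EFin \o f).

Definition cmod (z : R[i]) : R := ComplexField.Normc.normc z.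

(* complex-valued L^2(R) *)
Definition L2C : set (R -> R[i]) :=
  [set g | L2 (fun xi => complex.Re (g xi)) /\ L2 (fun xi => complex.Im (g xi))].

(* Integral of f(x) exp(-i x xi) over -n <= x <= n. *)
Definition trunc_fourier (f : R -> R) (n : nat) (xi : R) : R[i] :=
  (\int[mu]_(x in `[- n%:R, n%:R]) (f x * cos (x * xi)))
  -i* (\int[mu]_(x in `[- n%:R, n%:R]) (f x * sin (x * xi))).

(* Plancherel's definition of the Fourier transform on L^2(R): fh is the limit
   in L^2 of the transforms of the truncations of f.  It exists for every f in
   L^2(R) and is unique up to equality almost everywhere. *)
Definition is_fourier (f : R -> R) (fh : R -> R[i]) : Prop :=
  [/\ L2 f, L2C fh &
      L2_norm (fun xi => cmod (trunc_fourier f n xi - fh xi))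
        @[n --> \oo] --> 0%E].

(* The H^s norm for s >= 0.  The infimum is over a set with at most one element,
   and it is +oo when there is none; the factor 1/sqrt(2 pi) makes the H^0
   norm the L^2 norm. *)
Definition Hs_norm (s : R) (f : R -> R) : \bar R :=
  ((Num.sqrt (2 * pi))^-1%:E *
   ereal_inf [set L2_norm (fun xi => (1 + xi ^+ 2) `^ (s / 2) * cmod (fh xi))%R
             | fh in is_fourier f])%E.

Definition Hs (s : R) : set (R -> R) :=
  [set f | L2 f /\ (Hs_norm s f < +oo)%E].

Definition L2w_norm (r : R) (f : R -> R) : \bar R :=
  L2_norm (fun x => `|x| `^ r * f x).

Definition L2w (r : R) : set (R -> R) :=
  [set f | L2 f /\ L2 (fun x => `|x| `^ r * f x)].

Definition Hsr (s r : R) : set (R -> R) := Hs s `&` L2w r.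

Definition Hsr_norm (s r : R) (f : R -> R) : \bar R :=
  ((Hs_norm s f `^ 2 + L2w_norm r f `^ 2) `^ 2^-1)%E.

Definition continuous_Hsr (s r T : R) (u : R -> R -> R) : Prop :=
  forall t0 : R, t0 \in `[0, T] ->
    Hsr s r (u t0) /\
    Hsr_norm s r (u t \- u t0) @[t --> within `[0, T] (nbhs t0)] --> 0%E.

(* g is the image of f under the Fourier multiplier with symbol m *)
Definition fourier_multiplier (m : R -> R[i]) (f g : R -> R) : Prop :=
  exists fh gh, [/\ is_fourier f fh, is_fourier g gh &
    {ae mu, forall xi, gh xi = m xi * fh xi}].

Definition hilbert_symbol (xi : R) : R[i] := 0 -i* Num.sg xi.
Definition deriv_symbol (xi : R) : R[i] := 0 +i* xi.

(* d/dx (1 + H d/dx)^-1 *)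
Definition rbo_symbol (xi : R) : R[i] :=
  deriv_symbol xi / (1 + hilbert_symbol xi * deriv_symbol xi).

Definition A_symbol (xi : R) : R[i] := - rbo_symbol xi.

Definition cexp (z : R[i]) : R[i] :=
  (expR (complex.Re z) * cos (complex.Im z))
  +i* (expR (complex.Re z) * sin (complex.Im z)).

(* exp(tA) *)
Definition group_symbol (t xi : R) : R[i] := cexp (t%:C * A_symbol xi).

(* w is the integral of F over [a, b] as an L^2(R)-valued function: the limit
   in L^2 of the tagged Riemann sums as the mesh goes to 0.  For integrands
   continuous in time it is the Bochner integral. *)
Definition is_L2_integral (a b : R) (F : R -> R -> R) (w : R -> R) : Prop :=
  L2 w /\
  forall eps : R, 0 < eps -> exists2 delta : R, 0 < delta &
    forall (n : nat) (p c : nat -> R), p 0%N = a -> p n = b ->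
      (forall k, (k < n)%N -> p k <= c k <= p k.+1 /\ p k.+1 - p k < delta) ->
      (L2_norm (fun x => (\sum_(k < n) (p k.+1 - p k) * F (c k) x) - w x)%R
         < eps%:E)%E.

(* u(t) = e^{tA} phi
     - 1/2 int_0^t e^{(t - tau)A} d/dx (1 + H d/dx)^-1 (u(tau)^2) dtau,
   with v = e^{tA} phi, F(tau) the integrand and w its integral. *)
Definition mild_solution (T : R) (phi : R -> R) (u : R -> R -> R) : Prop :=
  {ae mu, forall x, u 0 x = phi x} /\
  forall t : R, t \in `[0, T] ->
    exists (v : R -> R) (F : R -> R -> R) (w : R -> R),
      [/\ fourier_multiplier (group_symbol t) phi v,
          forall tau : R, tau \in `[0, t] ->
            fourier_multiplier
              (fun xi => group_symbol (t - tau) xi * rbo_symbol xi)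
              (fun x => u tau x ^+ 2) (F tau),
          is_L2_integral 0 t F w &
          {ae mu, forall x, u t x = v x - 2^-1 * w x}].

Lemma rbo_symbolE xi : rbo_symbol xi = 0 +i* (xi / (1 + `|xi|)).
Proof.
rewrite /rbo_symbol /hilbert_symbol /deriv_symbol.
have -> : 1 + (0 -i* Num.sg xi) * (0 +i* xi) = (1 + `|xi|)%:C :> R[i].
  apply/eqP; rewrite eq_complex /=; apply/andP; split; apply/eqP.
    by rewrite mul0r sub0r mulNr opprK normrEsg.
  by rewrite mul0r mulr0 !addr0.
have n0 : 1 + `|xi| != 0 by rewrite gt_eqF// ltr_pwDl.
rewrite -fmorphV; apply/eqP; rewrite eq_complex /=.
by rewrite !mul0r !mulr0 subrr add0r !eqxx.
Qed.

Lemma group_symbolE t xi : group_symbol t xi =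
  cos (t * xi / (1 + `|xi|)) -i* sin (t * xi / (1 + `|xi|)).
Proof.
rewrite /group_symbol /A_symbol rbo_symbolE /cexp /=.
rewrite oppr0 mulr0 mul0r subr0 expR0 mul0r addr0 !mul1r.
by rewrite mulrN cosN sinN mulrA.
Qed.

End defs.

(* Main.v *)
Require Import Defs.
From mathcomp Require Import all_boot all_order all_algebra.
From mathcomp Require Import all_classical all_reals all_analysis.
From mathcomp Require Import measurable_realfun complex ring lra.

Set Implicit Arguments.
Unset Strict Implicit.
Unset Printing Implicit Defensive.
Import Order.TTheory GRing.Theory Num.Theory.
Import numFieldNormedType.Exports.

Local Open Scope classical_set_scope.
Local Open Scope ring_scope.

                                     

(** Write [theta xi = xi / (1 + |xi|)]. On the Fourier side the integral equation says that the
    transform of [u(t)] is [exp(-i t theta)] times the transform of [phi], minus one half of the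
    time integral over [[0, t]] of [i theta exp(-i (t - tau) theta)] times the transform of
    [u(tau)^2]. Near the origin [theta = xi - xi |xi| + O(|xi|^3)], and [xi |xi|] has a jump in its
    second derivative. On the other hand [|x|^(5/2) u(t)] in L^2 puts the transform of [u(t)] in
    H^(5/2), whose elements have second derivatives in H^(1/2) and so cannot jump.

    Expanding at low frequency, the sine transform of [u(t)] minus that of [u(0)] equals [theta(xi)]
    times [t p0 + 1/2 int_0^t |u(tau)|_2^2 dtau], up to [o(xi^2)], where [p0] is the integral of
    [phi]. If [u(0)] and [u(t2)] both have the extra decay, this coefficient must vanish at
    [t = t2]. Both of its terms are nonnegative, so [u(0) = 0], and uniqueness for zero data gives
    [u = 0] at all times.

    The jump is measured by the test function [jump_test r], which annihilates [xi] and sees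
    [xi |xi|] at size [r^3]. By [jump_test_pairing], functions with the extra decay give only
    [o(r^3)]; by [jump_test_theta], [theta] gives at least [r^3]. The errors of the expansion are
    controlled in [phase_expand] and [duhamel_term_expand], and [jump_absurd] balances everything
    against the Riemann-sum form of the equation, [duhamel_pairing].

    Uniqueness for zero data is [mild_solution_zero]: an exponential envelope for [|u(t)|_2^2] can
    be halved indefinitely, because the transform is bounded pointwise through the equation and
    bounded in L^1 through H^s with [s > 1/2].

    All transforms are handled as real cosine and sine integrals. The link with the L^2 definitions
    is [is_fourier_ft] and [is_fourier_pairing]; L^2 norms are recovered from transforms by
    [parseval_le], and H^s norms are exploited through [Hs_norm_lt]. *)

(** * Measurability and real-valued integrals over the line *)

Definition msr {R : realType} (f : R -> R) := measurable_fun [set: R] f.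

Definition L1 {R : realType} (f : R -> R) :=
  (@lebesgue_measure R).-integrable [set: R] (EFin \o f).

Definition sq_int {R : realType} (f : R -> R) :=
  msr f /\ L1 (fun x => f x ^+ 2).

Section integration.
Context {R : realType}.
Local Notation mu := (@lebesgue_measure R).
Implicit Types f g h : R -> R.

Lemma msr_L1 f : L1 f -> msr f.
Proof. by move=> /integrableP[/measurable_EFinP]. Qed.

Lemma msr_continuous f : continuous f -> msr f.
Proof. exact: continuous_measurable_fun. Qed.

Lemma msr_cst (c : R) : msr (fun=> c).
Proof. exact: measurable_cst. Qed.

Lemma msr_id : msr (fun x : R => x).
Proof. exact: measurable_id. Qed.

Lemma msrD f g : msr f -> msr g -> msr (fun x => f x + g x).
Proof. exact: measurable_funD. Qed.

Lemma msrB f g : msr f -> msr g -> msr (fun x => f x - g x).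
Proof. exact: measurable_funB. Qed.

Lemma msrM f g : msr f -> msr g -> msr (fun x => f x * g x).
Proof. exact: measurable_funM. Qed.

Lemma msrX f n : msr f -> msr (fun x => f x ^+ n).
Proof. exact: measurable_funX. Qed.

Lemma msrN f : msr f -> msr (fun x => - f x).
Proof. exact: measurable_funN. Qed.

Lemma msr_norm f : msr f -> msr (fun x => `|f x|).
Proof. by move=> mf; apply: (measurableT_comp (f := fun y : R => `|y|)). Qed.

Lemma msr_cos f : msr f -> msr (fun x => cos (f x)).
Proof.
move=> mf; apply: (measurableT_comp (f := @cos R)) => //.
by apply: msr_continuous => x; exact: continuous_cos.
Qed.

Lemma msr_sin f : msr f -> msr (fun x => sin (f x)).
Proof.
move=> mf; apply: (measurableT_comp (f := @sin R)) => //.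
by apply: msr_continuous => x; exact: continuous_sin.
Qed.

Lemma msr_expR f : msr f -> msr (fun x => expR (f x)).
Proof. by move=> mf; apply: (measurableT_comp (f := @expR R)). Qed.

Lemma msr_inv f : (forall x, f x != 0) -> msr f -> msr (fun x => (f x)^-1).
Proof.
move=> f0 mf.
apply: (@measurable_comp _ _ _ _ _ _ [set x : R | x != 0] (@GRing.inv R)) => //.
- by apply: open_measurable; exact: open_neq.
- by move=> _ [x _ <-]; exact: f0.
- apply: open_continuous_measurable_fun; first exact: open_neq.
  by move=> x /set_mem x0; exact: inv_continuous.
Qed.

Lemma msr_indic (A : set R) : measurable A -> msr (\1_A : R -> R).
Proof. by move=> mA; exact: measurable_indic. Qed.

Lemma L1_norm f : L1 f -> L1 (fun x => `|f x|).
Proof. by move=> ?; exact: integrable_norm. Qed.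

Lemma L1_dom f g : msr f -> L1 g -> (forall x, `|f x| <= g x) -> L1 f.
Proof.
move=> mf Lg fg; apply: (le_integrable _ _ _ Lg) => //.
  exact/measurable_EFinP.
by move=> x _ /=; rewrite lee_fin (le_trans (fg x))// ler_norm.
Qed.

Lemma L1_cst0 : L1 (fun=> 0 : R).
Proof. exact: integrable0. Qed.

Lemma L1D f g : L1 f -> L1 g -> L1 (fun x => f x + g x).
Proof. by move=> Lf Lg; exact: (integrableD _ Lf Lg). Qed.

Lemma L1Z (c : R) f : L1 f -> L1 (fun x => c * f x).
Proof. by move=> Lf; exact: (integrableZl measurableT c Lf). Qed.

Lemma L1Zr (c : R) f : L1 f -> L1 (fun x => f x * c).
Proof.
by move=> Lf; have := L1Z c Lf; congr L1; apply/funext => x; rewrite mulrC.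
Qed.

Lemma L1N f : L1 f -> L1 (fun x => - f x).
Proof. by move=> Lf; exact: (integrableN Lf). Qed.

Lemma L1B f g : L1 f -> L1 g -> L1 (fun x => f x - g x).
Proof. by move=> Lf /L1N Lg; exact: L1D. Qed.

Lemma L1_sum (n : nat) (F : nat -> R -> R) : (forall k, L1 (F k)) ->
  L1 (fun x => \sum_(k < n) F k x).
Proof.
move=> LF; elim: n => [|n ih].
  by under eq_fun do rewrite big_ord0; exact: L1_cst0.
by under eq_fun do rewrite big_ord_recr /=; exact: L1D.
Qed.

Lemma L1_mul_bounded (M : R) f g : L1 f -> msr g -> (forall x, `|g x| <= M) ->
  L1 (fun x => f x * g x).
Proof.
move=> Lf mg gM; apply: (@L1_dom _ (fun x => `|f x| * M)).
- by apply: msrM => //; exact: msr_L1.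
- exact/L1Zr/L1_norm.
- by move=> x; rewrite normrM ler_wpM2l.
Qed.

Lemma int_eq f g : f =1 g -> \int[mu]_x f x = \int[mu]_x g x.
Proof. by move=> fg; apply: eq_Rintegral => x _. Qed.

Lemma intD f g : L1 f -> L1 g ->
  \int[mu]_x (f x + g x) = \int[mu]_x f x + \int[mu]_x g x.
Proof. by move=> Lf Lg; rewrite RintegralD. Qed.

Lemma intB f g : L1 f -> L1 g ->
  \int[mu]_x (f x - g x) = \int[mu]_x f x - \int[mu]_x g x.
Proof. by move=> Lf Lg; rewrite RintegralB. Qed.

Lemma intZ (c : R) f : L1 f -> \int[mu]_x (c * f x) = c * \int[mu]_x f x.
Proof. by move=> Lf; rewrite RintegralZl. Qed.

Lemma intZr (c : R) f : L1 f -> \int[mu]_x (f x * c) = \int[mu]_x f x * c.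
Proof. by move=> Lf; rewrite RintegralZr. Qed.

Lemma int_sum (n : nat) (F : nat -> R -> R) : (forall k, L1 (F k)) ->
  \int[mu]_x (\sum_(k < n) F k x) = \sum_(k < n) \int[mu]_x F k x.
Proof.
move=> LF; elim: n => [|n ih].
  rewrite big_ord0; under int_eq do rewrite big_ord0.
  by rewrite /Rintegral integral0.
rewrite big_ord_recr /= -ih -intD//; last exact: L1_sum.
by apply: int_eq => x; rewrite big_ord_recr.
Qed.

Lemma int_ge0 f : (forall x, 0 <= f x) -> 0 <= \int[mu]_x f x.
Proof. by move=> f0; apply: Rintegral_ge0 => x _. Qed.

Lemma int_le f g : L1 f -> L1 g -> (forall x, f x <= g x) ->
  \int[mu]_x f x <= \int[mu]_x g x.
Proof. by move=> Lf Lg fg; apply: le_Rintegral. Qed.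

Lemma int_norm f : L1 f -> `|\int[mu]_x f x| <= \int[mu]_x `|f x|.
Proof. by move=> Lf; apply: le_normr_Rintegral. Qed.

Lemma int_norm_le f g : L1 f -> L1 g -> (forall x, `|f x| <= g x) ->
  `|\int[mu]_x f x| <= \int[mu]_x g x.
Proof.
move=> Lf Lg fg; apply: (le_trans (int_norm Lf)).
by apply: int_le => //; exact: L1_norm.
Qed.

Lemma int_EFin f : L1 f -> ((\int[mu]_x f x)%:E = \int[mu]_x (f x)%:E)%E.
Proof. by move=> Lf; rewrite /Rintegral fineK// integrable_fin_num. Qed.

Lemma ae_imp (P Q : set R) : P `<=` Q ->
  {ae mu, forall x, P x} -> {ae mu, forall x, Q x}.
Proof. exact: (@filterS _ _ (ae_filter_ringOfSetsType mu)). Qed.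

Lemma ae_and (P Q : set R) : {ae mu, forall x, P x} -> {ae mu, forall x, Q x} ->
  {ae mu, forall x, P x /\ Q x}.
Proof. exact: (@filterI _ _ (ae_filter_ringOfSetsType mu)). Qed.

Lemma ae_all (P : set R) : (forall x, P x) -> {ae mu, forall x, P x}.
Proof. by move=> h; apply: (@filterE _ _ (ae_filter_ringOfSetsType mu)). Qed.

Lemma int_ae_eq f g : L1 f -> msr g -> {ae mu, forall x, f x = g x} ->
  \int[mu]_x f x = \int[mu]_x g x.
Proof.
move=> Lf mg fg; congr fine; apply: ae_eq_integral => //.
- by have /measurable_EFinP := msr_L1 Lf.
- exact/measurable_EFinP.
- by apply: ae_imp fg => x /= -> _.
Qed.

Lemma L1_ae_eq f g : L1 f -> msr g -> {ae mu, forall x, f x = g x} -> L1 g.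
Proof.
move=> Lf mg fg; apply/integrableP; split; first exact/measurable_EFinP.
have /integrableP[mf] := Lf; apply: le_lt_trans.
rewrite le_eqVlt; apply/orP; left; apply/eqP.
apply: ae_eq_integral => //.
- by apply: measurableT_comp => //; exact/measurable_EFinP.
- by apply: measurableT_comp.
- by apply: ae_imp fg => x /= -> _.
Qed.

Lemma dominated_cvg_int (F : nat -> R -> R) f g : (forall n, msr (F n)) -> msr f -> L1 g ->
  {ae mu, forall x, F n x @[n --> \oo] --> f x} ->
  (forall n x, `|F n x| <= g x) ->
  L1 f /\ \int[mu]_x F n x @[n --> \oo] --> \int[mu]_x f x.
Proof.
move=> mF mf Lg Ff Fg.
have [] := @dominated_convergence _ _ _ mu _ measurableT
  (fun n x => (F n x)%:E) (EFin \o f) (EFin \o g).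
- by move=> n; apply/measurable_EFinP; exact: mF.
- exact/measurable_EFinP.
- by apply: ae_imp Ff => x h _; apply: cvg_EFin h; exact: nearW.
- exact: Lg.
- by apply: ae_all => x n _; rewrite /= lee_fin.
move=> Lf _ h; split => //.
rewrite /Rintegral; apply: fine_cvg; rewrite fineK//.
exact: integrable_fin_num.
Qed.

(** A product majorant with integrable factors makes [F] integrable on the plane by Tonelli, after
    which Fubini applies. Transforms of integrable functions always come with such a majorant. *)
Lemma fubini_int (F : R -> R -> R) f g :
  measurable_fun [set: R * R] (fun p => F p.1 p.2) -> L1 f -> L1 g ->
  (forall x y, `|F x y| <= f x * g y) ->
  [/\ L1 (fun x => \int[mu]_y F x y), L1 (fun y => \int[mu]_x F x y) &
  \int[mu]_x \int[mu]_y F x y = \int[mu]_y \int[mu]_x F x y].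
Proof.
move=> mF Lf Lg Fle.
have mFe : measurable_fun [set: R * R] (fun p => (F p.1 p.2)%:E).
  exact/measurable_EFinP.
have mF1 x : msr (F x).
  exact: (measurableT_comp mF (pair1_measurable x)).
have mF2 y : msr (F ^~ y).
  exact: (measurableT_comp mF (pair2_measurable y)).
have L2 y : L1 (F ^~ y) by apply: (@L1_dom _ (fun x => f x * g y)) => //; exact: L1Zr.
have L1' x : L1 (F x) by apply: (@L1_dom _ (fun y => f x * g y)) => //; exact: L1Z.
have iF : (mu \x mu)%E.-integrable [set: R * R] (fun p => (F p.1 p.2)%:E).
  apply/(integrable12ltyP mu mu mFe) => /=.
  apply: (@le_lt_trans _ _ (\int[mu]_x ((f x * \int[mu]_y g y)%:E))%E).
    apply: ge0_le_integral => //=.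
    - by move=> x _; apply: integral_ge0.
    - have := @measurable_fun_fubini_tonelli_F _ _ _ _ R mu
        (fun p => `|F p.1 p.2|%:E).
      by apply => //; apply/measurable_EFinP; exact: measurableT_comp.
    - apply/measurable_EFinP; apply: measurable_funM => //; exact: msr_L1.
    - move=> x _; rewrite -intZ// int_EFin//; last exact: L1Z.
      apply: ge0_le_integral => //=.
      + by apply/measurable_EFinP; exact: (msr_norm (mF1 x)).
      + by have /measurable_EFinP := msr_L1 (L1Z (f x) Lg).
      + by move=> y _; rewrite lee_fin.
  exact: integrable_lty (L1Zr _ Lf).
have iFE : (EFin \o (fun x => \int[mu]_y F x y)) = (fun x => \int[mu]_y (F x y)%:E)%E.
  by apply/funext => x /=; rewrite int_EFin.
have iGE : (EFin \o (fun y => \int[mu]_x F x y)) = (fun y => \int[mu]_x (F x y)%:E)%E.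
  by apply/funext => x /=; rewrite int_EFin.
split.
- by rewrite /L1 iFE; exact: (integrable_fubini_F iF).
- apply: (@L1_dom _ (fun y => (\int[mu]_x f x) * g y)); last first.
  + move=> y; rewrite -intZr//; apply: int_norm_le => //; exact: L1Zr.
  + exact: L1Z.
  + apply/measurable_EFinP; rewrite iGE; exact: (measurable_fubini_G iF).
- have E1 : (\int[mu]_x (\int[mu]_y F x y)%R%:E = \int[mu]_x \int[mu]_y (F x y)%:E)%E.
    by apply: eq_integral => x _; rewrite int_EFin.
  have E2 : (\int[mu]_y (\int[mu]_x F x y)%R%:E = \int[mu]_y \int[mu]_x (F x y)%:E)%E.
    by apply: eq_integral => x _; rewrite int_EFin.
  by have /= := Fubini iF; rewrite -E1 -E2 => /(congr1 fine).
Qed.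

End integration.

Ltac solve_msr := repeat first
  [ assumption | exact: msr_id | exact: msr_cst | apply: msr_cos | apply: msr_sin
  | apply: msr_expR | apply: msr_norm | apply: msrX | apply: msrN
  | apply: msrM | apply: msrB | apply: msrD
  | (apply: msr_indic; exact: measurable_itv) | (apply: msr_L1; assumption) ].

(** * Square-integrable functions, integrals over intervals, primitives *)

Section L2_tools.
Context {R : realType}.
Local Notation mu := (@lebesgue_measure R).
Implicit Types f g h : R -> R.

Lemma sq_int_mul f g : sq_int f -> sq_int g -> L1 (fun x => f x * g x).
Proof.
move=> [mf Lf] [mg Lg]; apply: (@L1_dom _ _ (fun x => f x ^+ 2 + g x ^+ 2)).
- exact: msrM.
- exact: L1D.
- move=> x; rewrite normrM -[f x ^+ 2]real_normK ?num_real//.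
  rewrite -[g x ^+ 2]real_normK ?num_real//; set a := `|f x|; set b := `|g x|.
  have : 0 <= a by exact: normr_ge0.
  have : 0 <= b by exact: normr_ge0.
  nra.
Qed.

Lemma sq_intZ (c : R) f : sq_int f -> sq_int (fun x => c * f x).
Proof.
move=> [mf Lf]; split; first by apply: msrM => //; exact: msr_cst.
by under eq_fun do rewrite exprMn; exact: L1Z.
Qed.

Lemma sq_intD f g : sq_int f -> sq_int g -> sq_int (fun x => f x + g x).
Proof.
move=> sf sg; split; first by apply: msrD; [exact: sf.1|exact: sg.1].
have := L1D (L1D sf.2 sg.2) (L1Z 2 (sq_int_mul sf sg)).
by congr L1; apply/funext => x; ring.
Qed.

Lemma sq_intN f : sq_int f -> sq_int (fun x => - f x).
Proof.
by move=> /(sq_intZ (-1)); congr sq_int; apply/funext => x; rewrite mulN1r.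
Qed.

Lemma sq_intB f g : sq_int f -> sq_int g -> sq_int (fun x => f x - g x).
Proof. by move=> sf /sq_intN; exact: sq_intD. Qed.

Lemma sq_int_sum (n : nat) (F : nat -> R -> R) :
  (forall k, (k < n)%N -> sq_int (F k)) -> sq_int (fun x => \sum_(k < n) F k x).
Proof.
elim: n => [|n ih] sF.
  under eq_fun do rewrite big_ord0.
  split; first exact: msr_cst.
  by under eq_fun do rewrite expr0n; exact: L1_cst0.
under eq_fun do rewrite big_ord_recr /=.
by apply: sq_intD; [apply: ih => k kn; apply: sF; exact: ltnW|exact: sF].
Qed.

Lemma sq_int_dom f g : msr f -> sq_int g -> (forall x, `|f x| <= `|g x|) ->
  sq_int f.
Proof.
move=> mf [mg Lg] fg; split => //; apply: (L1_dom _ Lg); first exact: msrX.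
move=> x; rewrite ger0_norm ?sqr_ge0//.
by rewrite -[leLHS]real_normK ?num_real// -[leRHS]real_normK ?num_real// ler_sqr.
Qed.

(** The quadratic form sending [(s, t)] to the integral of [(s f + t g)^2] is nonnegative; one
    suitable pair gives the inequality. *)
Lemma cauchy_schwarz f g : sq_int f -> sq_int g ->
  (\int[mu]_x (f x * g x)) ^+ 2 <=
  (\int[mu]_x f x ^+ 2) * (\int[mu]_x g x ^+ 2).
Proof.
move=> sf sg; have Lfg := sq_int_mul sf sg.
set A := \int[mu]_x (f x ^+ 2); set B := \int[mu]_x (g x ^+ 2).
set C := \int[mu]_x (f x * g x).
have A0 : 0 <= A by apply: int_ge0 => x; exact: sqr_ge0.
have B0 : 0 <= B by apply: int_ge0 => x; exact: sqr_ge0.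
have quad s t : 0 <= s ^+ 2 * A + 2 * s * t * C + t ^+ 2 * B.
  have -> : s ^+ 2 * A + 2 * s * t * C + t ^+ 2 * B =
      \int[mu]_x (s * f x + t * g x) ^+ 2.
    rewrite /A /B /C -(intZ _ sf.2) -(intZ _ sg.2) -(intZ _ Lfg).
    rewrite -intD; [|by apply: L1Z; exact: sf.2|by apply: L1Z].
    rewrite -intD; [|by apply: L1D; apply: L1Z => //; exact: sf.2
                    |by apply: L1Z; exact: sg.2].
    by apply: int_eq => x; ring.
  by apply: int_ge0 => x; exact: sqr_ge0.
have [B00|BN0] := eqVneq B 0.
  (* With [B = 0] this pair leaves [- C^2 (A + 2) >= 0], which forces [C = 0]. In the other case the
     pair [(B, - C)] yields [B (A B - C^2) >= 0]. *)
  have := quad C (- (A + 1)); rewrite B00 mulr0 addr0 => h.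
  have : C ^+ 2 * (A + 2) <= 0 by nra.
  have C2 : 0 <= C ^+ 2 by exact: sqr_ge0.
  nra.
have Bpos : 0 < B by rewrite lt_neqAle eq_sym BN0.
have := quad B (- C) => h.
have : 0 <= B * (A * B - C ^+ 2) by nra.
by rewrite pmulr_rge0// subr_ge0.
Qed.

Lemma cauchy_schwarz_norm f g : sq_int f -> sq_int g ->
  `|\int[mu]_x (f x * g x)| <=
  Num.sqrt (\int[mu]_x f x ^+ 2) * Num.sqrt (\int[mu]_x g x ^+ 2).
Proof.
move=> sf sg; rewrite -sqrtrM; last by apply: int_ge0 => x; exact: sqr_ge0.
by rewrite -sqrtr_sqr ler_wsqrtr// cauchy_schwarz.
Qed.

Lemma L2P f : L2 f <-> sq_int f.
Proof.
split.
  move=> Lf; split; last exact: Lfun2_integrable_sqr.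
  by move: Lf; rewrite /L2 /= inE => /andP[+ _]; rewrite inE.
move=> [mf Lf]; rewrite /L2 /= inE; apply/andP; split; first by rewrite inE.
rewrite inE/= /finite_norm unlock; apply: poweR_lty.
have -> : (\int[mu]_x (`|(EFin \o f) x| `^ 2) = \int[mu]_x (f x ^+ 2)%:E)%E.
  apply: eq_integral => x _; rewrite /= powR_mulrn//.
  by rewrite real_normK// num_real.
exact: integrable_lty.
Qed.

Lemma L2_normE f : sq_int f ->
  L2_norm f = (Num.sqrt (\int[mu]_x f x ^+ 2))%:E.
Proof.
move=> [mf Lf]; rewrite /L2_norm unlock.
have -> : (\int[mu]_x (`|(EFin \o f) x| `^ 2) = \int[mu]_x (f x ^+ 2)%:E)%E.
  apply: eq_integral => x _; rewrite /= powR_mulrn//.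
  by rewrite real_normK// num_real.
rewrite -int_EFin// poweR_EFin powR12_sqrt//.
by apply: int_ge0 => x; exact: sqr_ge0.
Qed.

(** A finite [L2_norm] carries square integrability with it. This turns the extended-real estimates
    of the definitions into statements on real integrals. *)
Lemma L2_norm_lt_sq_int f (e : R) : msr f -> (L2_norm f < e%:E)%E ->
  sq_int f /\ \int[mu]_x f x ^+ 2 < e ^+ 2.
Proof.
move=> mf fe.
have sf : sq_int f.
  apply/L2P; rewrite /L2 /= inE; apply/andP; split; first by rewrite inE.
  by rewrite inE/= /finite_norm (lt_le_trans fe)// leey.
split => //; move: fe; rewrite L2_normE// lte_fin => fe.
have I0 : 0 <= \int[mu]_x f x ^+ 2 by apply: int_ge0 => x; exact: sqr_ge0.
rewrite -[ltLHS]sqr_sqrtr// ltr_sqr ?nnegrE ?sqrtr_ge0//.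
by apply: ltW; apply: le_lt_trans fe; exact: sqrtr_ge0.
Qed.

Lemma int_set f (A : set R) :
  \int[mu]_(x in A) f x = \int[mu]_x (\1_A x * f x).
Proof.
rewrite Rintegral_mkcond; apply: int_eq => x; rewrite patchE indicE.
by case: ifPn => _; rewrite ?mul1r ?mul0r.
Qed.

Lemma L1_set f (A : set R) : measurable A ->
  mu.-integrable A (EFin \o f) <-> L1 (fun x => \1_A x * f x).
Proof.
move=> mA; rewrite integrable_mkcond// /L1.
rewrite (_ : (EFin \o f) \_ A = EFin \o (fun x => \1_A x * f x))//.
apply/funext => x /=; rewrite patchE indicE.
by case: ifPn => _; rewrite ?mul1r ?mul0r.
Qed.

Lemma L1_indic (A : set R) f : measurable A -> L1 f -> L1 (fun x => \1_A x * f x).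
Proof.
move=> mA Lf; apply/(L1_set _ mA).
by apply: integrableS Lf.
Qed.

Lemma L1_itv (a b : R) : L1 (\1_(`[a, b]) : R -> R).
Proof. exact: integrable_indic_itv. Qed.

Lemma L1_itv_bounded (a b M : R) f : msr f -> (forall x, `|f x| <= M) ->
  L1 (fun x => \1_(`[a, b]) x * f x).
Proof. by move=> mf fM; apply: (L1_mul_bounded _ mf fM); exact: L1_itv. Qed.

Lemma int_itv1 (a b : R) : a <= b -> \int[mu]_x (\1_(`[a, b]) x : R) = b - a.
Proof.
move=> ab; have := @Rintegral_cst _ _ R mu `[a, b] (measurable_itv _) 1.
rewrite int_set; under int_eq do rewrite mulr1.
move=> ->; rewrite mul1r /= lebesgue_measure_itv/= lte_fin.
by case: ltgtP ab => // -> _; rewrite subrr.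
Qed.

Lemma ftc_itv (a b : R) f (F : R -> R) : a <= b -> continuous f ->
  (forall x : R, is_derive x 1 F (f x)) ->
  \int[mu]_x (\1_(`[a, b]) x * f x) = F b - F a.
Proof.
rewrite le_eqVlt => /predU1P[<- _ _|ab cf dF].
  by rewrite -int_set set_itv1 Rintegral_set1 subrr.
have cF : continuous F.
  by move=> x; apply: differentiable_continuous; apply/derivable1_diffP; exact: ex_derive.
rewrite -int_set /Rintegral (@continuous_FTC2 R f F a b)//.
- exact: continuous_subspaceT.
- split; first by move=> x _; exact: ex_derive.
    by apply: cvg_at_right_filter; exact: cF.
  by apply: cvg_at_left_filter; exact: cF.
- by move=> x _; rewrite derive1E derive_val.
Qed.

(** For a nonnegative integrand one half-line primitive gives both conclusions: the extended
    integral, twice the increment of [F] by symmetry, comes out finite. *)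
Lemma even_L1 f (F : R -> R) (l : R) : (forall x, 0 <= f x) -> continuous f ->
  (forall x, f (- x) = f x) -> F x @[x --> +oo] --> l ->
  (forall x : R, 0 <= x -> is_derive x 1 F (f x)) ->
  L1 f /\ \int[mu]_x f x = 2 * (l - F 0).
Proof.
move=> f0 cf ef Fl dF.
have E : (\int[mu]_x (f x)%:E = (2 * (l - F 0))%:E)%E.
  rewrite ge0_symfun_integralT//; last by move=> x /=; rewrite ef.
  rewrite (_ : [set x | _] = `[0, +oo[%classic); last first.
    by apply/seteqP; split => x/=; rewrite in_itv/= andbT.
  rewrite (@ge0_continuous_FTC2y _ f F 0 l)//.
  - exact: continuous_subspaceT.
  - by move=> x /ltW x0; have := dF x x0 => -[].
  - apply: cvg_at_right_filter; apply: differentiable_continuous.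
    by apply/derivable1_diffP; have [] := dF 0 (lexx _).
  - move=> x; rewrite in_itv/= andbT => /ltW x0.
    by rewrite derive1E; have [_ ->] := dF x x0.
have mf : msr f by exact: msr_continuous.
split; last by rewrite /Rintegral E.
apply/integrableP; split; first exact/measurable_EFinP.
under eq_integral do rewrite /= ger0_norm//.
by rewrite E ltry.
Qed.

End L2_tools.

                           

(** * Explicit integrals: Cauchy, exponential, Poisson and Bessel weights *)

Section kernels.
Context {R : realType}.
Local Notation mu := (@lebesgue_measure R).
Implicit Types f g h : R -> R.

Lemma is_derive_scaled (F : R -> R) (r x a : R) : is_derive (r * x) 1 F a ->
  is_derive x 1 (fun y => F (r * y)) (r * a).
Proof.
move=> dF.
have dr : is_derive x 1 (fun y : R => r * y) r.
  by apply: (@is_derive_eq _ _ _ (r \*: id)); rewrite /GRing.scale /= mulr1.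
have := @is_derive1_comp R F (fun y => r * y) x a r dF dr.
by rewrite mulrC.
Qed.

Lemma is_derive_cos_scaled (r x : R) :
  is_derive x 1 (fun y => cos (r * y)) (- (r * sin (r * x))).
Proof. by rewrite -mulrN; exact: is_derive_scaled. Qed.

Lemma is_derive_sin_scaled (r x : R) :
  is_derive x 1 (fun y => sin (r * y)) (r * cos (r * x)).
Proof. exact: is_derive_scaled. Qed.

Lemma is_derive_expR_scaled (r x : R) :
  is_derive x 1 (fun y => expR (r * y)) (r * expR (r * x)).
Proof. exact: is_derive_scaled. Qed.

Lemma continuous_derive f : (forall x : R, derivable f x 1) -> continuous f.
Proof.
by move=> df x; apply: differentiable_continuous; apply/derivable1_diffP.
Qed.

Lemma continuous_scale_norm (r : R) : continuous (fun x : R => r * `|x|).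
Proof. by move=> x; apply: cvgM; [exact: cvg_cst|exact: norm_continuous]. Qed.

(** The factor [r] keeps the mass equal to [pi] at every scale, so that powers of [r] stay explicit
    in later estimates. *)
Lemma cauchy_weight (r : R) : 0 < r ->
  L1 (fun x => r * (1 + (r * x) ^+ 2)^-1) /\
  \int[mu]_x (r * (1 + (r * x) ^+ 2)^-1) = pi.
Proof.
move=> r0.
have n0 (y : R) : 1 + y ^+ 2 != 0 by rewrite gt_eqF// ltr_pwDl// sqr_ge0.
have := @even_L1 R (fun x => r * (1 + (r * x) ^+ 2)^-1) (fun x => atan (r * x))
  (pi / 2).
rewrite mulr0 atan0 subr0 (mulrC 2) divfK//; apply.
- by move=> x; rewrite mulr_ge0 ?invr_ge0 ?addr_ge0 ?sqr_ge0// ltW.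
- move=> x; apply: cvgM; first exact: cvg_cst.
  apply: cvgV => //; apply: cvgD; first exact: cvg_cst.
  apply: (@continuous_comp _ _ _ (fun y => r * y) (fun y => y ^+ 2)).
    exact: mulrl_continuous.
  exact: exprn_continuous.
- by move=> x; rewrite mulrN sqrrN.
- apply: (cvg_comp (fun x => r * x) atan); last exact: cvgy_atan.
  by apply: gt0_cvgMry => //; exact: cvg_id.
- by move=> x _; exact: is_derive_scaled.
Qed.

Lemma cvg_expR_scaled (e : R) : 0 < e -> expR (- e * x) @[x --> +oo] --> (0 : R).
Proof.
move=> e0; under eq_fun do rewrite mulNr.
apply: (cvg_comp (fun x => e * x) (fun x => expR (- x))); last exact: cvgr_expR.
by apply: gt0_cvgMry => //; exact: cvg_id.
Qed.

Lemma exp_weight (e : R) : 0 < e ->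
  L1 (fun x => expR (- e * `|x|)) /\ \int[mu]_x expR (- e * `|x|) = 2 / e.
Proof.
move=> e0.
have := @even_L1 R (fun x => expR (- e * `|x|)) (fun x => - e^-1 * expR (- e * x)) 0.
rewrite mulr0 expR0 mulr1 sub0r opprK; apply.
- by move=> x; exact: expR_ge0.
- move=> x; apply: (@continuous_comp _ _ _ (fun x => - e * `|x|) expR).
    exact: continuous_scale_norm.
  exact: continuous_expR.
- by move=> x; rewrite normrN.
- rewrite -[X in _ --> X](mulr0 (- e^-1)).
  by apply: cvgM; [exact: cvg_cst|exact: cvg_expR_scaled].
- move=> x x0; rewrite ger0_norm//.
  have dE := is_derive_expR_scaled (- e) x.
  apply: (@is_derive_eq _ _ _ (- e^-1 \*: (fun x => expR (- e * x)))).
  rewrite /GRing.scale /=; field; exact: lt0r_neq0.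
Qed.

                                                                                 
                                
(** The integrand changes sign, so [even_L1] is applied with [1 + cos (z x)] in place of the cosine,
    and the integral of the exponential alone is subtracted. As a function of [z] the result is
    [2 pi] times the Poisson kernel at height [e]. *)
Lemma poisson_kernel (e z : R) : 0 < e ->
  \int[mu]_x (expR (- e * `|x|) * cos (z * x)) = 2 * e / (e ^+ 2 + z ^+ 2).
Proof.
move=> e0; have [Le Ie] := exp_weight e0.
have ez : 0 < e ^+ 2 + z ^+ 2 by rewrite ltr_wpDr ?sqr_ge0 ?exprn_gt0.
(* [H] is bounded and [expR (- e x) H x] is a primitive on the half-line, so this primitive tends to
   0 at infinity. *)
pose H (x : R) := (z * sin (z * x) - e * cos (z * x)) / (e ^+ 2 + z ^+ 2) - e^-1.
have [] := @even_L1 R (fun x => expR (- e * `|x|) * (1 + cos (z * x)))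
  (fun x => expR (- e * x) * H x) 0.
- move=> x; rewrite mulr_ge0 ?expR_ge0//; have := cos_geN1 (z * x); lra.
- move=> x; apply: cvgM.
    apply: (@continuous_comp _ _ _ (fun x => - e * `|x|) expR).
      exact: continuous_scale_norm.
    exact: continuous_expR.
  apply: cvgD; first exact: cvg_cst.
  apply: continuous_derive => y.
  by have [] := is_derive_cos_scaled z y.
- by move=> x; rewrite normrN mulrN cosN.
- pose C := (`|z| + e) / (e ^+ 2 + z ^+ 2) + e^-1.
  have HC x : `|H x| <= C.
    rewrite /H /C (le_trans (ler_normB _ _))// (ger0_norm (x := e^-1)) ?invr_ge0 ?(ltW e0)//.
    rewrite lerD2r normrM (ger0_norm (x := _^-1)) ?invr_ge0 ?(ltW ez)//.
    rewrite ler_wpM2r ?invr_ge0 ?(ltW ez)// (le_trans (ler_normB _ _))//.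
    rewrite !normrM (ger0_norm (ltW e0)) lerD//.
      by rewrite ler_piMr// sin_max.
    by rewrite ler_piMr// ?cos_max// ltW.
  apply/norm_cvg0P.
  apply: (@squeeze_cvgr _ _ _ _ (fun=> 0) (fun x => expR (- e * x) * C)).
  + apply: nearW => x; rewrite normr_ge0 normrM ger0_norm ?expR_ge0//=.
    by rewrite ler_wpM2l ?expR_ge0.
  + exact: cvg_cst.
  + rewrite -[X in _ --> X](mul0r C).
    by apply: cvgM; [exact: cvg_expR_scaled|exact: cvg_cst].
- move=> x x0; rewrite ger0_norm//.
  have dE := is_derive_expR_scaled (- e) x.
  have dC := is_derive_cos_scaled z x.
  have dS := is_derive_sin_scaled z x.
  have dH : is_derive x 1 H ((z * (z * cos (z * x)) + e * (z * sin (z * x))) / (e ^+ 2 + z ^+ 2)).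
    pose h := ((e ^+ 2 + z ^+ 2)^-1 \*: ((z \*: (fun y => sin (z * y))) - (e \*: (fun y => cos (z * y)))))
       - cst (e^-1) : R -> R.
    have -> : H = h.
      by apply/funext => y; rewrite /H /h /= !fctE /GRing.scale/= mulrC.
    rewrite /h; apply: is_derive_eq; rewrite /GRing.scale/= subr0 mulrC; ring.
  apply: is_derive_eq; rewrite /GRing.scale /= /H.
  by field; rewrite gt_eqF//= gt_eqF.
move=> L I.
have E : \int[mu]_x (expR (- e * `|x|) * (1 + cos (z * x))) =
   \int[mu]_x expR (- e * `|x|) + \int[mu]_x (expR (- e * `|x|) * cos (z * x)).
  rewrite -intD//; last first.
    apply: (L1_mul_bounded (M := 1)) => //; last by move=> x; exact: cos_max.
    solve_msr.
  by apply: int_eq => x; rewrite mulrDr mulr1.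
have : \int[mu]_x (expR (- e * `|x|) * cos (z * x)) =
  2 * (0 - expR (- e * 0) * H 0) - 2 / e by rewrite -I -Ie E; ring.
move=> ->; rewrite /H !mulr0 expR0 sin0 cos0; field.
by rewrite gt_eqF//= gt_eqF.
Qed.

Lemma continuous_powR_1norm (a : R) : continuous (fun x : R => (1 + `|x|) `^ a).
Proof.
move=> x; apply: (@continuous_comp _ _ _ (fun x : R => 1 + `|x|) (fun y => y `^ a)).
  by apply: cvgD; [exact: cvg_cst|exact: norm_continuous].
apply: differentiable_continuous; apply/derivable1_diffP.
by apply: derivable_powR; rewrite in_itv/= andbT ltr_pwDl.
Qed.

(** Since [(1 + |x|)^2 <= 2 (1 + x^2)], the weight is dominated by [2^s (1 + |x|)^(- 2 s)], which
    has an explicit primitive decaying at infinity because [2 s > 1]. *)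
Lemma bessel_weight (s : R) : 1 / 2 < s -> L1 (fun x => (1 + x ^+ 2) `^ (- s)).
Proof.
move=> s2.
have [] := @even_L1 R (fun x => (1 + `|x|) `^ (- (2 * s)))
  (fun x => - (2 * s - 1)^-1 * (1 + x) `^ (1 - 2 * s)) 0.
- by move=> x; exact: powR_ge0.
- exact: continuous_powR_1norm.
- by move=> x; rewrite normrN.
- rewrite -[X in _ --> X](mulr0 (- (2 * s - 1)^-1)).
  apply: cvgM; first exact: cvg_cst.
  apply/cvgrPdist_le => e e0.
  near=> x.
  have x0 : 0 <= x by near: x; apply: nbhs_pinfty_ge; rewrite num_real.
  rewrite sub0r normrN ger0_norm ?powR_ge0//.
  have ps : 0 < 2 * s - 1 by lra.
  have xe : (e^-1) `^ (2 * s - 1)^-1 <= 1 + x.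
    have : (e^-1) `^ (2 * s - 1)^-1 <= x by near: x; apply: nbhs_pinfty_ge; rewrite num_real.
    lra.
  rewrite -opprB powRN invf_ple ?posrE ?powR_gt0//; last by rewrite ltr_pwDl.
  rewrite -[leLHS]powRr1 ?invr_ge0 ?(ltW e0)// -[X in _ `^ X <= _](@mulVf _ (2 * s - 1)) ?gt_eqF//.
  rewrite powRrM; apply: ge0_ler_powR => //; rewrite ?nnegrE.
  - exact: ltW.
  - exact: powR_ge0.
  - exact: addr_ge0.
- move=> x x0; rewrite ger0_norm//.
  have x1 : 0 < 1 + x by rewrite ltr_pwDl.
  have d1 : is_derive x 1 (fun y : R => 1 + y) 1.
    have -> : (fun y : R => 1 + y) = cst 1 + id :> (R -> R) by apply/funext.
    by apply: is_derive_eq; rewrite add0r.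
  have dp := is_derive1_powR (1 - 2 * s) x1.
  have dc := @is_derive1_comp R (fun y => y `^ (1 - 2 * s)) (fun y => 1 + y) x _ _ dp d1.
  apply: (@is_derive_eq _ _ _ (- (2 * s - 1)^-1 \*: ((fun y => y `^ (1 - 2 * s)) \o (fun y => 1 + y)))).
  rewrite /GRing.scale /= mulr1 (_ : 1 - 2 * s - 1 = - (2 * s)); last by ring.
  by field; rewrite gt_eqF//; lra.
move=> L _.
apply: (L1_dom _ (L1Z (2 `^ s) L)).
  have m2 : msr (fun x : R => 1 + x ^+ 2) by solve_msr.
  exact: (@measurableT_comp _ _ _ _ _ _ (fun y => y `^ (- s))).
move=> x; rewrite ger0_norm ?powR_ge0//.
have x2 : 0 < 1 + x ^+ 2 by rewrite ltr_pwDl// sqr_ge0.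
have x1 : 0 < 1 + `|x| by rewrite ltr_pwDl.
rewrite !powRN -ler_pdivrMl ?powR_gt0// -invfM lef_pV2 ?posrE ?mulr_gt0 ?powR_gt0//.
have -> : (1 + `|x|) `^ (2 * s) = ((1 + `|x|) ^+ 2) `^ s.
  by rewrite powRrM powR_mulrn// ltW.
rewrite -powRM ?(ltW x2)//.
have s0 : 0 <= s by lra.
apply: ge0_ler_powR => //; rewrite ?nnegrE.
- exact: sqr_ge0.
- by rewrite mulr_ge0// ltW.
- by rewrite -(real_normK (num_real x)); have := sqr_ge0 (1 - `|x|); nra.
Unshelve. all: by end_near. Qed.

End kernels.

                                   

(** * Cosine and sine transforms of integrable functions *)

Definition trig {R : realType} (b : bool) (y : R) : R := if b then cos y else sin y.

(** The integral of [f(x) exp(- i x xi)] is [ft true f xi - i ft false f xi]; the two real parts are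
    studied in parallel through the boolean. *)
Definition ft {R : realType} (b : bool) (f : R -> R) (xi : R) : R :=
  \int[@lebesgue_measure R]_x (f x * trig b (x * xi)).

                                     
(** The sign makes [fcomp b] of the complex transform match [ft b], the sine integral being minus
    the imaginary part. *)
Definition fcomp {R : realType} (b : bool) (z : R[i]) : R :=
  if b then complex.Re z else - complex.Im z.

Section transforms.
Context {R : realType}.
Local Notation mu := (@lebesgue_measure R).
Implicit Types f g h : R -> R.

Lemma trig_max b (y : R) : `|trig b y| <= 1.
Proof. by case: b; [exact: cos_max|exact: sin_max]. Qed.

Lemma msr_trig b f : msr f -> msr (fun x => trig b (f x)).
Proof. by case: b; [exact: msr_cos|exact: msr_sin]. Qed.

Lemma lipschitz_derive (F f : R -> R) :
  (forall x : R, is_derive x 1 F (f x)) -> (forall x, `|f x| <= 1) ->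
  forall y z, `|F y - F z| <= `|y - z|.
Proof.
move=> dF f1.
suff H y z : y <= z -> `|F z - F y| <= z - y.
  move=> y z; have [yz|/ltW zy] := leP y z.
    by rewrite distrC (le_trans (H _ _ yz))// (distrC y) ler_norm.
  by rewrite (le_trans (H _ _ zy))// ler_norm.
rewrite le_eqVlt => /predU1P[->|yz]; first by rewrite !subrr normr0.
have cF : {within `[y, z], continuous F}.
  apply: continuous_subspaceT => x; apply: differentiable_continuous.
  by apply/derivable1_diffP; exact: ex_derive.
have [c _ ->] := MVT yz (fun x _ => dF x) cF.
by rewrite normrM (@ger0_norm _ (z - y)) ?subr_ge0 ?(ltW yz)// ler_piMl// subr_ge0 ltW.
Qed.

Lemma trig_lipschitz b (y z : R) : `|trig b y - trig b z| <= `|y - z|.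
Proof.
case: b => /=; last first.
  by apply: (@lipschitz_derive sin cos) => x; exact: cos_max.
apply: (@lipschitz_derive cos (fun x => - sin x)) => x.
by rewrite normrN sin_max.
Qed.

Lemma L1_trig b f (xi : R) : L1 f -> L1 (fun x => f x * trig b (x * xi)).
Proof.
move=> Lf; apply: (L1_mul_bounded (M := 1)) => //; last by move=> x; exact: trig_max.
by apply: msr_trig; solve_msr.
Qed.

Lemma ft_bound b f xi : L1 f -> `|ft b f xi| <= \int[mu]_x `|f x|.
Proof.
move=> Lf; apply: int_norm_le; [exact: L1_trig|exact: L1_norm|].
by move=> x; rewrite normrM ler_piMr// trig_max.
Qed.

Lemma ftB b f g xi : L1 f -> L1 g ->
  ft b (fun x => f x - g x) xi = ft b f xi - ft b g xi.
Proof.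
move=> Lf Lg; rewrite /ft -intB; [|exact: L1_trig|exact: L1_trig].
by apply: int_eq => x; rewrite mulrBl.
Qed.

Lemma ft_ae_eq b f g xi : L1 f -> msr g -> {ae mu, forall x, f x = g x} ->
  ft b f xi = ft b g xi.
Proof.
move=> Lf mg fg; apply: int_ae_eq; first exact: L1_trig.
  by apply: msrM => //; apply: msr_trig; solve_msr.
by apply: ae_imp fg => x /= ->.
Qed.

Lemma measurable_trig2 b f : msr f ->
  measurable_fun [set: R * R] (fun p => f p.1 * trig b (p.1 * p.2)).
Proof.
move=> mf; apply: measurable_funM.
  exact: (measurableT_comp mf measurable_fst).
have mp : measurable_fun [set: R * R] (fun p => p.1 * p.2).
  by apply: measurable_funM.
by case: b; apply: (measurableT_comp _ mp); apply: msr_continuous => x;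
  [exact: continuous_cos|exact: continuous_sin].
Qed.

(** The kernel [trig b (x * xi)] is symmetric in its two variables, so Fubini moves the transform
    from one factor to the other. *)
Lemma ft_mul b f h : L1 f -> L1 h ->
  L1 (fun xi => ft b f xi * h xi) /\
  \int[mu]_xi (ft b f xi * h xi) = \int[mu]_x (f x * ft b h x).
Proof.
move=> Lf Lh.
have [] := @fubini_int R (fun x xi => (f x * trig b (x * xi)) * h xi)
  (fun x => `|f x|) (fun x => `|h x|).
- apply: measurable_funM; first by apply: measurable_trig2; exact: msr_L1.
  exact: (measurableT_comp (msr_L1 Lh) measurable_snd).
- exact: L1_norm.
- exact: L1_norm.
- by move=> x y; rewrite !normrM ler_wpM2r// ler_piMr// trig_max.
move=> _ L2 E.
have E1 xi : \int[mu]_x (f x * trig b (x * xi) * h xi) = ft b f xi * h xi.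
  by rewrite intZr//; exact: L1_trig.
split; first by move: L2; under eq_fun do rewrite E1.
rewrite -(int_eq E1) -E; apply: int_eq => x; rewrite /ft -intZ; last exact: L1_trig.
by apply: int_eq => y; rewrite (mulrC y); ring.
Qed.

(** Fubini gives measurability of [ft b f] times an integrable exponential; multiplying by the
    reciprocal exponential removes the factor. *)
Lemma msr_ft b f : L1 f -> msr (ft b f).
Proof.
move=> Lf; have [Le _] := @exp_weight R 1 ltr01.
have [/msr_L1 m _] := ft_mul b Lf Le.
have : msr (fun xi => ft b f xi * expR (- 1 * `|xi|) * expR `|xi|).
  by apply: msrM => //; solve_msr.
congr msr; apply/funext => x.
by rewrite -mulrA -expRD mulN1r addNr expR0 mulr1.
Qed.

(** The kernel is 1-Lipschitz in its phase, so one absolute moment of [f] controls the increments of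
    the transform. *)
Lemma ft_lipschitz b f xi eta : L1 f -> L1 (fun x => x * f x) ->
  `|ft b f xi - ft b f eta| <= `|xi - eta| * \int[mu]_x `|x * f x|.
Proof.
move=> Lf Lxf; rewrite /ft -intB; [|exact: L1_trig|exact: L1_trig].
rewrite -intZ; last exact: L1_norm.
apply: int_norm_le.
- by apply: L1B; exact: L1_trig.
- exact/L1Z/L1_norm.
- move=> x; have := trig_lipschitz b (x * xi) (x * eta).
  rewrite -!mulrBr !normrM (mulrC `|x| `|f x|) mulrCA => h.
  by rewrite ler_wpM2l// (mulrC `|xi - eta|).
Qed.

Lemma ft_itv_bound b (a c x : R) : a <= c ->
  `|ft b (\1_(`[a, c])) x| <= c - a.
Proof.
move=> ac; rewrite (le_trans (ft_bound _ _ (L1_itv a c)))//.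
rewrite -(int_itv1 ac) le_eqVlt; apply/orP; left; apply/eqP.
by apply: int_eq => y; rewrite ger0_norm// indicE.
Qed.

Lemma ft_itv_mul b (a c x : R) : a <= c ->
  x * ft b (\1_(`[a, c])) x =
  if b then sin (x * c) - sin (x * a) else cos (x * a) - cos (x * c).
Proof.
move=> ac; rewrite /ft -intZ; last exact/L1_trig/L1_itv.
have -> : \int[mu]_y (x * (\1_(`[a, c]) y * trig b (y * x))) =
   \int[mu]_y (\1_(`[a, c]) y * (x * trig b (x * y))).
  by apply: int_eq => y; rewrite mulrCA (mulrC y).
case: b => /=.
  apply: (@ftc_itv _ a c _ (fun y => sin (x * y))) => //.
  - move=> y; apply: cvgM; first exact: cvg_cst.
    by apply: continuous_derive => z; have [] := is_derive_cos_scaled x z.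
  - by move=> y; exact: is_derive_sin_scaled.
rewrite -[RHS](_ : - cos (x * c) - - cos (x * a) = _); last by ring.
apply: (@ftc_itv _ a c _ (fun y => - cos (x * y))) => //.
- move=> y; apply: cvgM; first exact: cvg_cst.
  by apply: continuous_derive => z; have [] := is_derive_sin_scaled x z.
- move=> y; rewrite -[x * sin _]opprK; apply: is_deriveN.
  exact: is_derive_cos_scaled.
Qed.

Lemma ft_itv_decay b (a c x : R) : a <= c ->
  `|x * ft b (\1_(`[a, c])) x| <= 2.
Proof.
move=> ac; rewrite ft_itv_mul//; case: b; rewrite (le_trans (ler_normB _ _))//.
  by have := sin_max (x * c); have := sin_max (x * a); lra.
by have := cos_max (x * c); have := cos_max (x * a); lra.
Qed.

(** The transform is at most [c - a] and at most [2 / |x|] in absolute value, so its square is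
    dominated by a multiple of [1 / (1 + x^2)]. *)
Lemma sq_int_ft_itv b (a c : R) : a <= c -> sq_int (ft b (\1_(`[a, c]))).
Proof.
move=> ac; have m := msr_ft b (L1_itv a c); split => //.
have [Lw _] := @cauchy_weight R 1 ltr01.
apply: (L1_dom _ (L1Z ((c - a) ^+ 2 + 4) Lw)); first exact: msrX.
move=> x; rewrite ger0_norm ?sqr_ge0// !mul1r.
rewrite ler_pdivlMr; last by rewrite ltr_pwDl// sqr_ge0.
rewrite mulrDr mulr1 lerD//.
  rewrite -[leLHS]real_normK ?num_real//.
  by rewrite ler_sqr ?nnegrE ?subr_ge0// ft_itv_bound.
rewrite mulrC -exprMn -[leLHS]real_normK ?num_real// (_ : 4 = 2 ^+ 2); last by ring.
by rewrite ler_sqr ?nnegrE//; exact: ft_itv_decay.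
Qed.

Lemma int_eq0_ae f : L1 f -> (forall x, 0 <= f x) -> \int[mu]_x f x = 0 ->
  {ae mu, forall x, f x = 0}.
Proof.
move=> Lf f0 I0; have mf : measurable_fun [set: R] (EFin \o f).
  by apply/measurable_EFinP; exact: msr_L1.
have : (\int[mu]_x `|(EFin \o f) x| = 0)%E.
  have <- : ((\int[mu]_x f x)%:E = 0)%E by rewrite I0.
  by rewrite int_EFin//; apply: eq_integral => x _ /=; rewrite ger0_norm.
move=> /(ae_eq_integral_abs mu measurableT mf).
by apply: ae_imp => x /= h; have := h I => -[].
Qed.

End transforms.

(** * The L^2 Fourier transform compared with the integral transforms *)

Section fourier.
Context {R : realType}.
Local Notation mu := (@lebesgue_measure R).
Implicit Types f g h : R -> R.

Lemma cvg0_lt (T : Type) (F : set_system T) (FF : Filter F) (u : T -> \bar R) :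
  u @ F --> 0%E -> forall e : R, 0 < e -> \forall x \near F, (u x < e%:E)%E.
Proof.
move=> /fine_cvgP[ufin /cvgrPdist_lt u0] e e0.
apply: filterS2 ufin (u0 e e0) => x xfin; rewrite sub0r normrN /= => xe.
by rewrite -(fineK xfin) lte_fin (le_lt_trans (ler_norm _)).
Qed.

Lemma fcomp_L2C b (g : R -> R[i]) : L2C g -> sq_int (fun xi => fcomp b (g xi)).
Proof. by move=> [/L2P ? /L2P ?]; case: b => //; exact: sq_intN. Qed.

Lemma fcompB b (z w : R[i]) : fcomp b (z - w) = fcomp b z - fcomp b w.
Proof. by case: z w => [? ?] [? ?]; case: b => /=; ring. Qed.

Lemma cmod_sqr (z : R[i]) : cmod z ^+ 2 = fcomp true z ^+ 2 + fcomp false z ^+ 2.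
Proof.
case: z => x y; rewrite /cmod /= sqr_sqrtr ?sqrrN//.
by rewrite addr_ge0 ?sqr_ge0.
Qed.

Lemma fcomp_le b (z : R[i]) : `|fcomp b z| <= cmod z.
Proof.
have c0 : 0 <= cmod z by case: z => x y; exact: sqrtr_ge0.
rewrite -(ler_sqr (x := `|_|)) ?nnegrE// real_normK ?num_real// cmod_sqr.
by case: b; rewrite ?lerDl ?lerDr sqr_ge0.
Qed.

Lemma msr_cmod (g : R -> R[i]) : (forall b, msr (fun xi => fcomp b (g xi))) ->
  msr (fun xi => cmod (g xi)).
Proof.
move=> mg.
have -> : (fun xi => cmod (g xi)) =
    (fun xi => Num.sqrt (fcomp true (g xi) ^+ 2 + fcomp false (g xi) ^+ 2)).
  apply/funext => xi; rewrite -cmod_sqr sqrtr_sqr ger0_norm//.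
  by case: (g xi) => x y; exact: sqrtr_ge0.
apply: (measurableT_comp (f := @Num.sqrt R)).
  by apply: continuous_measurable_fun; exact: sqrt_continuous.
apply: msrD; apply: msrX; exact: mg.
Qed.

Definition trunc f (n : nat) (x : R) : R := \1_(`[- n%:R, n%:R]) x * f x.

Lemma fcomp_trunc b f n xi : fcomp b (trunc_fourier f n xi) = ft b (trunc f n) xi.
Proof.
case: b => /=; rewrite ?opprK int_set /ft; apply: int_eq => x;
by rewrite /trunc /= mulrA.
Qed.

Lemma trunc_le f n x : `|trunc f n x| <= `|f x|.
Proof.
rewrite /trunc normrM ler_piMl// indicE.
by case: (_ \in _); rewrite ?normr1 ?normr0.
Qed.

Lemma msr_trunc f n : msr f -> msr (trunc f n).
Proof. by move=> mf; apply: msrM => //; apply: msr_indic; exact: measurable_itv. Qed.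

Lemma cvg_trunc f x : trunc f n x @[n --> \oo] --> f x.
Proof.
apply: cvg_near_cst; exists (Num.truncn `|x|).+1 => // n /= xn.
apply/eqP; rewrite /trunc indicE mem_set ?mul1r//= in_itv/= -ler_norml.
rewrite (le_trans (ltW (truncnS_gt _)))//.
by rewrite ler_nat.
Qed.

Lemma sq_int_indic (a b : R) : sq_int (\1_(`[a, b]) : R -> R).
Proof.
split; first by apply: msr_indic; exact: measurable_itv.
have := L1_itv a b; congr L1; apply/funext => x; rewrite indicE.
by case: (_ \in _); rewrite /= ?expr1n ?expr0n.
Qed.

Lemma L1_trunc f n : sq_int f -> L1 (trunc f n).
Proof. by apply: sq_int_mul; exact: sq_int_indic. Qed.

(** Each real component is dominated by the complex modulus, so the Plancherel limit holds
    componentwise. *)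
Lemma is_fourier_cvg b f (fh : R -> R[i]) : is_fourier f fh ->
  forall e : R, 0 < e -> \forall n \near \oo,
  sq_int (fun xi => ft b (trunc f n) xi - fcomp b (fh xi)) /\
  \int[mu]_xi (ft b (trunc f n) xi - fcomp b (fh xi)) ^+ 2 < e.
Proof.
move=> [/L2P sf Lfh h] e e0.
have se : 0 < Num.sqrt e by rewrite sqrtr_gt0.
apply: filterS (cvg0_lt _ h se) => n.
have md b' : msr (fun xi => fcomp b' (trunc_fourier f n xi - fh xi)).
  under eq_fun do rewrite fcompB fcomp_trunc.
  apply: msrB; first by apply: msr_ft; exact: L1_trunc.
  exact: (fcomp_L2C b' Lfh).1.
move=> /(L2_norm_lt_sq_int (msr_cmod md))[sc]; rewrite sqr_sqrtr ?ltW// => ce.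
have dE xi : ft b (trunc f n) xi - fcomp b (fh xi) =
   fcomp b (trunc_fourier f n xi - fh xi) by rewrite fcompB fcomp_trunc.
have c0 z : 0 <= @cmod R z by case: z => x y; exact: sqrtr_ge0.
under eq_fun do rewrite dE.
under int_eq do rewrite dE.
have sd : sq_int (fun xi => fcomp b (trunc_fourier f n xi - fh xi)).
  apply: (sq_int_dom _ sc) => // xi; rewrite (ger0_norm (c0 _)).
  exact: fcomp_le.
split => //; apply: le_lt_trans ce; apply: int_le; [exact: sd.2|exact: sc.2|].
move=> xi; rewrite -[leLHS]real_normK ?num_real// ler_sqr ?nnegrE//.
exact: fcomp_le.
Qed.

(** The multiplication formula holds for the truncations, which are integrable. One side passes to
    the limit by Cauchy-Schwarz and the L^2 convergence of transforms, the other by dominated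
    convergence. *)
Lemma is_fourier_pairing b f (fh : R -> R[i]) h : is_fourier f fh ->
  L1 h -> sq_int h -> sq_int (ft b h) ->
  \int[mu]_xi (fcomp b (fh xi) * h xi) = \int[mu]_x (f x * ft b h x).
Proof.
move=> Ff Lh sh sfh; have [/L2P sf Lfh _] := Ff.
have sc := fcomp_L2C b Lfh.
have c1 : \int[mu]_x (trunc f n x * ft b h x) @[n --> \oo] -->
    \int[mu]_x (f x * ft b h x).
  apply: (@dominated_cvg_int R _ _ (fun x => `|f x * ft b h x|) _ _ _ _ _).2.
  - by move=> n; apply: msrM; [apply: msr_trunc; exact: sf.1|exact: sfh.1].
  - by apply: msrM; [exact: sf.1|exact: sfh.1].
  - by apply: L1_norm; exact: sq_int_mul.
  - by apply: ae_all => x; apply: cvgM; [exact: cvg_trunc|exact: cvg_cst].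
  - by move=> n x; rewrite [leLHS]normrM [leRHS]normrM ler_wpM2r// trunc_le.
have c2 : \int[mu]_x (trunc f n x * ft b h x) @[n --> \oo] -->
    \int[mu]_xi (fcomp b (fh xi) * h xi).
  set I := \int[mu]_xi (fcomp b _ * _).
  set H := \int[mu]_x (h x ^+ 2).
  have H0 : 0 <= H by apply: int_ge0 => x; exact: sqr_ge0.
  apply/cvgrPdist_lt => e e0.
  have e1 : 0 < e ^+ 2 / (H + 1) by rewrite divr_gt0 ?exprn_gt0// ltr_wpDl.
  apply: filterS (is_fourier_cvg b Ff e1) => n [sd dlt].
  have [L _] := ft_mul b (L1_trunc n sf) Lh.
  rewrite -(ft_mul b (L1_trunc n sf) Lh).2 distrC.
  have <- : \int[mu]_xi ((ft b (trunc f n) xi - fcomp b (fh xi)) * h xi) =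
     \int[mu]_xi (ft b (trunc f n) xi * h xi) - I.
    rewrite /I -intB//; last exact: sq_int_mul.
    by apply: int_eq => xi; rewrite mulrBl.
  have := cauchy_schwarz sd sh; rewrite -/H => cs.
  rewrite -(ltr_sqr (x := `|_|)) ?nnegrE ?(ltW e0)// real_normK ?num_real//.
  apply: (le_lt_trans cs); move: dlt; rewrite ltr_pdivlMr ?ltr_wpDl// => dlt.
  apply: le_lt_trans dlt; rewrite ler_wpM2l ?lerDl//.
  by apply: int_ge0 => x; exact: sqr_ge0.
exact: (cvg_unique _ c2 c1).
Qed.

(** The transforms of the truncations converge to [fh] in L^2 and to [ft b f] uniformly, so the two
    limits agree almost everywhere. The weight [w] makes the squared difference integrable, since
    [ft b f] is controlled here only by a uniform bound. *)
Lemma is_fourier_ft b f (fh : R -> R[i]) : L1 f -> is_fourier f fh ->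
  {ae mu, forall xi, fcomp b (fh xi) = ft b f xi}.
Proof.
move=> Lf Ff; have [/L2P sf Lfh _] := Ff.
have sc := fcomp_L2C b Lfh.
have [Lw Iw] := @exp_weight R 1 ltr01.
have w1 (x : R) : expR (- 1 * `|x|) <= 1 :> R.
  by rewrite -[leRHS]expR0 ler_expR mulN1r oppr_le0.
pose w (x : R) := expR (- 1 * `|x|).
have mw : msr w by exact: msr_L1 Lw.
have mft := msr_ft b Lf.
pose G xi := (fcomp b (fh xi) - ft b f xi) ^+ 2 * w xi.
have G0 xi : 0 <= G xi by exact: mulr_ge0 (sqr_ge0 _) (expR_ge0 _).
have LG : L1 G.
  pose M := \int[mu]_x `|f x|.
  apply: (L1_dom (g := fun xi => 2 * fcomp b (fh xi) ^+ 2 + 2 * M ^+ 2 * w xi)).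
  - by apply: msrM => //; apply: msrX; apply: msrB => //; exact: sc.1.
  - by apply: L1D; apply: L1Z => //; exact: sc.2.
  - move=> xi; rewrite ger0_norm//.
    have fM : ft b f xi ^+ 2 <= M ^+ 2.
      rewrite -[leLHS]real_normK ?num_real// ler_sqr ?nnegrE ?ft_bound//.
      by apply: int_ge0 => x.
    have w0 : 0 <= w xi by exact: expR_ge0.
    have := w1 xi; rewrite -/(w xi) => w1'.
    rewrite /G; set a := fcomp b (fh xi); set c := ft b f xi in fM *.
    have h1 : (a - c) ^+ 2 <= 2 * a ^+ 2 + 2 * M ^+ 2.
      by have := sqr_ge0 (a + c); nra.
    have a0 := sqr_ge0 a.
    apply: (@le_trans _ _ ((2 * a ^+ 2 + 2 * M ^+ 2) * w xi)).
      by rewrite ler_wpM2r.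
    by rewrite mulrDl lerD2r ler_piMr//; exact: mulr_ge0.
have IG : \int[mu]_xi G xi = 0.
  apply/eqP; rewrite eq_le int_ge0// andbT; apply/ler_addgt0Pl => e e0.
  rewrite addr0.
  pose T n := \int[mu]_x `|trunc f n x - f x|.
  have T0 : T n @[n --> \oo] --> 0.
    rewrite [X in _ --> X](_ : _ = \int[mu]_x (0 * `|f x|)); last first.
      by rewrite intZ ?mul0r//; exact: L1_norm.
    apply: (@dominated_cvg_int R _ _ (fun x => 2 * `|f x|) _ _ _ _ _).2.
    - move=> n; apply: msr_norm; apply: msrB; last exact: sf.1.
      by apply: msr_trunc; exact: sf.1.
    - by apply: msrM; [exact: msr_cst|apply: msr_norm; exact: sf.1].
    - exact/L1Z/L1_norm.
    - apply: ae_all => x; rewrite mul0r; apply/norm_cvg0P.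
      rewrite -[X in _ --> X](subrr (f x)).
      by apply: cvgB; [exact: cvg_trunc|exact: cvg_cst].
    - move=> n x; rewrite normr_id (le_trans (ler_normB _ _))//.
      by rewrite mulr2n mulrDl !mul1r lerD2r trunc_le.
  (* With these thresholds [2 (e / 4) + 2 T^2 * 2 <= e], because [T^2 <= T <= e / 8]; the last
     factor 2 is the integral of [w]. *)
  have T1 : \forall n \near \oo, T n < Num.min 1 (e / 8).
    have m0 : 0 < Num.min 1 (e / 8) by rewrite lt_min ltr01 divr_gt0.
    move/cvgrPdist_lt : T0 => /(_ _ m0); apply: filterS => n.
    by rewrite sub0r normrN => /(le_lt_trans (ler_norm _)).
  have e4 : 0 < e / 4 by rewrite divr_gt0.
  have [n [[sd dlt] Tn]] := filter_ex (filterI (is_fourier_cvg b Ff e4) T1).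
  move: Tn; rewrite lt_min => /andP[Tn1 Tne].
  have Tn0 : 0 <= T n by apply: int_ge0 => x.
  apply: (@le_trans _ _ (\int[mu]_xi (2 * (ft b (trunc f n) xi - fcomp b (fh xi)) ^+ 2
     + 2 * T n ^+ 2 * w xi))).
    apply: int_le => //.
      by apply: L1D; apply: L1Z => //; exact: sd.2.
    move=> xi.
    have dT : (ft b (trunc f n) xi - ft b f xi) ^+ 2 <= T n ^+ 2.
      rewrite -ftB//; last exact: L1_trunc.
      rewrite -[leLHS]real_normK ?num_real// ler_sqr ?nnegrE//.
      by apply: ft_bound; apply: L1B => //; exact: L1_trunc.
    have w0 : 0 <= w xi by exact: expR_ge0.
    have := w1 xi; rewrite -/(w xi) => w1'.
    rewrite /G; set a := fcomp b (fh xi); set c := ft b f xi in dT *.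
    set d := ft b (trunc f n) xi in dT *.
    have h1 : (a - c) ^+ 2 <= 2 * (d - a) ^+ 2 + 2 * T n ^+ 2.
      by have := sqr_ge0 (2 * d - a - c); nra.
    have a0 := sqr_ge0 (d - a).
    apply: (@le_trans _ _ ((2 * (d - a) ^+ 2 + 2 * T n ^+ 2) * w xi)).
      by rewrite ler_wpM2r.
    by rewrite mulrDl lerD2r ler_piMr//; exact: mulr_ge0.
  rewrite intD; [|exact/L1Z/sd.2|exact: L1Z].
  rewrite intZ; last exact: sd.2.
  rewrite intZ// Iw divr1.
  have : T n ^+ 2 <= T n by rewrite expr2 ler_piMr// ltW.
  move: dlt; lra.
apply: ae_imp (int_eq0_ae LG G0 IG) => xi /= /eqP.
by rewrite /G mulf_eq0 (gt_eqF (expR_gt0 _)) orbF sqrf_eq0 subr_eq0 => /eqP.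
Qed.

End fourier.

                            

(** * Poisson summability and a Parseval inequality *)

Section parseval.
Context {R : realType}.
Local Notation mu := (@lebesgue_measure R).
Implicit Types f g h : R -> R.

Lemma ae_neq (a : R) : {ae mu, forall x, x != a}.
Proof.
exists [set a]; split; [exact: measurable_set1|exact: lebesgue_measure_set1|].
by move=> x /= /negP; rewrite negbK => /eqP.
Qed.

Lemma sq_int_bounded_L1 f (M : R) : L1 f -> (forall x, `|f x| <= M) -> sq_int f.
Proof.
move=> Lf fM; split; first exact: msr_L1.
under eq_fun do rewrite expr2.
by apply: (L1_mul_bounded (M := M)) => //; exact: msr_L1.
Qed.

Lemma sq_int_ft b f : L1 f -> L1 (ft b f) -> sq_int (ft b f).
Proof.
by move=> Lf Lft; apply: (sq_int_bounded_L1 Lft) => x; exact: ft_bound.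
Qed.

(** An interval centred at 0 has no sine part, and moving its centre to [x] only introduces a phase.
    Both sides are compared after multiplication by [xi], where transforms of intervals are
    differences of trigonometric functions; hence the separate case [xi = 0]. *)
Lemma ft_shift_itv b (x h xi : R) : 0 <= h ->
  ft b (\1_(`[x - h, x + h])) xi = trig b (x * xi) * ft true (\1_(`[- h, h])) xi.
Proof.
move=> h0; have [->|xi0] := eqVneq xi 0.
  rewrite /ft mulr0; case: b => /=.
    rewrite cos0 mul1r.
    under int_eq do rewrite mulr0 cos0 mulr1.
    under [RHS]int_eq do rewrite mulr0 cos0 mulr1.
    by rewrite !int_itv1; lra.
  rewrite sin0 mul0r; under int_eq do rewrite mulr0 sin0 mulr0.
  by rewrite /Rintegral integral0.
apply: (mulfI xi0); rewrite ft_itv_mul; last by lra.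
rewrite mulrCA ft_itv_mul; last by lra.
rewrite mulrN sinN opprK.
have -> : xi * (x + h) = x * xi + xi * h by ring.
have -> : xi * (x - h) = x * xi - xi * h by ring.
by case: b; rewrite /= ?sinB ?sinD ?cosB ?cosD; ring.
Qed.

Lemma poisson_itv (a c y e : R) : 0 < e -> a <= c ->
  \int[mu]_z (\1_(`[a, c]) z * (2 * e / (e ^+ 2 + (y - z) ^+ 2))) =
  2 * (atan (e^-1 * (c - y)) - atan (e^-1 * (a - y))).
Proof.
move=> e0 ac; have ne : e != 0 by exact: lt0r_neq0.
have pos z : e ^+ 2 + (y - z) ^+ 2 != 0.
  by rewrite gt_eqF// ltr_pwDl ?sqr_ge0 ?exprn_gt0.
pose F z := 2 * atan (e^-1 * (z - y)).
rewrite mulrBr -/(F c) -/(F a); apply: (@ftc_itv _ a c _ F) => //.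
  move=> z; apply: cvgM; first exact: cvg_cst.
  apply: cvgV => //; apply: cvgD; first exact: cvg_cst.
  apply: (@continuous_comp _ _ _ (fun z => y - z) (fun t => t ^+ 2)).
    by apply: cvgB; [exact: cvg_cst|exact: cvg_id].
  exact: exprn_continuous.
move=> z.
have d1 : is_derive z 1 (fun z => e^-1 * (z - y)) (e^-1).
  have -> : (fun z => e^-1 * (z - y)) = e^-1 \*: (id - cst y) :> (R -> R).
    by apply/funext.
  by apply: is_derive_eq; rewrite subr0 /GRing.scale /= mulr1.
have d2 := is_derive1_atan (e^-1 * (z - y)).
have d3 := @is_derive1_comp R atan (fun z => e^-1 * (z - y)) z _ _ d2 d1.
apply: (@is_derive_eq _ _ _ (2 \*: (atan \o (fun z => e^-1 * (z - y))))).
rewrite /GRing.scale /=.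
have -> : 1 + (e^-1 * (z - y)) ^+ 2 = (e ^+ 2 + (y - z) ^+ 2) / e ^+ 2 by field.
by rewrite invf_div; field; rewrite ne pos.
Qed.

(** Abel-regularised Parseval. [ft_mul] moves the transform off [f], then off the indicator; what is
    left is the cosine transform of the exponential at [y - z], that is, the Poisson kernel, whose
    integral over the interval is a difference of arctangents. *)
Lemma poisson_pairing f (a c e : R) : L1 f -> a <= c -> 0 < e ->
  \int[mu]_xi (expR (- e * `|xi|) * (ft true f xi * ft true (\1_(`[a, c])) xi +
     ft false f xi * ft false (\1_(`[a, c])) xi)) =
  \int[mu]_y (f y * (2 * (atan (e^-1 * (c - y)) - atan (e^-1 * (a - y))))).
Proof.
move=> Lf ac e0; have [Le _] := exp_weight e0.
have Lx := L1_itv a c.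
pose E (x : R) := expR (- e * `|x|).
pose X b := ft b (\1_(`[a, c]) : R -> R).
have LEX b : L1 (fun xi => E xi * X b xi).
  apply: (L1_mul_bounded (M := c - a) Le); first exact: msr_ft.
  by move=> x; exact: ft_itv_bound.
have LEt b y : L1 (fun xi => E xi * trig b (xi * y)) by exact: L1_trig.
transitivity (\int[mu]_y (f y * ft true (fun xi => E xi * X true xi) y) +
              \int[mu]_y (f y * ft false (fun xi => E xi * X false xi) y)).
  rewrite -!(ft_mul _ Lf (LEX _)).2 -intD; last 2 first.
  - exact: (ft_mul _ Lf (LEX _)).1.
  - exact: (ft_mul _ Lf (LEX _)).1.
  by apply: int_eq => xi; rewrite /E /X; ring.
have bft b : msr (ft b (fun xi => E xi * X b xi)) by exact: msr_ft.
rewrite -intD; last 2 first.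
- apply: (L1_mul_bounded Lf (bft _)) => x; exact: ft_bound.
- apply: (L1_mul_bounded Lf (bft _)) => x; exact: ft_bound.
apply: int_eq => y; rewrite -mulrDr; congr (_ * _).
rewrite -poisson_itv//.
have E1 b : ft b (fun xi => E xi * X b xi) y =
    \int[mu]_z (\1_(`[a, c]) z * ft b (fun xi => E xi * trig b (xi * y)) z).
  rewrite -(ft_mul b Lx (LEt b y)).2; apply: int_eq => xi; rewrite /X; ring.
have L2 b : L1 (fun z => \1_(`[a, c]) z * ft b (fun xi => E xi * trig b (xi * y)) z).
  by apply: (L1_mul_bounded Lx); [exact: msr_ft|move=> z; exact: ft_bound].
rewrite !E1 -intD//; apply: int_eq => z; rewrite -mulrDr; congr (_ * _).
rewrite -poisson_kernel// /ft -intD; last 2 first.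
- exact: L1_trig.
- exact: L1_trig.
apply: int_eq => xi; rewrite -/(E xi) mulrBl cosB !(mulrC xi) /=; ring.
Qed.

Lemma cvg_natS_mul (t : R) : 0 < t -> n.+1%:R * t @[n --> \oo] --> +oo.
Proof.
move=> t0; apply/cvgryPge => A; near=> n; rewrite -ler_pdivrMr//.
have : (Num.truncn (A / t) < n)%N by near: n; exact: nbhs_infty_gt.
move=> An; apply: (le_trans (ltW (truncnS_gt _))).
by rewrite ler_nat; exact: ltnW.
Unshelve. all: by end_near. Qed.

Lemma cvg_atan_sg (t : R) : atan (n.+1%:R * t) @[n --> \oo] --> pi / 2 * Num.sg t.
Proof.
case: (sgrP t) => [->|t0|t0].
- by rewrite mulr0; under eq_fun do rewrite mulr0 atan0; exact: cvg_cst.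
- by rewrite mulr1; exact: (cvg_comp _ _ (cvg_natS_mul t0) (@cvgy_atan R)).
- have Nt : 0 < - t by rewrite oppr_gt0.
  rewrite mulrN1.
  have -> : (fun n : nat => atan (n.+1%:R * t)) = (fun n => - atan (n.+1%:R * - t)).
    by apply/funext => n; rewrite mulrN atanN opprK.
  by apply: cvgN; exact: (cvg_comp _ _ (cvg_natS_mul Nt) (@cvgy_atan R)).
Qed.

Lemma msr_atan f : msr f -> msr (fun x => atan (f x)).
Proof.
move=> mf; apply: (measurableT_comp (f := @atan R)) => //.
by apply: msr_continuous => x; exact: continuous_atan.
Qed.

Lemma msr_sg f : msr f -> msr (fun x => Num.sg (f x)).
Proof.
move=> mf.
apply: (@measurable_fun_cvg _ R R setT (fun n x => 2 / pi * atan (n.+1%:R * f x))) => //.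
  by move=> n; apply: msrM; [exact: msr_cst|apply: msr_atan; solve_msr].
move=> x _; rewrite [X in _ --> X](_ : _ = 2 / pi * (pi / 2 * Num.sg (f x))).
  by apply: cvgM; [exact: cvg_cst|exact: cvg_atan_sg].
by rewrite mulrA -[2 / pi]invf_div mulVf ?mul1r// lt0r_neq0// divr_gt0 ?pi_gt0.
Qed.

Lemma norm_atan (t : R) : `|atan t| <= pi / 2.
Proof.
rewrite ler_norml; have := atan_gtNpi2 t; have := atan_ltpi2 t.
by move=> h1 h2; rewrite !ltW.
Qed.

(** Dominated convergence removes the Abel factor on both sides. The arctangents tend to [pi / 2]
    times signs, and [sg (c - y) - sg (a - y)] is twice the indicator of [[a, c]] away from the
    endpoints. *)
Lemma parseval_itv f (a c : R) : L1 f -> (forall b, L1 (ft b f)) -> a <= c ->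
  2 * pi * \int[mu]_x (f x * \1_(`[a, c]) x) =
  \int[mu]_xi (ft true f xi * ft true (\1_(`[a, c])) xi +
     ft false f xi * ft false (\1_(`[a, c])) xi).
Proof.
move=> Lf Lft ac.
pose X b := ft b (\1_(`[a, c]) : R -> R).
pose G xi := ft true f xi * X true xi + ft false f xi * X false xi.
have mX b : msr (X b) by apply: msr_ft; exact: L1_itv.
have mG : msr G by apply: msrD; apply: msrM => //; exact: msr_L1.
have LG : L1 G.
  apply: L1D; apply: (L1_mul_bounded (M := c - a)) => // x;
  exact: ft_itv_bound.
have c1 : \int[mu]_xi (expR (- n.+1%:R^-1 * `|xi|) * G xi) @[n --> \oo] -->
    \int[mu]_xi G xi.
  apply: (@dominated_cvg_int R _ _ (fun x => `|G x|) _ _ _ _ _).2 => //.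
  - by move=> n; apply: msrM => //; solve_msr.
  - exact: L1_norm.
  - apply: ae_all => x; rewrite -[X in _ --> X]mul1r.
    apply: cvgM; last exact: cvg_cst.
    rewrite -[X in _ --> X]expR0; apply: continuous_cvg; first exact: continuous_expR.
      rewrite -[X in _ --> X](mul0r `|x|).
      apply: cvgM; last exact: cvg_cst.
      by rewrite -[X in _ --> X]oppr0; apply: cvgN; exact: cvg_harmonic.
  - move=> n x; have e1 : expR (- n.+1%:R^-1 * `|x|) <= 1.
      by rewrite -[X in _ <= X]expR0 ler_expR mulNr oppr_le0 mulr_ge0.
    by rewrite normrM ler_piMl// ger0_norm ?expR_ge0.
have c2 : \int[mu]_xi (expR (- n.+1%:R^-1 * `|xi|) * G xi) @[n --> \oo] -->
    \int[mu]_y (f y * (pi * (Num.sg (c - y) - Num.sg (a - y)))).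
  have E (n : nat) : \int[mu]_xi (expR (- n.+1%:R^-1 * `|xi|) * G xi) =
    \int[mu]_y (f y * (2 * (atan (n.+1%:R * (c - y)) - atan (n.+1%:R * (a - y))))).
    by rewrite /G /X poisson_pairing// invrK.
  under eq_fun do rewrite E.
  apply: (@dominated_cvg_int R _ _ (fun y => `|f y| * (2 * pi)) _ _ _ _ _).2.
  - move=> n; apply: msrM; first exact: msr_L1.
    by apply: msrM; [exact: msr_cst|apply: msrB; apply: msr_atan; solve_msr].
  - apply: msrM; first exact: msr_L1.
    by apply: msrM; [exact: msr_cst|apply: msrB; apply: msr_sg; solve_msr].
  - exact/L1Zr/L1_norm.
  - apply: ae_all => y; apply: cvgM; first exact: cvg_cst.
    rewrite [X in _ --> X](_ : _ = 2 * (pi / 2 * Num.sg (c - y) - pi / 2 * Num.sg (a - y))).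
      apply: cvgM; first exact: cvg_cst.
      by apply: cvgB; exact: cvg_atan_sg.
    by field.
  - move=> n y; rewrite normrM ler_wpM2l// normrM ger0_norm// ler_wpM2l//.
    rewrite (le_trans (ler_normB _ _))//.
    by have := norm_atan (n.+1%:R * (c - y)); have := norm_atan (n.+1%:R * (a - y)); lra.
rewrite -(cvg_unique _ c2 c1) // -intZ; last first.
  by have := L1_indic (measurable_itv `[a, c]) Lf; congr L1; apply/funext => x; rewrite mulrC.
apply: int_ae_eq.
- apply: L1Z; have := L1_indic (measurable_itv `[a, c]) Lf.
  by congr L1; apply/funext => x; rewrite mulrC.
- apply: msrM; first exact: msr_L1.
  by apply: msrM; [exact: msr_cst|apply: msrB; apply: msr_sg; solve_msr].
apply: ae_imp (ae_and (ae_neq a) (ae_neq c)) => y /= [ya yc].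
rewrite mulrCA; congr (_ * _); rewrite indicE.
have [yac|yac] := boolP (y \in `[a, c]).
  rewrite mem_set//; move: yac; rewrite in_itv/= => /andP[ay cy].
  rewrite gtr0_sg ?subr_gt0 1?lt_neqAle ?yc//.
  by rewrite ltr0_sg ?subr_lt0 1?lt_neqAle 1?eq_sym ?ya//=; ring.
rewrite memNset//; last exact/negP.
rewrite mulr0; move: yac; rewrite in_itv/= negb_and -!ltNge => /orP[h|h].
  by rewrite !gtr0_sg ?subr_gt0 ?subrr ?mulr0// (lt_le_trans h).
by rewrite !ltr0_sg ?subr_lt0 ?subrr ?mulr0// (le_lt_trans ac).
Qed.

(** Fourier inversion for local integrals: the integral of [f] over an interval centred at [x] is an
    inverse transform with the bounded multiplier [k], an identity valid at every [x]. *)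
Lemma ft_itvE f (x h : R) : L1 f -> (forall b, L1 (ft b f)) -> 0 <= h ->
  let k xi := ft true (\1_(`[- h, h])) xi in
  2 * pi * \int[mu]_y (f y * \1_(`[x - h, x + h]) y) =
  ft true (fun xi => k xi * ft true f xi) x +
  ft false (fun xi => k xi * ft false f xi) x.
Proof.
move=> Lf Lft h0 k.
have mk : msr k by apply: msr_ft; exact: L1_itv.
have Lk b : L1 (fun xi => k xi * ft b f xi).
  have := L1_mul_bounded (Lft b) mk (fun xi => ft_itv_bound true xi (ge0_cp h0).2).
  by congr L1; apply/funext => xi; rewrite mulrC.
rewrite parseval_itv//; last by lra.
rewrite [RHS](_ : _ = \int[mu]_xi (k xi * ft true f xi * cos (xi * x) +
    k xi * ft false f xi * sin (xi * x))); last first.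
  exact: (esym (intD (L1_trig true x (Lk true)) (L1_trig false x (Lk false)))).
by apply: int_eq => xi; rewrite !ft_shift_itv// -/(k xi) (mulrC xi) /=; ring.
Qed.

Lemma lebesgue_diff_centered f : L1 f -> {ae mu, forall x,
  (2 * n.+1%:R^-1)^-1 * (\int[mu]_y (f y * \1_(`[x - n.+1%:R^-1, x + n.+1%:R^-1]) y))
    @[n --> \oo] --> f x}.
Proof.
move=> Lf.
have lf : locally_integrable setT f.
  by apply: open_integrable_locally => //; exact: openT.
pose E (x : R) (n : nat) : set R := `[x - n.+1%:R^-1, x + n.+1%:R^-1]%classic.
have muE x n : mu (E x n) = (2 * n.+1%:R^-1)%:E.
  have p : 0 < n.+1%:R^-1 :> R by [].
  rewrite /E; move: p; set q := _^-1 => p.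
  rewrite /= lebesgue_measure_itv/= lte_fin ifT; last by lra.
  by rewrite -EFinB; congr EFin; ring.
have hE x : nicely_shrinking x (E x).
  split; first by move=> n; exact: measurable_itv.
  have rp (n : nat) : 0 < 2 * n.+1%:R^-1 :> R by rewrite mulr_gt0.
  pose r (n : nat) : {posnum R} := PosNum (rp n).
  exists (2, r); split => //=.
  - rewrite -[X in _ --> X](mulr0 2); apply: cvgM; first exact: cvg_cst.
    exact: cvg_harmonic.
  - move=> n y; rewrite /E /= in_itv/= ball_itv /= in_itv/= => /andP[h1 h2].
    have p : 0 < n.+1%:R^-1 :> R by [].
    move: p h1 h2; set q := _^-1 => p h1 h2.
    by apply/andP; split; lra.
  - move=> n; rewrite lebesgue_measure_ball// muE -EFinM lee_fin.
    by rewrite mulr2n; set q := _^-1; lra.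
have := lebesgue_differentiation lf; apply: ae_imp => x /= fx.
have := nice_lebesgue_differentiation hE lf fx => /fine_cvg.
apply: cvg_trans; apply: near_eq_cvg; apply: nearW => n /=.
rewrite muE inver ifF; last first.
  by apply/negbTE; rewrite mulf_neq0.
have Lc : L1 (fun y => \1_(E x n) y * f y).
  by apply: L1_indic => //; exact: measurable_itv.
rewrite -[X in (_ * X)%E]fineK; last first.
  apply: integrable_fin_num => //; first exact: measurable_itv.
  by apply/(L1_set _ (measurable_itv _)).
rewrite -EFinM /=; congr (_ * _).
rewrite -[LHS]/(\int[mu]_(y in E x n) f y) int_set.
by apply: int_eq => y; rewrite mulrC.
Qed.

(** Pair [f] with its means [a n] over shrinking intervals. By [ft_itvE] and [ft_mul] the pairing is
    an integral of [k n] against the squared transform, and [k n <= 2 h n] cancels the normalisation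
    of the mean. The same cancellation bounds the means uniformly, so Lebesgue differentiation and
    dominated convergence turn the pairing into the integral of [f^2]. *)
Lemma parseval_le f : L1 f -> (forall b, L1 (ft b f)) ->
  2 * pi * \int[mu]_x f x ^+ 2 <=
  \int[mu]_xi (ft true f xi ^+ 2 + ft false f xi ^+ 2).
Proof.
move=> Lf Lft.
have p0 : 0 < 2 * pi :> R by rewrite mulr_gt0 ?pi_gt0.
pose h (n : nat) : R := n.+1%:R^-1.
have h0 n : 0 < h n by rewrite invr_gt0.
pose k n xi := ft true (\1_(`[- h n, h n])) xi.
have mk n : msr (k n) by apply: msr_ft; exact: L1_itv.
have kb n xi : `|k n xi| <= 2 * h n.
  rewrite (le_trans (ft_itv_bound _ _ _))//; have := h0 n; lra.
have Lk n b : L1 (fun xi => k n xi * ft b f xi).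
  have := L1_mul_bounded (Lft b) (mk n) (kb n).
  by congr L1; apply/funext => xi; rewrite mulrC.
pose g n x := ft true (fun xi => k n xi * ft true f xi) x +
  ft false (fun xi => k n xi * ft false f xi) x.
pose K := \int[mu]_xi `|ft true f xi| + \int[mu]_xi `|ft false f xi|.
have gK n x : `|g n x| <= 2 * h n * K.
  rewrite /g (le_trans (ler_normD _ _))// /K mulrDr lerD//;
  (rewrite (le_trans (ft_bound _ _ (Lk _ _)))// -intZ; last exact: L1_norm);
  (apply: int_le; [exact: L1_norm|exact/L1Z/L1_norm|]) => xi;
  by rewrite normrM ler_wpM2r.
have mg n : msr (g n) by apply: msrD; exact: msr_ft.
pose a n x := (2 * h n)^-1 * \int[mu]_y (f y * \1_(`[x - h n, x + h n]) y).
have aE n x : a n x = (2 * pi)^-1 * ((2 * h n)^-1 * g n x).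
  rewrite /a /g -(ft_itvE x Lf Lft (ltW (h0 n))) mulrCA mulKf//.
  exact: lt0r_neq0.
have h20 n : 0 < 2 * h n by rewrite mulr_gt0.
have aK n x : `|a n x| <= (2 * pi)^-1 * K.
  rewrite aE !normrM (@ger0_norm _ (2 * pi)^-1) ?invr_ge0 ?(ltW p0)//.
  rewrite ler_wpM2l ?invr_ge0 ?(ltW p0)// ger0_norm ?invr_ge0 ?(ltW (h20 n))//.
  by rewrite ler_pdivrMl.
have c1 : \int[mu]_x (f x * a n x) @[n --> \oo] --> \int[mu]_x (f x ^+ 2).
  apply: (@dominated_cvg_int R _ _ (fun x => `|f x| * ((2 * pi)^-1 * K)) _ _ _ _ _).2.
  - move=> n; apply: msrM; first exact: msr_L1.
    have -> : a n = (fun x => (2 * pi)^-1 * ((2 * h n)^-1 * g n x)).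
      by apply/funext => x; exact: aE.
    by do 2 (apply: msrM; first exact: msr_cst).
  - by apply: msrX; exact: msr_L1.
  - exact/L1Zr/L1_norm.
  - apply: ae_imp (lebesgue_diff_centered Lf) => x /= fx.
    by rewrite expr2; apply: cvgM; [exact: cvg_cst|exact: fx].
  - by move=> n x; rewrite normrM ler_wpM2l.
pose P := \int[mu]_xi (ft true f xi ^+ 2 + ft false f xi ^+ 2).
have L2 : L1 (fun xi => ft true f xi ^+ 2 + ft false f xi ^+ 2).
  by apply: L1D; exact: (sq_int_ft Lf (Lft _)).2.
have aP n : \int[mu]_x (f x * a n x) <= (2 * pi)^-1 * P.
  have E : \int[mu]_x (f x * g n x) =
      \int[mu]_xi (k n xi * (ft true f xi ^+ 2 + ft false f xi ^+ 2)).
    have Lfg b : L1 (fun x => f x * ft b (fun xi => k n xi * ft b f xi) x).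
      apply: (L1_mul_bounded Lf); first exact: msr_ft.
      by move=> x; exact: ft_bound.
    transitivity (\int[mu]_xi (ft true f xi * (k n xi * ft true f xi)) +
       \int[mu]_xi (ft false f xi * (k n xi * ft false f xi))).
      rewrite !(ft_mul _ Lf (Lk _ _)).2 -intD//.
      by apply: int_eq => x; rewrite /g mulrDr.
    rewrite -intD; [|exact: (ft_mul _ Lf (Lk _ _)).1|exact: (ft_mul _ Lf (Lk _ _)).1].
    by apply: int_eq => xi; ring.
  have -> : \int[mu]_x (f x * a n x) = (2 * pi)^-1 * ((2 * h n)^-1 * \int[mu]_x (f x * g n x)).
    have Lfg : L1 (fun x => f x * g n x) by exact: (L1_mul_bounded Lf (mg n) (gK n)).
    rewrite -!intZ//; last exact: L1Z.
    by apply: int_eq => x; rewrite aE; ring.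
  rewrite ler_wpM2l ?invr_ge0 ?(ltW p0)// ler_pdivrMl// E -intZ//.
  apply: int_le.
  - have := L1_mul_bounded L2 (mk n) (kb n).
    by congr L1; apply/funext => xi; rewrite mulrC.
  - exact: L1Z.
  - move=> xi; rewrite ler_wpM2r ?addr_ge0 ?sqr_ge0//.
    by rewrite (le_trans (ler_norm _)).
rewrite -/P -ler_pdivlMl//.
by apply: (ler_cvg_to c1 (cvg_cst _)); apply: nearW.
Qed.

End parseval.

                                              

(** * Bounds extracted from the weighted Sobolev norm of the solution *)

Section sobolev.
Context {R : realType}.
Local Notation mu := (@lebesgue_measure R).
Implicit Types f g h : R -> R.

(** Compactness in its near-covering form, the covering parameter being the bound itself, sent to
    [+oo]. *)
Lemma segment_bounded (a b : R) (Q : R -> R) :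
  (forall t0 : R, t0 \in `[a, b] ->
    exists M, \forall t \near within `[a, b] (nbhs t0), Q t <= M) ->
  exists M, forall t : R, t \in `[a, b] -> Q t <= M.
Proof.
move=> locQ.
have cov := (near_covering_withinP _).2
  ((compact_near_coveringP _).1 (@segment_compact R a b)).
have [|M [_ hM]] := cov R +oo (fun M t => Q t <= M) _.
  move=> t0 /= /locQ[M QM].
  exists ([set t | t \in `[a, b] -> Q t <= M], [set i | M <= i]) => /=.
    by split; [exact: QM|apply: nbhs_pinfty_ge; rewrite num_real].
  by move=> [t i] /= [Qt Mi] tab; exact: le_trans (Qt tab) Mi.
exists (M + 1) => t tab; apply: (hM (M + 1)) => //.
by rewrite ltrDl.
Qed.

Definition moment2 f := sq_int f /\ sq_int (fun x => x ^+ 2 * f x).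

(** [(1 + x^2) f] is in L^2, and so are [1 / (1 + x^2)] and [x / (1 + x^2)]; the products are
    integrable. *)
Lemma moment2_L1 f : moment2 f -> L1 f /\ L1 (fun x => x * f x).
Proof.
move=> [sf sxf].
have d0 (x : R) : 0 < 1 + x ^+ 2 by rewrite ltr_pwDl// sqr_ge0.
have dn (x : R) : 1 + x ^+ 2 != 0 by rewrite gt_eqF.
have mi : msr (fun x : R => (1 + x ^+ 2)^-1) by apply: msr_inv => //; solve_msr.
have [Lw _] := @cauchy_weight R 1 ltr01.
have Lw' : L1 (fun x : R => (1 + x ^+ 2)^-1).
  by move: Lw; congr L1; apply/funext => x; rewrite !mul1r.
have sg : sq_int (fun x => (1 + x ^+ 2) * f x).
  by have := sq_intD sf sxf; congr sq_int; apply/funext => x; ring.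
have s1 : sq_int (fun x : R => (1 + x ^+ 2)^-1).
  split => //; apply: (L1_dom _ Lw'); first exact: msrX.
  move=> x; rewrite ger0_norm ?sqr_ge0// expr2 ler_piMl ?invr_ge0 ?(ltW (d0 x))//.
  by rewrite invf_le1// lerDl sqr_ge0.
have s2 : sq_int (fun x : R => x * (1 + x ^+ 2)^-1).
  split; first by apply: msrM => //; exact: msr_id.
  apply: (L1_dom _ Lw'); first by apply: msrX; apply: msrM => //; exact: msr_id.
  move=> x; rewrite ger0_norm ?sqr_ge0// exprMn expr2 (expr2 _^-1) mulrA.
  rewrite ler_piMl ?invr_ge0 ?(ltW (d0 x))// -expr2 ler_pdivrMr// mul1r.
  by rewrite lerDr.
split.
  have := sq_int_mul s1 sg; congr L1; apply/funext => x.
  by rewrite mulrA mulVf ?mul1r.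
have := sq_int_mul s2 sg; congr L1; apply/funext => x.
by rewrite mulrA -(mulrA x) mulVf ?mulr1.
Qed.

Lemma moment2B f g : moment2 f -> moment2 g -> moment2 (fun x => f x - g x).
Proof.
move=> [sf sxf] [sg sxg]; split; first exact: sq_intB.
by have := sq_intB sxf sxg; congr sq_int; apply/funext => x; ring.
Qed.

Lemma L2wE f : (fun x => `|x| `^ 2 * f x) = (fun x => x ^+ 2 * f x).
Proof.
by apply/funext => x; rewrite powR_mulrn// real_normK// num_real.
Qed.

Lemma L2w2P f : L2w 2 f -> moment2 f.
Proof. by move=> [/L2P sf /L2P]; rewrite L2wE. Qed.

(** The transform factors as [w W], with [W] of L^2 norm below [sqrt (2 pi) e] by the H^s bound and
    [w = (1 + xi^2)^(- s / 2)] in L^2 because [s > 1/2]; Cauchy-Schwarz gives the L^1 bound. The L^2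
    bound on [f] is [parseval_le] together with [cmod (fh xi) <= W xi]. *)
Lemma Hs_norm_lt (s : R) : 1 / 2 < s -> exists2 C, 0 <= C &
  forall f (e : R), 0 < e -> L1 f -> (Hs_norm s f < e%:E)%E ->
  [/\ forall b, L1 (ft b f), forall b, \int[mu]_xi `|ft b f xi| <= C * e &
      \int[mu]_x f x ^+ 2 <= e ^+ 2].
Proof.
move=> s2; have LB := bessel_weight s2.
pose B := \int[mu]_x ((1 + x ^+ 2) `^ (- s) : R).
exists (Num.sqrt B * Num.sqrt (2 * pi)); first by rewrite mulr_ge0 ?sqrtr_ge0.
move=> f e e0 Lf.
have p2 : 0 < 2 * pi :> R by rewrite mulr_gt0 ?pi_gt0.
have sp : 0 < Num.sqrt (2 * pi) :> R by rewrite sqrtr_gt0.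
rewrite /Hs_norm lte_pdivrMl// -EFinM => /ereal_inf_lt[_ [fh Ff <-]].
have [_ Lfh _] := Ff.
have d0 (x : R) : 0 < 1 + x ^+ 2 by rewrite ltr_pwDl// sqr_ge0.
have mpow (a : R) : msr (fun x : R => (1 + x ^+ 2) `^ a).
  have m : msr (fun x : R => 1 + x ^+ 2) by solve_msr.
  exact: (measurableT_comp (measurable_powR a) m).
have mc : msr (fun xi => cmod (fh xi)).
  by apply: msr_cmod => b; exact: (fcomp_L2C b Lfh).1.
have c0 z : 0 <= @cmod R z by case: z => x y; exact: sqrtr_ge0.
move=> /(L2_norm_lt_sq_int (msrM (mpow _) mc))[].
set W := (fun x : R => _ * _) => sW IW.
have W0 xi : 0 <= W xi by rewrite mulr_ge0 ?powR_ge0.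
have cW xi : cmod (fh xi) <= W xi.
  rewrite ler_peMl// -[leLHS](powRr0 (1 + xi ^+ 2)) ler_powR//.
    by rewrite lerDl sqr_ge0.
  by rewrite divr_ge0//; lra.
have sc : sq_int (fun xi => cmod (fh xi)).
  by apply: (sq_int_dom mc sW) => xi; rewrite !ger0_norm.
pose w (x : R) := (1 + x ^+ 2) `^ (- (s / 2)).
have wE x : w x ^+ 2 = (1 + x ^+ 2) `^ (- s).
  by rewrite /w -powR_mulrn ?powR_ge0// -powRrM; congr (_ `^ _); field.
have sw : sq_int w.
  split; first exact: mpow.
  by move: LB; congr L1; apply/funext => x; rewrite wE.
have cE xi : cmod (fh xi) = w xi * W xi.
  rewrite /w /W powRN mulrA mulVf ?mul1r// gt_eqF// powR_gt0//.
have Lc : L1 (fun xi => cmod (fh xi)).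
  by have := sq_int_mul sw sW; congr L1; apply/funext => xi; rewrite -cE.
have aeE b := is_fourier_ft b Lf Ff.
have mb b : msr (fun xi => fcomp b (fh xi)) by exact: (fcomp_L2C b Lfh).1.
have Lb b : L1 (fun xi => fcomp b (fh xi)).
  by apply: (L1_dom (mb b) Lc) => xi; exact: fcomp_le.
have Lft b : L1 (ft b f) by apply: (L1_ae_eq (Lb b)) => //; exact: msr_ft.
split => // [b|].
- have <- : \int[mu]_xi `|fcomp b (fh xi)| = \int[mu]_xi `|ft b f xi|.
    apply: int_ae_eq; first exact: L1_norm.
      by apply: msr_norm; exact: msr_ft.
    by apply: ae_imp (aeE b) => xi /= ->.
  apply: (@le_trans _ _ (\int[mu]_xi (w xi * W xi))).
    apply: int_le; [exact: L1_norm|exact: sq_int_mul|] => xi.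
    by rewrite -cE fcomp_le.
  rewrite (le_trans (ler_norm _))// (le_trans (cauchy_schwarz_norm sw sW))//.
  rewrite -mulrA ler_pM ?sqrtr_ge0//.
    by rewrite (int_eq wE).
  rewrite -[leRHS]ger0_norm ?mulr_ge0 ?sqrtr_ge0 ?(ltW e0)// -sqrtr_sqr.
  by rewrite ler_wsqrtr// ltW.
- have := parseval_le Lf Lft => PL.
  rewrite -(ler_pM2l p2) (le_trans PL)//.
  apply: (@le_trans _ _ (\int[mu]_xi (W xi ^+ 2))); last first.
    by apply: ltW; move: IW; rewrite exprMn sqr_sqrtr// ltW.
  have -> : \int[mu]_xi (ft true f xi ^+ 2 + ft false f xi ^+ 2) =
      \int[mu]_xi (cmod (fh xi) ^+ 2).
    symmetry; apply: int_ae_eq; first exact: sc.2.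
      by apply: msrD; apply: msrX; exact: msr_ft.
    apply: ae_imp (ae_and (aeE true) (aeE false)) => xi /= [<- <-].
    exact: cmod_sqr.
  apply: int_le; [exact: sc.2|exact: sW.2|] => xi.
  by rewrite ler_sqr ?nnegrE.
Qed.

Lemma Hs_norm_ge0 (s : R) f : (0 <= Hs_norm s f)%E.
Proof.
apply: mule_ge0; first by rewrite lee_fin invr_ge0 sqrtr_ge0.
by apply: le_ereal_inf_tmp => _ [fh _ <-]; rewrite /L2_norm; exact: Lnorm_ge0.
Qed.

Lemma Hsr_norm_lt (s r : R) f (e : R) : (Hsr_norm s r f < e%:E)%E ->
  (Hs_norm s f < e%:E)%E /\ (L2w_norm r f < e%:E)%E.
Proof.
have key (x : \bar R) (y : \bar R) : (0 <= x -> x `^ 2 <= y ->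
    x <= y `^ 2^-1)%E.
  move=> x0 xy; have -> : x = ((x `^ 2) `^ 2^-1)%E.
    by rewrite -poweRrM mulfV// poweRe1.
  apply: gt0_ler_poweR => //; rewrite ?in_itv/= ?leey ?andbT ?poweR_ge0//.
  exact: le_trans (poweR_ge0 _ _) xy.
have w0 : (0 <= L2w_norm r f)%E by rewrite /L2w_norm /L2_norm; exact: Lnorm_ge0.
move=> lt_e; split; apply: le_lt_trans lt_e; apply: key => //.
- exact: Hs_norm_ge0.
- by rewrite leeDl// poweR_ge0.
- by rewrite leeDr// poweR_ge0.
Qed.

Lemma int_sqrD_le f g : sq_int f -> sq_int g ->
  \int[mu]_x f x ^+ 2 <=
  2 * \int[mu]_x g x ^+ 2 + 2 * \int[mu]_x (f x - g x) ^+ 2.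
Proof.
move=> sf sg; have sd := sq_intB sf sg.
rewrite -(intZ _ sg.2) -(intZ _ sd.2) -intD; last 2 first.
- by apply: L1Z; exact: sg.2.
- by apply: L1Z; exact: sd.2.
apply: int_le; first exact: sf.2.
  by apply: L1D; apply: L1Z; [exact: sg.2|exact: sd.2].
by move=> x; have := sqr_ge0 (2 * g x - f x); nra.
Qed.

(** Bounds uniform in time with a single constant; the H^s norm is recorded as an L^1 bound on both
    components of the transform. *)
Definition bounded_data (T M : R) (u : R -> R -> R) := forall t : R, t \in `[0, T] ->
  [/\ moment2 (u t), forall b, L1 (ft b (u t)),
      \int[mu]_x u t x ^+ 2 <= M,
      \int[mu]_x (x ^+ 2 * u t x) ^+ 2 <= M &
      forall b, \int[mu]_xi `|ft b (u t) xi| <= M].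

Section continuous_solution.
Context (s T : R) (u : R -> R -> R).
Context (s2 : 1 / 2 < s) (T0 : 0 <= T) (cu : continuous_Hsr s 2 T u).

Let moment2_u (t : R) : t \in `[0, T] -> moment2 (u t).
Proof. by move=> /cu[[_ /L2w2P]]. Qed.

Let L1_ft_u (t : R) b : t \in `[0, T] -> L1 (ft b (u t)).
Proof.
move=> tT; have [[[_ Hfin] _] _] := cu tT.
have [C _ hC] := Hs_norm_lt s2.
have [e [e0 He]] : exists e : R, 0 < e /\ (Hs_norm s (u t) < e%:E)%E.
  exists (fine (Hs_norm s (u t)) + 1); split.
    by rewrite ltr_wpDl// fine_ge0// Hs_norm_ge0.
  rewrite EFinD fineK ?ge0_fin_numE ?Hs_norm_ge0//.
  by rewrite lteDl// ge0_fin_numE ?Hs_norm_ge0.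
have [+ _ _] := hC _ _ e0 (moment2_L1 (moment2_u tT)).1 He.
exact.
Qed.

Let near_u (t0 e : R) : t0 \in `[0, T] -> 0 < e ->
  \forall t \near within `[0, T] (nbhs (t0 : R)),
  (Hs_norm s (fun x => u t x - u t0 x)%R < e%:E)%E /\
  (L2w_norm 2 (fun x => u t x - u t0 x)%R < e%:E)%E.
Proof.
move=> t0T e0; have [_ h] := cu t0T.
by apply: filterS (cvg0_lt _ h e0) => t; exact: Hsr_norm_lt.
Qed.

Let near_sqr (t0 e : R) : t0 \in `[0, T] -> 0 < e ->
  \forall t \near within `[0, T] (nbhs t0), t \in `[0, T] ->
  \int[mu]_x (u t x - u t0 x) ^+ 2 <= e ^+ 2.
Proof.
move=> t0T e0; have [C _ hC] := Hs_norm_lt s2.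
apply: filterS (near_u t0T e0) => t [He _] tT.
by have [] := hC _ _ e0 (moment2_L1 (moment2B (moment2_u tT) (moment2_u t0T))).1 He.
Qed.

(** Near [t0] the solution is within norm 1 of [u t0], which bounds each quantity locally;
    [segment_bounded] makes the bounds uniform. *)
Lemma continuous_Hsr_bounded : exists2 M, 0 < M & bounded_data T M u.
Proof.
have [C C0 hC] := Hs_norm_lt s2.
have [M1 h1] : exists M, forall t : R, t \in `[0, T] -> \int[mu]_x u t x ^+ 2 <= M.
  apply: segment_bounded => t0 t0T.
  exists (2 * \int[mu]_x u t0 x ^+ 2 + 2).
  have nT : \forall t \near within `[0, T] (nbhs t0), t \in `[0, T].
    by apply: withinT.
  apply: filterS2 nT (near_sqr t0T ltr01) => t tT /(_ tT) h.
  rewrite (le_trans (int_sqrD_le (moment2_u tT).1 (moment2_u t0T).1))//.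
  by move: h; rewrite expr1n; lra.
have [M2 h2] : exists M, forall t : R, t \in `[0, T] ->
    \int[mu]_x (x ^+ 2 * u t x) ^+ 2 <= M.
  apply: segment_bounded => t0 t0T.
  exists (2 * \int[mu]_x (x ^+ 2 * u t0 x) ^+ 2 + 2).
  have nT : \forall t \near within `[0, T] (nbhs t0), t \in `[0, T].
    by apply: withinT.
  apply: filterS2 nT (near_u t0T ltr01) => t tT [_].
  rewrite /L2w_norm L2wE => hw.
  rewrite (le_trans (int_sqrD_le (moment2_u tT).2 (moment2_u t0T).2))//.
  have [md _] := (moment2B (moment2_u tT) (moment2_u t0T)).2.
  have [_] := L2_norm_lt_sq_int md hw.
  under [in X in _ + 2 * X <= _]int_eq do rewrite -mulrBr.
  by rewrite expr1n /=; lra.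
have [M3 h3] : exists M, forall t : R, t \in `[0, T] ->
    \int[mu]_xi `|ft true (u t) xi| + \int[mu]_xi `|ft false (u t) xi| <= M.
  apply: segment_bounded => t0 t0T.
  exists (\int[mu]_xi `|ft true (u t0) xi| + \int[mu]_xi `|ft false (u t0) xi| + (C + C)).
  have nT : \forall t \near within `[0, T] (nbhs t0), t \in `[0, T].
    by apply: withinT.
  apply: filterS2 nT (near_u t0T ltr01) => t tT [hs _].
  have [Lu _] := moment2_L1 (moment2_u tT).
  have [Lu0 _] := moment2_L1 (moment2_u t0T).
  have [Ld Id _] := hC _ _ ltr01 (L1B Lu Lu0) hs.
  have key b : \int[mu]_xi `|ft b (u t) xi| <= \int[mu]_xi `|ft b (u t0) xi| + C.
    rewrite -[C]mulr1 (le_trans _ (lerD (lexx _) (Id b)))//.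
    rewrite -intD; [|exact/L1_norm/L1_ft_u|exact: L1_norm].
    apply: int_le; first exact/L1_norm/L1_ft_u.
      by apply: L1D; apply: L1_norm => //; exact: L1_ft_u.
    move=> xi; rewrite ftB// -[in leLHS](subrK (ft b (u t0) xi) (ft b (u t) xi)) addrC.
    exact: ler_normD.
  by rewrite addrACA lerD.
exists (`|M1| + `|M2| + `|M3| + 1); first by rewrite ltr_wpDl ?addr_ge0.
move=> t tT; split.
- exact: moment2_u.
- by move=> b; exact: L1_ft_u.
- rewrite (le_trans (h1 t tT))//.
  by have := ler_norm M1; have := normr_ge0 M2; have := normr_ge0 M3; lra.
- rewrite (le_trans (h2 t tT))//.
  by have := ler_norm M2; have := normr_ge0 M1; have := normr_ge0 M3; lra.
- move=> b; have := h3 t tT.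
  have i1 : 0 <= \int[mu]_xi `|ft true (u t) xi| by exact: int_ge0.
  have i2 : 0 <= \int[mu]_xi `|ft false (u t) xi| by exact: int_ge0.
  have := ler_norm M3; have := normr_ge0 M1; have := normr_ge0 M2.
  by case: b; lra.
Qed.

(** For short times [u t] is within half the L^2 norm of [u 0]; with [N] the integral of [u 0 ^ 2],
    the inequality [N <= 2 |u t|^2 + 2 (N / 4)] then gives the claim. *)
Lemma continuous_Hsr_lower_bound : 0 < \int[mu]_x u 0 x ^+ 2 ->
  exists2 d, 0 < d & forall t : R, t \in `[0, T] -> t < d ->
    \int[mu]_x u 0 x ^+ 2 / 4 <= \int[mu]_x u t x ^+ 2.
Proof.
set N := \int[mu]_x _ => N0.
have t0T : 0 \in `[0, T] by rewrite in_itv/= lexx.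
have e0 : 0 < Num.sqrt (N / 4) by rewrite sqrtr_gt0 divr_gt0.
have := near_sqr t0T e0; rewrite near_withinE => -[d /= d0 hd].
exists d => // t tT td.
have tb : ball_ Num.norm (0 : R) d t.
  by rewrite /ball_ /= sub0r normrN ger0_norm//; move: tT; rewrite in_itv/= => /andP[].
have := hd t tb tT tT; rewrite sqr_sqrtr ?divr_ge0 ?(ltW N0)// => h.
have := int_sqrD_le (moment2_u t0T).1 (moment2_u tT).1; rewrite -/N.
have -> : \int[mu]_x (u 0 x - u t x) ^+ 2 = \int[mu]_x (u t x - u 0 x) ^+ 2.
  by apply: int_eq => x; ring.
lra.
Qed.

End continuous_solution.

End sobolev.

                        

(** * The integral equation on the Fourier side, tested against functions *)

(** The real part and minus the imaginary part of [(c - i d) (p - i q)]. *)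
Definition phase_mul {R : realType} (b : bool) (c d p q : R) : R :=
  if b then c * p - d * q else c * q + d * p.

Section duhamel.
Context {R : realType}.
Local Notation mu := (@lebesgue_measure R).
Implicit Types f g h : R -> R.

Lemma fcompM b (c d : R) (z : R[i]) :
  fcomp b ((c -i* d)%C * z) = phase_mul b c d (fcomp true z) (fcomp false z).
Proof. by case: z => x y; case: b => /=; ring. Qed.

Lemma phase_mul_bound b (c d p q : R) : `|c| <= 1 -> `|d| <= 1 ->
  `|phase_mul b c d p q| <= `|p| + `|q|.
Proof.
move=> c1 d1; case: b; rewrite /phase_mul.
  by rewrite (le_trans (ler_normB _ _))// !normrM lerD// ler_piMl.
by rewrite (le_trans (ler_normD _ _))// !normrM addrC lerD// ler_piMl.
Qed.

Lemma msr_phase_mul b (c d p q : R -> R) : msr c -> msr d -> msr p -> msr q ->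
  msr (fun x => phase_mul b (c x) (d x) (p x) (q x)).
Proof.
by move=> *; case: b; [apply: msrB|apply: msrD]; exact: msrM.
Qed.

Lemma L1_phase_mul_ft b f h (c d : R -> R) : L1 f -> L1 h -> msr c -> msr d ->
  (forall x, `|c x| <= 1) -> (forall x, `|d x| <= 1) ->
  L1 (fun xi => phase_mul b (c xi) (d xi) (ft true f xi) (ft false f xi) * h xi).
Proof.
move=> Lf Lh mc md c1 d1.
have H := @L1_mul_bounded R (\int[mu]_x `|f x| + \int[mu]_x `|f x|) h
  (fun xi => phase_mul b (c xi) (d xi) (ft true f xi) (ft false f xi)) Lh.
have := H (msr_phase_mul b mc md (msr_ft _ Lf) (msr_ft _ Lf)) _.
rewrite (_ : (fun x => h x * _) = fun xi =>
  phase_mul b (c xi) (d xi) (ft true f xi) (ft false f xi) * h xi); last first.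
  by apply/funext => x; rewrite mulrC.
apply => x; rewrite (le_trans (phase_mul_bound _ _ _ (c1 x) (d1 x)))// lerD// ft_bound//.
Qed.

(** An almost-everywhere identity between L^2 transforms becomes an identity of real integrals, with
    the integral transform of [f] on the right because [f] is integrable. *)
Lemma multiplier_pairing b (m : R -> R[i]) (c d : R -> R) f g h :
  fourier_multiplier m f g -> (forall xi, m xi = (c xi -i* d xi)%C) ->
  msr c -> msr d -> (forall x, `|c x| <= 1) -> (forall x, `|d x| <= 1) ->
  L1 f -> L1 h -> sq_int h -> sq_int (ft b h) ->
  sq_int g /\
  \int[mu]_x (g x * ft b h x) =
  \int[mu]_xi (phase_mul b (c xi) (d xi) (ft true f xi) (ft false f xi) * h xi).
Proof.
move=> [fh [gh [Ff Fg gm]]] mE mc md c1 d1 Lf Lh sh sfh.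
split; first by case: Fg => /L2P.
rewrite -(is_fourier_pairing Fg Lh sh sfh).
have [_ Lgh _] := Fg.
apply: int_ae_eq.
- exact: sq_int_mul (fcomp_L2C b Lgh) sh.
- exact: msr_L1 (L1_phase_mul_ft b Lf Lh mc md c1 d1).
- apply: ae_imp (ae_and gm (ae_and (is_fourier_ft true Lf Ff) (is_fourier_ft false Lf Ff))).
  by move=> xi /= [-> [<- <-]]; rewrite mE fcompM.
Qed.

                                                            
(** The phase of the linear group, whose symbol is [exp(- i t theta)]. Its second derivative jumps
    at 0, since [theta] behaves as [xi - xi |xi|] there. *)
Definition theta (xi : R) : R := xi / (1 + `|xi|).

Lemma norm_theta xi : `|theta xi| <= 1.
Proof.
have p : 0 < 1 + `|xi| by rewrite ltr_pwDl.
by rewrite /theta normrM normfV (gtr0_norm p) ler_pdivrMr// mul1r lerDr.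
Qed.

Lemma norm_theta_le xi : `|theta xi| <= `|xi|.
Proof.
have p : 0 < 1 + `|xi| by rewrite ltr_pwDl.
rewrite /theta normrM normfV (gtr0_norm p) ler_pdivrMr//.
by rewrite mulrDr mulr1 lerDl mulr_ge0.
Qed.

Lemma msr_theta : msr theta.
Proof.
apply: msrM; first exact: msr_id.
apply: msr_inv; last by solve_msr.
by move=> x; rewrite gt_eqF// ltr_pwDl.
Qed.

Lemma group_symbol_theta t xi :
  group_symbol t xi = (cos (t * theta xi) -i* sin (t * theta xi))%C.
Proof. by rewrite group_symbolE /theta !mulrA. Qed.

Lemma group_rbo_symbol_theta t xi : group_symbol t xi * rbo_symbol xi =
  (theta xi * sin (t * theta xi) -i* - (theta xi * cos (t * theta xi)))%C.
Proof.
rewrite group_symbol_theta rbo_symbolE -/(theta xi); apply/eqP.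
by rewrite eq_complex /=; apply/andP; split; apply/eqP; ring.
Qed.

(** Component [b] of [i theta exp(- i (t - tau) theta)] times the transform of [f]; in use [f] is
    the square of [u tau]. *)
Definition duhamel_term b (t tau : R) (f : R -> R) (xi : R) : R :=
  let a := (t - tau) * theta xi in
  phase_mul b (theta xi * sin a) (- (theta xi * cos a)) (ft true f xi) (ft false f xi).

Lemma duhamel_term_coef (t tau : R) :
  [/\ msr (fun xi => theta xi * sin ((t - tau) * theta xi)),
      msr (fun xi => - (theta xi * cos ((t - tau) * theta xi))),
      forall xi, `|theta xi * sin ((t - tau) * theta xi)| <= 1 &
      forall xi, `|- (theta xi * cos ((t - tau) * theta xi))| <= 1].
Proof.
have mth := msr_theta.
split; [by solve_msr|by solve_msr|move=> xi|move=> xi]; rewrite ?normrN normrM.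
  by rewrite mulr_ile1 ?norm_theta ?sin_max.
by rewrite mulr_ile1 ?norm_theta ?cos_max.
Qed.

Lemma L1_duhamel_term b t tau f h : L1 f -> L1 h ->
  L1 (fun xi => duhamel_term b t tau f xi * h xi).
Proof.
by move=> Lf Lh; have [mc md c1 d1] := duhamel_term_coef t tau; exact: L1_phase_mul_ft.
Qed.

(** The time integral appears as a left Riemann sum on the uniform partition, one of the sums that
    [is_L2_integral] controls. Cauchy-Schwarz turns its L^2 error into the scalar error [e]. *)
Lemma duhamel_pairing (T M : R) (phi : R -> R) (u : R -> R -> R) b (t : R) h (e : R) :
  bounded_data T M u -> mild_solution T phi u -> t \in `[0, T] -> L1 phi ->
  L1 h -> sq_int h -> sq_int (ft b h) -> 0 < e ->
  \forall n \near \oo,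
  `|\int[mu]_xi (ft b (u t) xi * h xi)
    - \int[mu]_xi (phase_mul b (cos (t * theta xi)) (sin (t * theta xi))
        (ft true phi xi) (ft false phi xi) * h xi)
    + 2^-1 * \sum_(k < n) t / n%:R *
        \int[mu]_xi (duhamel_term b t (t * k%:R / n%:R)
          (fun x => u (t * k%:R / n%:R) x ^+ 2) xi * h xi)| <= e.
Proof.
move=> bu [_ mild] tT Lphi Lh sh sfh e0.
have [v [F [w [mv mF [/L2P sw wint] uvw]]]] := mild _ tT.
have /andP[t0 tleT] : 0 <= t <= T by move: tT; rewrite in_itv.
have subT tau : tau \in `[0, t] -> tau \in `[0, T].
  by rewrite !in_itv/= => /andP[-> h1]; exact: le_trans h1 tleT.
have mth := msr_theta.
have [sv vE] : sq_int v /\ \int[mu]_x (v x * ft b h x) =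
    \int[mu]_xi (phase_mul b (cos (t * theta xi)) (sin (t * theta xi))
        (ft true phi xi) (ft false phi xi) * h xi).
  apply: (multiplier_pairing mv (group_symbol_theta t)) => //.
  - by solve_msr.
  - by solve_msr.
  - by move=> x; exact: cos_max.
  - by move=> x; exact: sin_max.
have FE tau : tau \in `[0, t] -> sq_int (F tau) /\ \int[mu]_x (F tau x * ft b h x) =
    \int[mu]_xi (duhamel_term b t tau (fun x => u tau x ^+ 2) xi * h xi).
  move=> taut; have [mc md c1 d1] := duhamel_term_coef t tau.
  apply: (multiplier_pairing (mF tau taut) (group_rbo_symbol_theta (t - tau))) => //.
  by have [[[_ +] _] _ _ _ _] := bu tau (subT _ taut).
have [mu_t _ _ _ _] := bu t tT.
have [Lu _] := moment2_L1 mu_t.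
have uE : \int[mu]_xi (ft b (u t) xi * h xi) =
    \int[mu]_x (v x * ft b h x) - 2^-1 * \int[mu]_x (w x * ft b h x).
  rewrite (ft_mul b Lu Lh).2 -intZ; last exact: sq_int_mul.
  rewrite -intB; [|exact: sq_int_mul|by apply: L1Z; exact: sq_int_mul].
  apply: int_ae_eq.
  - exact: sq_int_mul mu_t.1 sfh.
  - apply: msrB; first by apply: msrM; [exact: sv.1|exact: sfh.1].
    by do 2 (apply: msrM; first by [exact: msr_cst|exact: sw.1]); exact: sfh.1.
  - by apply: ae_imp uvw => x /= ->; rewrite mulrBl mulrA.
pose K := Num.sqrt (\int[mu]_x (ft b h x ^+ 2)).
have K0 : 0 <= K by exact: sqrtr_ge0.
(* [K + 1] in place of [K] avoids dividing by zero. *)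
have eK : 0 < e / (K + 1) by rewrite divr_gt0// ltr_wpDl.
have [delta d0 hdelta] := wint _ eK.
near=> n.
have n0 : (0 < n)%N by near: n; exact: nbhs_infty_gt.
have nn0 : n%:R != 0 :> R by rewrite pnatr_eq0 -lt0n.
have np : 0 < n%:R :> R by rewrite ltr0n.
pose p (k : nat) : R := t * k%:R / n%:R.
have dp k : p k.+1 - p k = t / n%:R by rewrite /p -natr1; field.
have tn : t / n%:R < delta.
  rewrite ltr_pdivrMr// -ltr_pdivrMl//.
  apply: (lt_le_trans (truncnS_gt _)); rewrite ler_nat.
  by near: n; exact: nbhs_infty_gt.
have tn0 : 0 <= t / n%:R by rewrite divr_ge0.
have pt (k : nat) : (k < n)%N -> p k \in `[0, t].
  move=> kn; rewrite in_itv/= /p divr_ge0 ?mulr_ge0//= ler_pdivrMr//.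
  by rewrite ler_wpM2l// ler_nat ltnW.
have p0 : p 0%N = 0 by rewrite /p mulr0 mul0r.
have pn : p n = t by rewrite /p mulfK.
have := hdelta n p p p0 pn.
have pk k : (k < n)%N -> p k <= p k <= p k.+1 /\ p k.+1 - p k < delta.
  by move=> kn; rewrite lexx dp tn -subr_ge0 dp tn0.
move=> /(_ pk).
have sF (k : nat) : (k < n)%N -> sq_int (F (p k)) by move=> kn; have [] := FE _ (pt k kn).
pose S x := \sum_(k < n) (t / n%:R) * F (p k) x.
have sS : sq_int S.
  apply: (@sq_int_sum _ n (fun k x => (t / n%:R) * F (p k) x)) => k kn.
  exact/sq_intZ/sF.
have -> : (fun x => \sum_(k < n) (p k.+1 - p k) * F (p k) x - w x) = (fun x => S x - w x).
  by apply/funext => x; rewrite /S; under eq_bigr do rewrite dp.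
rewrite L2_normE; last exact: sq_intB.
rewrite lte_fin => Sw.
have SE : \sum_(k < n) t / n%:R *
        \int[mu]_xi (duhamel_term b t (t * k%:R / n%:R)
          (fun x => u (t * k%:R / n%:R) x ^+ 2) xi * h xi) =
    \int[mu]_x (S x * ft b h x).
  pose F' (k : nat) (x : R) : R :=
    if (k < n)%N then t / n%:R * (F (p k) x * ft b h x) else 0.
  have LF' k : L1 (F' k).
    have [kn|kn] := boolP (k < n)%N; rewrite /F' ?kn ?(negbTE kn); last exact: L1_cst0.
    by apply: L1Z; apply: sq_int_mul => //; exact: sF.
  transitivity (\int[mu]_x (\sum_(k < n) F' k x)).
    rewrite int_sum//; apply: eq_bigr => k _.
    rewrite /F' ltn_ord intZ; last by apply: sq_int_mul => //; exact: sF.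
    by rewrite (FE _ (pt k _)).2.
  apply: int_eq => x; rewrite /S mulr_suml; apply: eq_bigr => k _.
  by rewrite /F' ltn_ord mulrA.
rewrite uE vE SE.
set V := \int[mu]_xi (phase_mul _ _ _ _ _ * _).
have -> : V - 2^-1 * \int[mu]_x (w x * ft b h x) - V + 2^-1 * \int[mu]_x (S x * ft b h x) =
   2^-1 * \int[mu]_x ((S x - w x) * ft b h x).
  have -> : \int[mu]_x ((S x - w x) * ft b h x) =
     \int[mu]_x (S x * ft b h x) - \int[mu]_x (w x * ft b h x).
    rewrite -intB; [|exact: sq_int_mul|exact: sq_int_mul].
    by apply: int_eq => x; rewrite mulrBl.
  ring.
rewrite normrM ger0_norm// mulrC ler_pdivrMr//.
apply: (le_trans (cauchy_schwarz_norm (sq_intB sS sw) sfh)); rewrite -/K.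
apply: (@le_trans _ _ (e / (K + 1) * K)); first by rewrite ler_wpM2r// ltW.
rewrite -mulrA; apply: (@le_trans _ _ (e * 1)); last by lra.
by rewrite ler_wpM2l ?(ltW e0)// mulrC ler_pdivrMr ?ltr_wpDl// mul1r lerDl.
Unshelve. all: by end_near. Qed.

End duhamel.

                   

(** * Zero initial data produce the zero solution *)

Section uniqueness.
Context {R : realType}.
Local Notation mu := (@lebesgue_measure R).
Implicit Types f g h : R -> R.

(** On [[a, a + r]] the function stays within [L r] of [g a], so [|g a| <= B + L r] with [r]
    arbitrarily small. This converts bounds on pairings with indicators into pointwise bounds. *)
Lemma average_bound g (L M B a : R) : msr g -> (forall x, `|g x| <= M) ->
  (forall x y, `|g x - g y| <= `|x - y| * L) ->
  (forall r, 0 < r -> `|\int[mu]_x (g x * \1_(`[a, a + r]) x)| <= r * B) ->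
  `|g a| <= B.
Proof.
move=> mg gM gL gB.
have L0 : 0 <= L by have := gL 1 0; have := normr_ge0 (g 1 - g 0); rewrite subr0 normr1; lra.
apply/ler_addgt0Pl => e e0.
pose r := e / (L + 1).
have r0 : 0 < r by rewrite divr_gt0// ltr_wpDl.
have ar : a <= a + r by rewrite lerDl ltW.
have L1g (c : R) : L1 (fun x => (g x - c) * \1_(`[a, a + r]) x).
  have := @L1_itv_bounded R a (a + r) (M + `|c|) (fun x => g x - c).
  rewrite (_ : (fun x => \1_(`[a, a + r]) x * (g x - c)) =
    (fun x => (g x - c) * \1_(`[a, a + r]) x)); last by apply/funext => x; rewrite mulrC.
  apply; first by apply: msrB => //; exact: msr_cst.
  by move=> x; rewrite (le_trans (ler_normB _ _))// lerD2r.
have Lg : L1 (fun x => g x * \1_(`[a, a + r]) x).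
  by have := L1g 0; congr L1; apply/funext => x; rewrite subr0.
have E : \int[mu]_x ((g x - g a) * \1_(`[a, a + r]) x) =
    \int[mu]_x (g x * \1_(`[a, a + r]) x) - r * g a.
  transitivity (\int[mu]_x (g x * \1_(`[a, a + r]) x - g a * \1_(`[a, a + r]) x)).
    by apply: int_eq => x; rewrite mulrBl.
  rewrite intB//; last exact/L1Z/L1_itv.
  have -> : \int[mu]_x (g a * \1_(`[a, a + r]) x) =
      g a * \int[mu]_x (\1_(`[a, a + r]) x : R) by exact: intZ (L1_itv _ _).
  by rewrite (int_itv1 ar); congr (_ - _); ring.
have : `|\int[mu]_x ((g x - g a) * \1_(`[a, a + r]) x)| <= r * L * r.
  apply: (@le_trans _ _ (\int[mu]_x (r * L * \1_(`[a, a + r]) x))).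
    apply: int_norm_le => //; first exact/L1Z/L1_itv.
    move=> x; rewrite indicE; have [xa|] := boolP (x \in _); last first.
      by move=> _; rewrite !mulr0 normr0.
    rewrite !mulr1 (le_trans (gL _ _))// ler_wpM2r//.
    by move: xa; rewrite inE/= in_itv/= ler_norml => /andP[h1 h2]; lra.
  have -> : \int[mu]_x (r * L * \1_(`[a, a + r]) x) =
      r * L * \int[mu]_x (\1_(`[a, a + r]) x : R) by exact: intZ (L1_itv _ _).
  by rewrite (int_itv1 ar); have -> : a + r - a = r by ring.
rewrite E => h1; have h2 := gB r r0.
have h3 : r * `|g a| <= r * L * r + r * B.
  have -> : r * `|g a| = `|r * g a| by rewrite normrM (gtr0_norm r0).
  apply: le_trans (lerD h1 h2).
  set I := \int[mu]_x _; rewrite -normrN.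
  by rewrite [X in `|X| <= _](_ : _ = (I - r * g a) - I); [exact: ler_normB|ring].
have h4 : r * `|g a| <= r * (L * r + B) by move: h3; lra.
move: h4; rewrite ler_pM2l// => h4; rewrite (le_trans h4)// lerD2r.
by rewrite /r mulrCA ler_piMr ?(ltW e0)// ler_pdivrMr ?ltr_wpDl// mul1r lerDl.
Qed.

(** Each term is at most the increment of [expR (K tau) / K] over its cell, by [1 + x <= expR x];
    the increments telescope. *)
Lemma exp_sum_le (K t : R) (n : nat) : 0 < K -> 0 <= t -> (0 < n)%N ->
  \sum_(k < n) t / n%:R * expR (K * (t * k%:R / n%:R)) <= expR (K * t) / K.
Proof.
move=> K0 t0 n0.
have nn0 : n%:R != 0 :> R by rewrite pnatr_eq0 -lt0n.
pose G (k : nat) := expR (K * (t * k%:R / n%:R)) / K.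
apply: (@le_trans _ _ (\sum_(k < n) (G k.+1 - G k))).
  apply: ler_sum => k _; rewrite /G.
  have -> : K * (t * k.+1%:R / n%:R) = K * (t / n%:R) + K * (t * k%:R / n%:R).
    by rewrite -natr1; field.
  rewrite expRD; set E := expR (K * (t * _ / _)).
  have E0 : 0 < E by exact: expR_gt0.
  have := expR_ge1Dx (K * (t / n%:R)); set X := expR _ => hX.
  rewrite -mulrBl ler_pdivlMr//.
  have -> : t / n%:R * E * K = K * (t / n%:R) * E by ring.
  have -> : X * E - E = (X - 1) * E by ring.
  by rewrite ler_wpM2r ?(ltW E0)//; lra.
have -> : \sum_(k < n) (G k.+1 - G k) = G n - G 0%N.
  by rewrite -(telescope_sumr _ (leq0n n)) big_mkord.
by rewrite /G mulfK// lerBlDr lerDl divr_ge0 ?expR_ge0 ?ltW.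
Qed.

Lemma sqr_le_1Dpow4 (x : R) : x ^+ 2 <= 1 + (x ^+ 2) ^+ 2.
Proof. by set y := x ^+ 2; have := sqr_ge0 (y - 1); rewrite !expr2; nra. Qed.

Lemma norm_le_1Dsqr (x : R) : `|x| <= 1 + x ^+ 2.
Proof.
rewrite -(real_normK (num_real x)); set y := `|x|.
by have := sqr_ge0 (y - 1); rewrite !expr2; nra.
Qed.

Lemma moment2_sqr f : moment2 f ->
  [/\ L1 (fun x => f x ^+ 2), L1 (fun x => x * f x ^+ 2) &
      L1 (fun x => x ^+ 2 * f x ^+ 2)].
Proof.
move=> [[mf Lf] [_ Lxf]].
have L2 : L1 (fun x => x ^+ 2 * f x ^+ 2).
  apply: (L1_dom _ (L1D Lf Lxf)).
    by apply: msrM; apply: msrX => //; exact: msr_id.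
  move=> x; rewrite ger0_norm ?(mulr_ge0 (sqr_ge0 _) (sqr_ge0 _))// exprMn.
  by rewrite -[X in X + _]mul1r -mulrDl ler_wpM2r ?sqr_ge0 ?sqr_le_1Dpow4 ?norm_le_1Dsqr.
split => //; apply: (L1_dom _ (L1D Lf L2)).
  by apply: msrM; [exact: msr_id|exact: msrX].
move=> x; rewrite normrM (ger0_norm (sqr_ge0 (f x))).
by rewrite -[X in X + _]mul1r -mulrDl ler_wpM2r ?sqr_ge0 ?sqr_le_1Dpow4 ?norm_le_1Dsqr.
Qed.

Lemma duhamel_term_bound b t tau f xi : L1 f ->
  `|duhamel_term b t tau f xi| <= 2 * \int[mu]_x `|f x|.
Proof.
move=> Lf; have [_ _ c1 d1] := duhamel_term_coef t tau.
rewrite /duhamel_term (le_trans (phase_mul_bound _ _ _ (c1 xi) (d1 xi)))//.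
by rewrite mulr2n mulrDl mul1r lerD// ft_bound.
Qed.

Lemma ft_zero b f xi : msr f -> {ae mu, forall x, f x = 0} -> ft b f xi = 0.
Proof.
move=> mf f0; rewrite -(@ft_ae_eq _ b (fun=> 0) f xi L1_cst0 mf).
  by rewrite /ft; under int_eq do rewrite mul0r; rewrite /Rintegral integral0.
by apply: ae_imp f0 => x /= ->.
Qed.

Lemma phase_mul0 b (c d : R) : phase_mul b c d 0 0 = 0.
Proof. by case: b; rewrite /phase_mul !mulr0 ?subrr ?addr0. Qed.

(** With zero data only the Duhamel sum remains. Its terms are at most twice the integral of
    [u tau ^ 2], the factor 2 is absorbed by the [1/2] of the equation, and summing the envelope in
    time divides it by [K]. Testing on [[xi, xi + r]] and [average_bound] make the bound
    pointwise. *)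
Lemma ft_u_bound (T M m K : R) (phi : R -> R) (u : R -> R -> R) :
  bounded_data T M u -> mild_solution T phi u -> L1 phi ->
  (forall b xi, ft b phi xi = 0) -> 0 < K -> 0 <= m ->
  (forall tau : R, tau \in `[0, T] -> \int[mu]_x u tau x ^+ 2 <= m * expR (K * tau)) ->
  forall b (t xi : R), t \in `[0, T] ->
    `|ft b (u t) xi| <= m * (expR (K * t) / K).
Proof.
move=> bu mild Lphi phi0 K0 m0 Nm b t xi tT.
have [mom _ _ _ _] := bu t tT; have [Lu Lxu] := moment2_L1 mom.
have /andP[t0 tleT] : 0 <= t <= T by move: tT; rewrite in_itv.
apply: (@average_bound _ (\int[mu]_x `|x * u t x|) (\int[mu]_x `|u t x|)).
- exact: msr_ft.
- by move=> x; exact: ft_bound.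
- by move=> x y; exact: ft_lipschitz.
move=> r r0; have ar : xi <= xi + r by rewrite lerDl ltW.
apply/ler_addgt0Pl => e e0.
pose h : R -> R := \1_(`[xi, xi + r]).
have Lh : L1 h by exact: L1_itv.
have duh := duhamel_pairing bu mild tT Lphi Lh (sq_int_indic _ _) (sq_int_ft_itv b ar) e0.
have [n [n0 hn]] := filter_ex (filterI (nbhs_infty_gt 0) duh).
move: hn; set S := \sum_(k < n) _; set V := \int[mu]_x (phase_mul _ _ _ _ _ * _).
have -> : V = 0.
  rewrite /V (_ : (fun x => _) = (fun=> 0)); last first.
    by apply/funext => x; rewrite !phi0 phase_mul0 mul0r.
  by rewrite /Rintegral integral0.
rewrite subr0 => hn.
have Sle : `|S| <= 2 * (r * (m * (expR (K * t) / K))).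
  rewrite /S (le_trans (ler_norm_sum _ _ _))//.
  apply: (@le_trans _ _ (\sum_(k < n) (2 * r * m) * (t / n%:R * expR (K * (t * k%:R / n%:R))))).
    apply: ler_sum => k _; set c := t * k%:R / n%:R.
    have cT : c \in `[0, T].
      have np : 0 < n%:R :> R by rewrite ltr0n.
      rewrite in_itv/= /c divr_ge0 ?mulr_ge0//= (le_trans _ tleT)// ler_pdivrMr//.
      by rewrite ler_wpM2l// ler_nat ltnW.
    have [momc _ _ _ _] := bu c cT; have [Lc _ _] := moment2_sqr momc.
    rewrite normrM ger0_norm ?divr_ge0// mulrCA ler_wpM2l ?divr_ge0//.
    apply: (@le_trans _ _ (\int[mu]_x (2 * (m * expR (K * c)) * h x))).
      apply: int_norm_le; [exact: L1_duhamel_term|exact: L1Z|] => x.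
      rewrite normrM (ger0_norm (x := h x)); last by rewrite /h indicE.
      rewrite ler_wpM2r//.
      rewrite (le_trans (duhamel_term_bound _ _ _ _ Lc))// ler_wpM2l//.
      apply: le_trans (Nm c cT); rewrite le_eqVlt; apply/orP; left; apply/eqP.
      by apply: int_eq => y; rewrite ger0_norm ?sqr_ge0.
    rewrite intZ// /h (int_itv1 ar) (_ : xi + r - xi = r); last by ring.
    by rewrite le_eqVlt; apply/orP; left; apply/eqP; ring.
  rewrite -mulr_sumr.
  apply: (@le_trans _ _ ((2 * r * m) * (expR (K * t) / K))).
    by rewrite ler_wpM2l ?exp_sum_le// mulr_ge0// mulr_ge0// ltW.
  by rewrite le_eqVlt; apply/orP; left; apply/eqP; ring.
set I := \int[mu]_x _ in hn *.
have -> : I = (I + 2^-1 * S) - 2^-1 * S by ring.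
rewrite (le_trans (ler_normB _ _))// lerD// normrM ger0_norm//.
by rewrite ler_pdivrMl.
Qed.

(** Multiplying the pointwise bound of [ft_u_bound], taken with [K = M], by the L^1 bound [M] shows
    that each component of the transform has squared integral at most [m expR (M t)]. Parseval
    divides the sum of the two by [2 pi >= 4], so the envelope is halved, on all of [[0, T]] at
    once; iterating gives zero. *)
Lemma mild_solution_zero (T M : R) (phi : R -> R) (u : R -> R -> R) :
  0 < M -> bounded_data T M u -> mild_solution T phi u -> L1 phi ->
  (forall b xi, ft b phi xi = 0) ->
  forall t : R, t \in `[0, T] -> {ae mu, forall x, u t x = 0}.
Proof.
move=> M0 bu mild Lphi phi0.
pose P m := forall tau : R, tau \in `[0, T] ->
  \int[mu]_x u tau x ^+ 2 <= m * expR (M * tau).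
have step m : 0 <= m -> P m -> P (m / 2).
  move=> m0 Pm t tT.
  have fb := ft_u_bound bu mild Lphi phi0 M0 m0 Pm.
  have [mom Lft _ _ iM] := bu t tT; have [Lu _] := moment2_L1 mom.
  pose A := m * (expR (M * t) / M).
  have A0 : 0 <= A by rewrite mulr_ge0// divr_ge0 ?expR_ge0 ?ltW.
  have bI b : \int[mu]_xi ft b (u t) xi ^+ 2 <= A * M.
    apply: (@le_trans _ _ (\int[mu]_xi (A * `|ft b (u t) xi|))).
      apply: int_le; [exact: (sq_int_ft Lu (Lft b)).2|exact/L1Z/L1_norm|] => xi.
      by rewrite -real_normK ?num_real// expr2 ler_wpM2r// fb.
    by rewrite intZ ?ler_wpM2l//; exact: L1_norm.
  have AM : A * M = m * expR (M * t).
    by rewrite /A; field; rewrite gt_eqF.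
  have := parseval_le Lu Lft.
  rewrite intD; [|exact: (sq_int_ft Lu (Lft _)).2|exact: (sq_int_ft Lu (Lft _)).2].
  have := bI true; have := bI false; rewrite AM.
  set X := m * expR _; set N := \int[mu]_x (u t x ^+ 2).
  have N0 : 0 <= N by apply: int_ge0 => x; exact: sqr_ge0.
  have := @pi_ge2 R => pi2 i1 i2 i3.
  have : 2 * 2 * N <= 2 * pi * N by rewrite ler_wpM2r// ler_wpM2l.
  have -> : m / 2 * expR (M * t) = X / 2 by rewrite /X; field.
  by move: i1 i2 i3; lra.
have P0 j : P (M / 2 ^+ j).
  elim: j => [|j ih].
    move=> t tT; have [_ _ NM _ _] := bu t tT.
    rewrite expr0 divr1 (le_trans NM)// ler_peMr ?(ltW M0)//.
    rewrite -[leLHS]expR0 ler_expR mulr_ge0 ?(ltW M0)//.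
    by move: tT; rewrite in_itv/= => /andP[].
  rewrite exprSr invfM mulrA; apply: step => //.
  by rewrite divr_ge0 ?exprn_ge0 ?(ltW M0).
move=> t tT; have [[[mut Lut] _] _ _ _ _] := bu t tT.
set N := \int[mu]_x (u t x ^+ 2) in P0 *.
have N0 : N = 0.
  apply/eqP; rewrite eq_le int_ge0 ?andbT; last by move=> x; exact: sqr_ge0.
  apply/ler_addgt0Pl => e e0; rewrite addr0.
  pose A := M * expR (M * t).
  have A0 : 0 < A by rewrite mulr_gt0// expR_gt0.
  have [j hj] := filter_ex (near_infty_natSinv_expn_lt (PosNum (divr_gt0 e0 A0))).
  apply: (le_trans (P0 j t tT)).
  have -> : M / 2 ^+ j * expR (M * t) = (1 / 2 ^+ j) * A by rewrite /A mul1r; ring.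
  by rewrite -ler_pdivlMr// ltW.
by apply: ae_imp (int_eq0_ae Lut (fun x => sqr_ge0 _) N0) => x /= /eqP; rewrite sqrf_eq0 => /eqP.
Qed.

End uniqueness.

                                   

(** * A test function detecting a jump of the second derivative at 0 *)

Section jump.
Context {R : realType}.
Local Notation mu := (@lebesgue_measure R).
Implicit Types f g h : R -> R.

Lemma norm_sin_le (y : R) : `|sin y| <= `|y|.
Proof. by have := trig_lipschitz false y 0; rewrite /= sin0 !subr0. Qed.

Lemma one_sub_cos_ge0 (y : R) : 0 <= 1 - cos y.
Proof. by rewrite subr_ge0 cos_le1. Qed.

Lemma one_sub_cos_le (y : R) : 1 - cos y <= y ^+ 2 / 2.
Proof.
have -> : cos y = 1 - 2 * sin (y / 2) ^+ 2.
  have {1}-> : y = y / 2 + y / 2 by field.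
  by rewrite cosD; have := cos2Dsin2 (y / 2); rewrite !expr2; lra.
have : sin (y / 2) ^+ 2 <= (y / 2) ^+ 2.
  rewrite -real_normK ?num_real// -[leRHS]real_normK ?num_real//.
  by rewrite ler_sqr ?nnegrE// norm_sin_le.
have -> : (y / 2) ^+ 2 = y ^+ 2 / 4 by field.
lra.
Qed.

Lemma sin_sub_le (y : R) : 0 <= y -> `|sin y - y| <= y ^+ 3.
Proof.
rewrite le_eqVlt => /predU1P[<-|y0]; first by rewrite sin0 subrr normr0 expr0n.
have dF (x : R) : is_derive x 1 (fun x => sin x - x) (cos x - 1).
  have -> : (fun x => sin x - x) = sin - id :> (R -> R) by apply/funext.
  exact: is_deriveB.
have cF : {within `[0, y], continuous (fun x => sin x - x)}.
  apply: continuous_subspaceT; apply: continuous_derive => x.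
  by have [] := dF x.
have [c c0 E] := MVT y0 (fun x _ => dF x) cF.
move: E; rewrite sin0 !subr0 => ->.
move: c0; rewrite in_itv/= => /andP[c0 cy].
rewrite normrM (gtr0_norm y0) -normrN opprB ger0_norm ?one_sub_cos_ge0//.
rewrite exprSr ler_wpM2r ?(ltW y0)// (le_trans (one_sub_cos_le _))//.
have : c ^+ 2 <= y ^+ 2 by rewrite ler_sqr ?nnegrE ?ltW// (lt_trans c0).
by have := sqr_ge0 c; lra.
Qed.

(** The product is [(A a) (A^-1 b)], to which the arithmetic-geometric inequality applies. Used
    pointwise under the integral, with [A] adapted to the scale. *)
Lemma amgm_sqr (p a b A : R) : 0 < A -> 0 <= p -> 0 <= a -> 0 <= b ->
  p ^+ 2 <= a * b -> p <= 2^-1 * (A * a + A^-1 * b).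
Proof.
move=> A0 p0 a0 b0 pab.
have Ai : 0 < A^-1 by rewrite invr_gt0.
rewrite -(ler_sqr (x := p)) ?nnegrE//; last first.
  by apply: mulr_ge0 => //; apply: addr_ge0; apply: mulr_ge0 => //; exact: ltW.
apply: (le_trans pab).
have E : a * b = (A * a) * (A^-1 * b) by field; rewrite gt_eqF.
rewrite E; set x := A * a; set y := A^-1 * b.
by have := sqr_ge0 (x - y); rewrite !expr2; lra.
Qed.

(** Merges the regimes [1 - cos y <= y^2 / 2] and [1 - cos y <= 2] so that division by [1 + y^2]
    leaves the Cauchy weight. *)
Lemma one_sub_cos_pow2 (y : R) :
  (1 - cos y) ^+ 2 * (1 + y ^+ 2) <= 2 * y ^+ 4.
Proof.
have := one_sub_cos_ge0 y; have := one_sub_cos_le y; have := cos_geN1 y.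
set a := 1 - cos y; set z := y ^+ 2 => c1 h1 h0.
have h2 : a <= 2 by rewrite /a; lra.
have -> : y ^+ 4 = z ^+ 2 by rewrite -exprM.
have z0 : 0 <= z by exact: sqr_ge0.
have A : a ^+ 2 <= z ^+ 2 / 4.
  have -> : z ^+ 2 / 4 = (z / 2) ^+ 2 by field.
  by rewrite ler_sqr ?nnegrE ?divr_ge0.
have B : a ^+ 2 <= z.
  by rewrite expr2 (le_trans (ler_wpM2r h0 h2))//; lra.
have C : a ^+ 2 * z <= z ^+ 2 by rewrite [leRHS]expr2 ler_wpM2r.
rewrite mulrDr mulr1; have := sqr_ge0 z; lra.
Qed.

(** For [|y| <= 1] the quadratic bound gives the eighth power, for [|y| >= 1] the trivial bound
    gives the second. The exponent 7 will split as [5 + 2]: the weight [|x|^5] of the hypothesis,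
    and the [x^2] lost when the squared kernel is divided by [x^2]. *)
Lemma one_sub_cos_pow4 (y : R) :
  (1 - cos y) ^+ 4 * (1 + y ^+ 2) <= 32 * `|y| ^+ 7.
Proof.
have := one_sub_cos_ge0 y; have := one_sub_cos_le y; have := cos_geN1 y.
rewrite -(real_normK (num_real y)).
set a := 1 - cos y; set z := `|y| => c1 h1 h0.
have z0 : 0 <= z by exact: normr_ge0.
have h2 : a <= 2 by rewrite /a; lra.
have [z1|/ltW z1] := leP z 1.
  have A : a ^+ 4 <= (z ^+ 2 / 2) ^+ 4 by rewrite lerXn2r ?nnegrE ?divr_ge0 ?sqr_ge0.
  have zz : 1 + z ^+ 2 <= 2 by rewrite (_ : 2 = 1 + 1)// lerD2l exprn_ile1.
  apply: (@le_trans _ _ ((z ^+ 2 / 2) ^+ 4 * 2)).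
    by rewrite ler_pM ?exprn_ge0// addr_ge0 ?sqr_ge0.
  have -> : (z ^+ 2 / 2) ^+ 4 * 2 = z ^+ 7 * z / 8 by field.
  have : z ^+ 7 * z <= z ^+ 7 by rewrite ler_piMr ?exprn_ge0.
  by have := exprn_ge0 7 z0; lra.
have A : a ^+ 4 <= 2 ^+ 4 by rewrite lerXn2r ?nnegrE.
have zz : 1 + z ^+ 2 <= 2 * z ^+ 2.
  by rewrite mulr2n mulrDl mul1r lerD2r exprn_ege1.
apply: (@le_trans _ _ (2 ^+ 4 * (2 * z ^+ 2))).
  by rewrite ler_pM ?exprn_ge0// addr_ge0 ?sqr_ge0.
have -> : 2 ^+ 4 * (2 * z ^+ 2) = 32 * z ^+ 2 by ring.
by rewrite ler_wpM2l// ler_weXn2l.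
Qed.

                                                                                 
(** The coefficients cancel on [xi], since [4 r^2 / 2 = (2 r)^2 / 2], but not on [xi^2], whose
    integral is [- 4/3 r^3]. *)
Definition jump_test (r xi : R) : R := 4 * \1_(`[0, r]) xi - \1_(`[0, 2 * r]) xi.

Lemma L1_jump_test r : L1 (jump_test r).
Proof. by apply: L1B; [apply: L1Z|]; exact: L1_itv. Qed.

Lemma sq_int_jump_test r : sq_int (jump_test r).
Proof. by apply: sq_intB; [apply: sq_intZ|]; exact: sq_int_indic. Qed.

Lemma ft_jump_test b r : ft b (jump_test r) =
  (fun x => 4 * ft b (\1_(`[0, r])) x - ft b (\1_(`[0, 2 * r])) x).
Proof.
apply/funext => x; have L4 := L1Z 4 (L1_itv (0 : R) r).
rewrite /jump_test ftB//; last exact: L1_itv.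
congr (_ - _); rewrite /ft -intZ; last exact/L1_trig/L1_itv.
by apply: int_eq => y; rewrite mulrA.
Qed.

Lemma sq_int_ft_jump_test b r : 0 <= r -> sq_int (ft b (jump_test r)).
Proof.
move=> r0; rewrite ft_jump_test; apply: sq_intB; [apply: sq_intZ|];
by apply: sq_int_ft_itv; rewrite ?mulr_ge0.
Qed.

(** With [c = cos y], [4 (1 - c) - (1 - cos (2 y)) = 2 (1 - c)^2]: the cancellation on linear
    functions shows up as vanishing of order four at [x = 0]. *)
Lemma jump_test_kernel (r x : R) : 0 <= r ->
  x * ft false (jump_test r) x = 2 * (1 - cos (x * r)) ^+ 2.
Proof.
move=> r0; rewrite ft_jump_test mulrBr mulrCA !ft_itv_mul ?mulr_ge0// mulr0 cos0.
have -> : x * (2 * r) = x * r + x * r by ring.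
by rewrite cosD; have := cos2Dsin2 (x * r); rewrite !expr2; lra.
Qed.

(** The first bound serves for bounded [x], where it gains an extra power of [r]. The second serves
    for large [x]: [|x|^5] is absorbed by the decay of the paired function and the remaining factor
    has integral [128 pi r^6]. *)
Lemma jump_test_kernel_bound (r x : R) : 0 <= r ->
  `|ft false (jump_test r) x| <= r ^+ 4 * `|x| ^+ 3 /\
  ft false (jump_test r) x ^+ 2 <=
    `|x| ^+ 5 * (128 * r ^+ 6 * (r * (1 + (r * x) ^+ 2)^-1)).
Proof.
move=> r0; have K := jump_test_kernel x r0.
have [x0|xN0] := eqVneq x 0.
  rewrite x0 /ft; under int_eq do rewrite mulr0 /= sin0 mulr0.
  have -> : \int[mu]_x (0 : R) = 0 by rewrite /Rintegral integral0.
  by rewrite !normr0 !expr0n /= !mulr0 mul0r.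
have xp : 0 < `|x| by rewrite normr_gt0.
set k := ft false _ x in K *; set a := 1 - cos (x * r) in K.
have a0 : 0 <= a by exact: one_sub_cos_ge0.
have ax : a <= (x * r) ^+ 2 / 2 by exact: one_sub_cos_le.
have k1 : `|x| * `|k| = 2 * a ^+ 2.
  by rewrite -normrM K ger0_norm// mulr_ge0 ?sqr_ge0.
split.
  rewrite -(ler_pM2l xp) k1.
  have -> : `|x| * (r ^+ 4 * `|x| ^+ 3) = ((x * r) ^+ 2) ^+ 2.
    have -> : `|x| * (r ^+ 4 * `|x| ^+ 3) = r ^+ 4 * (`|x| ^+ 2) ^+ 2 by ring.
    by rewrite real_normK ?num_real//; ring.
  have : a ^+ 2 <= ((x * r) ^+ 2 / 2) ^+ 2.
    by rewrite ler_sqr ?nnegrE ?divr_ge0 ?sqr_ge0.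
  have := sqr_ge0 ((x * r) ^+ 2); set z := (x * r) ^+ 2.
  have -> : (z / 2) ^+ 2 = z ^+ 2 / 4 by field.
  lra.
have d0 : 0 < 1 + (r * x) ^+ 2 by rewrite ltr_pwDl// sqr_ge0.
have x2 : 0 < `|x| ^+ 2 by rewrite exprn_gt0.
rewrite -(ler_pM2l x2) -(real_normK (num_real k)) -exprMn k1.
rewrite [leRHS](_ : _ = 128 * (`|x| * r) ^+ 7 * (1 + (r * x) ^+ 2)^-1); last by ring.
rewrite ler_pdivlMr//.
have := one_sub_cos_pow4 (x * r); rewrite -/a normrM (ger0_norm r0) (mulrC r x).
have -> : (2 * a ^+ 2) ^+ 2 * (1 + (x * r) ^+ 2) = 4 * (a ^+ 4 * (1 + (x * r) ^+ 2)) by ring.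
lra.
Qed.

(** The pairing is [o(r^3)]. Inside [[-n, n]] it is [O(r^4)]; outside, Cauchy-Schwarz in the form of
    [amgm_sqr] bounds it by [r^3] times a quantity small with the tail of the integral of [V]. *)
Lemma jump_test_pairing g : L1 g -> L1 (fun x => `|x| ^+ 5 * g x ^+ 2) ->
  forall e : R, 0 < e -> exists2 r0, 0 < r0 & forall r, 0 < r -> r < r0 ->
  `|\int[mu]_x (g x * ft false (jump_test r) x)| <= e * r ^+ 3.
Proof.
move=> Lg LV e e0.
pose V x := `|x| ^+ 5 * g x ^+ 2.
have V0 x : 0 <= V x by exact: mulr_ge0 (exprn_ge0 _ (normr_ge0 _)) (sqr_ge0 _).
have mV : msr V by exact: msr_L1.
(* With [A = r^3 G] the kernel term [A^-1 128 r^6 pi] is exactly [e / 2 r^3], and a tail of [V]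
   below [e / G] makes the other term at most [e r^3]. Half of their sum is [3 e / 4 r^3]. *)
pose G := 128 * pi * 2 / e.
have pi0 := @pi_gt0 R.
have G0 : 0 < G by rewrite divr_gt0// !mulr_gt0.
have eG : 0 < e / G by rewrite divr_gt0.
have LtV n : L1 (trunc V n) by apply: L1_indic => //; exact: measurable_itv.
have c1 : \int[mu]_x trunc V n x @[n --> \oo] --> \int[mu]_x V x.
  apply: (@dominated_cvg_int R _ _ V _ _ _ _ _).2 => //.
  - by move=> n; exact: msr_L1.
  - by apply: ae_all => x; exact: cvg_trunc.
  - by move=> n x; rewrite (le_trans (trunc_le _ _ _))// ger0_norm.
have [n hn] : exists n : nat, \int[mu]_x (V x - trunc V n x) < e / G.
  move/cvgrPdist_lt : c1 => /(_ _ eG) c1; have [n] := filter_ex c1.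
  by rewrite -intB// => /(le_lt_trans (ler_norm _)) h; exists n.
pose g1 := \int[mu]_x `|g x|.
have g10 : 0 <= g1 by exact: int_ge0.
(* For [r < e / D] the part inside [[-n, n]] is at most the missing [e / 4 r^3]. *)
pose D := 4 * (n%:R ^+ 3 * g1) + 1.
have D0 : 0 < D by rewrite ltr_wpDl// mulr_ge0// mulr_ge0// exprn_ge0.
exists (e / D); first by rewrite divr_gt0.
move=> r r0 rD.
have [Lw Iw] := cauchy_weight r0.
have mk := msr_ft false (L1_jump_test r).
have r3 : 0 < r ^+ 3 by rewrite exprn_gt0.
pose A := r ^+ 3 * G.
have A0 : 0 < A by rewrite mulr_gt0.
pose B x := r ^+ 4 * n%:R ^+ 3 * `|g x| +
  2^-1 * (A * (V x - trunc V n x) + A^-1 * (128 * r ^+ 6 * (r * (1 + (r * x) ^+ 2)^-1))).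
have LB : L1 B.
  apply: L1D; first by apply: L1Z; exact: L1_norm.
  by apply: L1Z; apply: L1D; apply: L1Z; [exact: L1B|exact: L1Z].
have IB : \int[mu]_x B x = r ^+ 4 * n%:R ^+ 3 * g1 +
   2^-1 * (A * \int[mu]_x (V x - trunc V n x) + A^-1 * (128 * r ^+ 6 * pi)).
  have L1' : L1 (fun x => A * (V x - trunc V n x)) by apply: L1Z; exact: L1B.
  have L2' : L1 (fun x => 128 * r ^+ 6 * (r * (1 + (r * x) ^+ 2)^-1)) by exact: L1Z.
  rewrite intD; [|exact/L1Z/L1_norm|by apply: L1Z; apply: L1D => //; exact: L1Z].
  rewrite intZ; last exact: L1_norm.
  rewrite intZ; last by apply: L1D => //; exact: L1Z.
  rewrite intD//; last exact: L1Z.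
  by rewrite intZ; [rewrite intZ// intZ// Iw|exact: L1B].
have w0 x : 0 <= r * (1 + (r * x) ^+ 2)^-1.
  by rewrite mulr_ge0 ?invr_ge0 ?addr_ge0 ?sqr_ge0 ?(ltW r0).
apply: (@le_trans _ _ (\int[mu]_x B x)).
  apply: int_norm_le => //.
    by apply: (L1_mul_bounded Lg mk) => x; apply: ft_bound; exact: L1_jump_test.
  move=> x; rewrite normrM /B.
  have [k1 k2] := jump_test_kernel_bound x (ltW r0).
  set k := ft false _ x in k1 k2 *; set w := r * _ in k2 *.
  have ww : 0 <= w by exact: w0.
  have r6 : 0 <= r ^+ 6 by rewrite exprn_ge0 ?ltW.
  have E0 : 0 <= 128 * r ^+ 6 * w by rewrite mulr_ge0// mulr_ge0.
  rewrite /trunc indicE; have [xn|xn] := boolP (x \in _).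
    rewrite mul1r subrr mulr0 add0r.
    apply: (@le_trans _ _ (r ^+ 4 * n%:R ^+ 3 * `|g x|)); last first.
      by rewrite lerDl; apply: mulr_ge0 => //; apply: mulr_ge0 => //; rewrite invr_ge0 ltW.
    rewrite mulrC ler_wpM2r// (le_trans k1)// ler_wpM2l ?exprn_ge0 ?(ltW r0)//.
    rewrite lerXn2r ?nnegrE//.
    by move: xn; rewrite inE/= in_itv/= -ler_norml.
  rewrite mul0r subr0; apply: ler_wpDl.
    by rewrite mulr_ge0// mulr_ge0// exprn_ge0// ltW.
  apply: amgm_sqr => //.
  rewrite exprMn !real_normK ?num_real// /V.
  rewrite [leRHS](_ : _ = g x ^+ 2 * (`|x| ^+ 5 * (128 * r ^+ 6 * w))); last by ring.
  by rewrite ler_wpM2l ?sqr_ge0.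
rewrite IB.
have h1 : r ^+ 4 * n%:R ^+ 3 * g1 <= e / 4 * r ^+ 3.
  have -> : r ^+ 4 * n%:R ^+ 3 * g1 = r * (n%:R ^+ 3 * g1) * r ^+ 3 by ring.
  rewrite ler_wpM2r ?(ltW r3)//.
  have : r * D <= e by rewrite -ler_pdivlMr// ltW.
  by rewrite /D; lra.
have h2 : A * \int[mu]_x (V x - trunc V n x) <= e * r ^+ 3.
  apply: (@le_trans _ _ (A * (e / G))); first by rewrite ler_wpM2l ?ltW.
  by rewrite le_eqVlt; apply/orP; left; apply/eqP; rewrite /A; field; rewrite gt_eqF.
have h3 : A^-1 * (128 * r ^+ 6 * pi) = e / 2 * r ^+ 3.
  apply: (mulfI (lt0r_neq0 A0)); rewrite mulVKf ?lt0r_neq0// /A /G.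
  by field; rewrite gt_eqF.
rewrite h3; lra.
Qed.

End jump.

(** * Low-frequency expansion of the free evolution and of the Duhamel term *)

Section expansions.
Context {R : realType}.
Local Notation mu := (@lebesgue_measure R).
Implicit Types f g h : R -> R.

(** The increment at 0 is [o(xi)]: [d] is taken small first, then [xi]. [amgm_sqr] with parameter
    [d xi] splits the integrand between the second moment and the Cauchy weight at scale [xi]. *)
Lemma ft_cos_modulus f (xi d : R) : moment2 f -> 0 < xi -> 0 < d ->
  `|ft true f xi - ft true f 0| <=
  xi * (d * \int[mu]_x (x ^+ 2 * f x) ^+ 2 / 2 + pi * xi / d).
Proof.
move=> mf xi0 d0; have [Lf _] := moment2_L1 mf.
have [[msf _] [_ LW]] := mf.
have [Lw Iw] := cauchy_weight xi0.
have A0 : 0 < d * xi by rewrite mulr_gt0.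
pose B x := 2^-1 * (d * xi * (x ^+ 2 * f x) ^+ 2 +
  (d * xi)^-1 * (2 * xi ^+ 3 * (xi * (1 + (xi * x) ^+ 2)^-1))).
have L1' : L1 (fun x => d * xi * (x ^+ 2 * f x) ^+ 2) by exact: L1Z.
have L2' : L1 (fun x => 2 * xi ^+ 3 * (xi * (1 + (xi * x) ^+ 2)^-1)) by exact: L1Z.
have LB : L1 B by apply: L1Z; apply: L1D => //; exact: L1Z.
have IB : \int[mu]_x B x = 2^-1 * (d * xi * \int[mu]_x (x ^+ 2 * f x) ^+ 2 +
    (d * xi)^-1 * (2 * xi ^+ 3 * pi)).
  rewrite intZ; last by apply: L1D => //; exact: L1Z.
  rewrite intD//; last exact: L1Z.
  by rewrite intZ// intZ// intZ// Iw.
apply: (@le_trans _ _ (\int[mu]_x B x)); last first.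
  by rewrite IB le_eqVlt; apply/orP; left; apply/eqP; field; rewrite !gt_eqF.
rewrite /ft -intB; [|exact: L1_trig|exact: L1_trig].
apply: int_norm_le => //; first by apply: L1B; exact: L1_trig.
move=> x; rewrite /= mulr0 cos0 -mulrBr normrM (distrC (cos _) 1).
rewrite (ger0_norm (one_sub_cos_ge0 _)).
apply: amgm_sqr => //.
- exact: sqr_ge0.
- rewrite mulr_ge0 ?mulr_ge0 ?exprn_ge0 ?invr_ge0 ?addr_ge0 ?(ltW xi0)//.
  exact: sqr_ge0.
- have p0 : 0 < 1 + (xi * x) ^+ 2 by rewrite ltr_pwDl// sqr_ge0.
  rewrite exprMn real_normK ?num_real//.
  rewrite [leRHS](_ : _ = f x ^+ 2 * (2 * (x * xi) ^+ 4 * (1 + (xi * x) ^+ 2)^-1)); last by ring.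
  rewrite ler_wpM2l ?sqr_ge0//.
  by rewrite ler_pdivlMr// (mulrC xi) one_sub_cos_pow2.
Qed.

Lemma ft_sin_le f xi : L1 f -> L1 (fun x => x * f x) ->
  `|ft false f xi| <= `|xi| * \int[mu]_x `|x * f x|.
Proof.
move=> Lf Lxf; have := ft_lipschitz false xi 0 Lf Lxf.
suff -> : ft false f 0 = 0 by rewrite !subr0.
rewrite /ft; under int_eq do rewrite mulr0 /= sin0 mulr0.
by rewrite /Rintegral integral0.
Qed.

Lemma theta_ge0 (xi : R) : 0 <= xi -> 0 <= theta xi.
Proof. by move=> xi0; rewrite /theta divr_ge0 ?addr_ge0. Qed.

Lemma theta_le (xi : R) : 0 <= xi -> theta xi <= xi.
Proof.
by move=> xi0; have := norm_theta_le xi; rewrite !ger0_norm ?theta_ge0.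
Qed.

Lemma theta_expand (xi : R) : 0 <= xi ->
  xi - xi ^+ 2 <= theta xi <= xi - xi ^+ 2 + xi ^+ 3.
Proof.
move=> xi0; rewrite /theta (ger0_norm xi0).
have p : 0 < 1 + xi by rewrite ltr_pwDl.
rewrite ler_pdivlMr// ler_pdivrMr//.
have -> : (xi - xi ^+ 2) * (1 + xi) = xi - xi ^+ 3 by ring.
have -> : (xi - xi ^+ 2 + xi ^+ 3) * (1 + xi) = xi + xi ^+ 4 by ring.
by rewrite gerBl lerDl !exprn_ge0.
Qed.

(** The test function is at most 4 in absolute value and lives on an interval of length [2 r]. *)
Lemma jump_test_bound g (r C : R) : 0 <= r -> 0 <= C ->
  L1 (fun xi => g xi * jump_test r xi) ->
  (forall xi, 0 <= xi -> xi <= 2 * r -> `|g xi| <= C) ->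
  `|\int[mu]_xi (g xi * jump_test r xi)| <= 8 * r * C.
Proof.
move=> r0 C0 Lg gC.
have r2 : 0 <= 2 * r by rewrite mulr_ge0.
apply: (@le_trans _ _ (\int[mu]_x (4 * C * \1_(`[0, 2 * r]) x))).
  apply: int_norm_le => //; first exact/L1Z/L1_itv.
  move=> x; rewrite normrM /jump_test !indicE.
  have [xr|xr] := boolP (x \in `[0, 2 * r]%classic).
    have {}xr : `|g x| <= C by move: xr; rewrite inE/= in_itv/= => /andP[]; exact: gC.
    rewrite mulr1 mulrC ler_pM//.
    case: (_ \in _) => /=; rewrite ?mulr1 ?mulr0 ?sub0r ?normrN ?normr1.
      by rewrite ger0_norm; lra.
    lra.
  rewrite (_ : (x \in `[0, r]%classic) = false).
    by rewrite !mulr0 subrr normr0 mulr0.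
  apply/negbTE; apply: contra xr; rewrite !inE /= !in_itv/= => /andP[-> h] /=.
  lra.
have -> : \int[mu]_x (4 * C * \1_(`[0, 2 * r]) x) =
   4 * C * \int[mu]_x (\1_(`[0, 2 * r]) x : R) by exact: intZ (L1_itv _ _).
rewrite (int_itv1 r2) subr0; lra.
Qed.

Lemma L1_itv_pow (c : R) n : 0 <= c -> L1 (fun x => \1_(`[0, c]) x * x ^+ n).
Proof.
move=> c0; apply: (L1_dom _ (L1Z (c ^+ n) (L1_itv 0 c))).
  by apply: msrM; [apply: msr_indic; exact: measurable_itv|solve_msr].
move=> x; rewrite normrM mulrC indicE.
have [xc|_] := boolP (x \in _); last by rewrite normr0 !mulr0.
rewrite normr1 !mulr1 normrX lerXn2r ?nnegrE//.
by move: xc; rewrite inE/= in_itv/= => /andP[x0 xc]; rewrite ger0_norm.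
Qed.

Lemma int_itv_pow (c : R) n : 0 <= c ->
  \int[mu]_x (\1_(`[0, c]) x * x ^+ n) = c ^+ n.+1 / n.+1%:R.
Proof.
move=> c0; rewrite (_ : c ^+ n.+1 / n.+1%:R = c ^+ n.+1 / n.+1%:R - 0 ^+ n.+1 / n.+1%:R); last first.
  by rewrite expr0n /= mul0r subr0.
apply: (@ftc_itv _ 0 c _ (fun x => x ^+ n.+1 / n.+1%:R)) => //.
  exact: exprn_continuous.
move=> x.
have -> : (fun x : R => x ^+ n.+1 / n.+1%:R) = n.+1%:R^-1 \*: (id ^+ n.+1) :> (R -> R).
  by apply/funext => y; rewrite /= fctE mulrC.
apply: is_derive_eq; rewrite /GRing.scale /= mulr1.
by rewrite mulKf// pnatr_eq0.
Qed.

Lemma L1_mul_jump_test g (r M : R) : msr g -> (forall x, `|g x| <= M) ->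
  L1 (fun xi => g xi * jump_test r xi).
Proof.
move=> mg gM; have := L1_mul_bounded (L1_jump_test r) mg gM.
by congr L1; apply/funext => x; rewrite mulrC.
Qed.

                                                                                 
(** Insert [theta >= xi - xi^2] in the part with coefficient 4 and [theta <= xi - xi^2 + xi^3] in
    the part with coefficient -1. The linear terms cancel and [4/3 r^3 - 4 r^4] remains, at least
    [r^3] when [r <= 1/12]. *)
Lemma jump_test_theta (r : R) : 0 < r -> r <= 1 / 12 ->
  r ^+ 3 <= \int[mu]_xi (theta xi * jump_test r xi).
Proof.
move=> r0 r12; have r2 : 0 <= 2 * r by rewrite mulr_ge0// ltW.
pose p (c : R) n x := \1_(`[0, c]) x * x ^+ n.
have Lp (c : R) n : 0 <= c -> L1 (p c n) by exact: L1_itv_pow.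
have Lr := Lp r _ (ltW r0); have L2r := Lp (2 * r) _ r2.
pose B x := (4 * p r 1%N x - 4 * p r 2%N x) - (p (2 * r) 1%N x - p (2 * r) 2%N x)
  - p (2 * r) 3%N x.
have LB : L1 B.
  by apply: L1B => //; apply: L1B; apply: L1B => //; exact: L1Z.
have Er n : \int[mu]_x p r n x = r ^+ n.+1 / n.+1%:R by exact: int_itv_pow (ltW r0).
have E2r n : \int[mu]_x p (2 * r) n x = (2 * r) ^+ n.+1 / n.+1%:R by exact: int_itv_pow r2.
have IB : \int[mu]_x B x = 4 / 3 * r ^+ 3 - 4 * r ^+ 4.
  rewrite intB//; last by apply: L1B; apply: L1B => //; exact: L1Z.
  rewrite intB//; [|by apply: L1B; exact: L1Z|exact: L1B].
  rewrite intB//; [|exact: L1Z|exact: L1Z].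
  by rewrite intB// !intZ// !Er !E2r; field.
apply: (@le_trans _ _ (\int[mu]_x B x)).
  rewrite IB; have : r ^+ 4 <= r ^+ 3 * (1 / 12).
    by rewrite [r ^+ 4]exprSr ler_wpM2l// exprn_ge0// ltW.
  have : 0 < r ^+ 3 by rewrite exprn_gt0.
  lra.
apply: int_le => //.
  by apply: (L1_mul_jump_test _ msr_theta) => x; exact: norm_theta.
move=> x; rewrite /B /p /jump_test !indicE.
have [xr|xr] := boolP (x \in `[0, 2 * r]%classic).
  have x0 : 0 <= x by move: xr; rewrite inE/= in_itv/= => /andP[].
  have /andP[h1 h2] := theta_expand x0.
  have x3 : 0 <= x ^+ 3 by rewrite exprn_ge0.
  by case: (_ \in _) => /=; rewrite ?mul1r ?mul0r ?mulr1 ?mulr0 !expr1; lra.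
rewrite (_ : (x \in `[0, r]%classic) = false); first by rewrite !mul0r !mulr0 !subrr mulr0.
apply/negbTE; apply: contra xr; rewrite !inE /= !in_itv/= => /andP[-> h] /=.
lra.
Qed.

(** Three remainders: [1 - cos] is quadratic and multiplies the sine transform, which is [O(xi)];
    [sin] minus its argument is cubic; and [t theta] multiplies the increment of the cosine
    transform. Only the last leaves a term in [xi^2], with the adjustable factor [d]. *)
Lemma phase_expand f (t xi d : R) : moment2 f -> 0 <= t -> 0 <= xi -> 0 < d ->
  `|phase_mul false (cos (t * theta xi)) (sin (t * theta xi))
      (ft true f xi) (ft false f xi)
    - (ft false f xi + t * theta xi * ft true f 0)| <=
  xi ^+ 2 * (t * (d * \int[mu]_x (x ^+ 2 * f x) ^+ 2 / 2)
    + xi * (t ^+ 2 * \int[mu]_x `|x * f x| + t ^+ 3 * \int[mu]_x `|f x| + t * pi / d)).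
Proof.
move=> mf t0 xi0 d0; have [Lf Lxf] := moment2_L1 mf.
have Sb := ft_sin_le xi Lf Lxf.
have Cb := ft_bound true xi Lf.
have th0 := theta_ge0 xi0; have th1 := theta_le xi0.
have mod : `|ft true f xi - ft true f 0| <=
    xi * (d * \int[mu]_x (x ^+ 2 * f x) ^+ 2 / 2 + pi * xi / d).
  move: xi0; rewrite le_eqVlt => /predU1P[<-|xp].
    by rewrite subrr normr0 mul0r.
  exact: ft_cos_modulus.
set W := \int[mu]_x (_ ^+ 2) in mod *.
set A1 := \int[mu]_x `|x * f x| in Sb *.
set A0 := \int[mu]_x `|f x| in Cb *.
set C := ft true f xi in Cb mod *; set S := ft false f xi in Sb *.
set p0 := ft true f 0 in mod *; set th := theta xi in th0 th1 *.
have A10 : 0 <= A1 by exact: int_ge0.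
have A00 : 0 <= A0 by exact: int_ge0.
have tth : 0 <= t * th by exact: mulr_ge0.
have ttx : t * th <= t * xi by rewrite ler_wpM2l.
rewrite (ger0_norm xi0) in Sb.
have -> : phase_mul false (cos (t * th)) (sin (t * th)) C S - (S + t * th * p0) =
  - ((1 - cos (t * th)) * S) + (sin (t * th) - t * th) * C + t * th * (C - p0).
  by rewrite /phase_mul; ring.
have h1 : `|(1 - cos (t * th)) * S| <= (t * xi) ^+ 2 * (xi * A1).
  rewrite normrM (ger0_norm (one_sub_cos_ge0 _)) ler_pM ?one_sub_cos_ge0//.
  rewrite (le_trans (one_sub_cos_le _))//.
  have : (t * th) ^+ 2 <= (t * xi) ^+ 2 by rewrite ler_sqr ?nnegrE// mulr_ge0.
  by have := sqr_ge0 (t * th); lra.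
have h2 : `|(sin (t * th) - t * th) * C| <= (t * xi) ^+ 3 * A0.
  rewrite normrM ler_pM// (le_trans (sin_sub_le tth))//.
  by rewrite lerXn2r ?nnegrE// mulr_ge0.
have h3 : `|t * th * (C - p0)| <= t * xi * (xi * (d * W / 2 + pi * xi / d)).
  by rewrite normrM (ger0_norm tth) ler_pM.
apply: (le_trans (ler_normD _ _)).
apply: (le_trans (lerD (ler_normD _ _) (lexx _))).
rewrite normrN; apply: (le_trans (lerD (lerD h1 h2) h3)).
by rewrite le_eqVlt; apply/orP; left; apply/eqP; field; rewrite gt_eqF.
Qed.

(** The square of [f] has two moments, so its cosine transform is its integral up to [O(xi^2)] and
    its sine transform is [O(xi)]. The latter meets [sin a = O(xi)], and the common factor [theta]
    makes every remainder cubic. *)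
Lemma duhamel_term_expand f (t c M xi : R) : moment2 f ->
  \int[mu]_x f x ^+ 2 <= M -> \int[mu]_x (x ^+ 2 * f x) ^+ 2 <= M ->
  0 <= c -> c <= t -> 0 <= xi ->
  `|duhamel_term false t c (fun x => f x ^+ 2) xi + \int[mu]_x f x ^+ 2 * theta xi| <=
  M * (1 + 3 * t + t ^+ 2) * xi ^+ 3.
Proof.
move=> mf fM xfM c0 ct xi0; have [L2 Lx L4] := moment2_sqr mf.
have [[msf Lf] [_ Lxf]] := mf.
have th0 := theta_ge0 xi0; have th1 := theta_le xi0.
have I2 : \int[mu]_x (x ^+ 2 * f x ^+ 2) <= 2 * M.
  apply: (@le_trans _ _ (\int[mu]_x (f x ^+ 2 + (x ^+ 2 * f x) ^+ 2))).
    apply: int_le => //; first exact: L1D.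
    by move=> x; rewrite exprMn -[X in X + _]mul1r -mulrDl ler_wpM2r ?sqr_ge0 ?sqr_le_1Dpow4 ?norm_le_1Dsqr.
  by rewrite intD//; lra.
have I1 : \int[mu]_x `|x * f x ^+ 2| <= 3 * M.
  apply: (@le_trans _ _ (\int[mu]_x (f x ^+ 2 + x ^+ 2 * f x ^+ 2))).
    apply: int_le; [exact: L1_norm|exact: L1D|] => x.
    rewrite normrM (ger0_norm (sqr_ge0 (f x))).
    by rewrite -[X in X + _]mul1r -mulrDl ler_wpM2r ?sqr_ge0 ?sqr_le_1Dpow4 ?norm_le_1Dsqr.
  by rewrite intD//; lra.
set N := \int[mu]_x (f x ^+ 2) in fM *.
have N0 : 0 <= N by apply: int_ge0 => x; exact: sqr_ge0.
have M0 : 0 <= M by exact: le_trans fM.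
set P := ft true (fun x => f x ^+ 2) xi; set Q := ft false (fun x => f x ^+ 2) xi.
have Qb : `|Q| <= xi * (3 * M).
  rewrite (le_trans (ft_sin_le xi L2 Lx))// (ger0_norm xi0).
  by rewrite ler_wpM2l.
have Pb : `|P| <= M.
  rewrite (le_trans (ft_bound true xi L2))//; apply: le_trans fM.
  rewrite le_eqVlt; apply/orP; left; apply/eqP/int_eq => x.
  by rewrite ger0_norm ?sqr_ge0.
have NP : `|N - P| <= xi ^+ 2 * M.
  rewrite /N /P /ft -intB//; last exact: L1_trig.
  apply: (@le_trans _ _ (\int[mu]_x (xi ^+ 2 / 2 * (x ^+ 2 * f x ^+ 2)))).
    apply: int_norm_le; [by apply: L1B => //; exact: L1_trig|exact: L1Z|] => x /=.
    rewrite -{1}[f x ^+ 2]mulr1 -mulrBr normrM (ger0_norm (sqr_ge0 _)).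
    rewrite (ger0_norm (one_sub_cos_ge0 _)) mulrC mulrA ler_wpM2r ?sqr_ge0//.
    by rewrite (le_trans (one_sub_cos_le _))// exprMn; lra.
  rewrite intZ//; have := sqr_ge0 xi; have := I2; set X := \int[mu]_x _; nra.
rewrite /duhamel_term -/P -/Q; set a := (t - c) * theta xi.
have a0 : 0 <= a by rewrite mulr_ge0// subr_ge0.
have at_ : a <= t * xi by rewrite ler_pM ?subr_ge0// gerBl.
have -> : phase_mul false (theta xi * sin a) (- (theta xi * cos a)) P Q + N * theta xi =
   theta xi * (sin a * Q + (1 - cos a) * P + (N - P)) by rewrite /phase_mul; ring.
have t0 : 0 <= t by exact: le_trans ct.
have h1 : `|sin a * Q| <= t * xi * (xi * (3 * M)).
  by rewrite normrM ler_pM// (le_trans (norm_sin_le a))// ger0_norm.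
have h2 : `|(1 - cos a) * P| <= (t * xi) ^+ 2 * M.
  rewrite normrM (ger0_norm (one_sub_cos_ge0 _)) ler_pM ?one_sub_cos_ge0//.
  rewrite (le_trans (one_sub_cos_le _))//.
  have : a ^+ 2 <= (t * xi) ^+ 2 by rewrite ler_sqr ?nnegrE// mulr_ge0.
  by have := sqr_ge0 a; lra.
rewrite normrM (ger0_norm th0).
apply: (@le_trans _ _ (xi * (t * xi * (xi * (3 * M)) + (t * xi) ^+ 2 * M + xi ^+ 2 * M))).
  rewrite ler_pM// (le_trans (ler_normD _ _))// lerD// (le_trans (ler_normD _ _))//.
  exact: lerD.
by rewrite le_eqVlt; apply/orP; left; apply/eqP; ring.
Qed.

(** Each term dominates [eta] times the increment of the function [min(x, d)] over its cell: for a
    cell starting before [d] the increment is at most the mesh, from [d] on it is 0. The increments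
    telescope. *)
Lemma left_sum_lower (N : R -> R) (t d eta : R) (n : nat) :
  0 < t -> 0 <= eta -> (0 < n)%N -> (forall c, 0 <= c -> c <= t -> 0 <= N c) ->
  (forall c, 0 <= c -> c <= t -> c < d -> eta <= N c) ->
  eta * Num.min t d <= \sum_(k < n) t / n%:R * N (t * k%:R / n%:R) + eta * Num.min 0 d.
Proof.
move=> t0 eta0 n0 N0 Ne.
have np : 0 < n%:R :> R by rewrite ltr0n.
have nn0 : n%:R != 0 :> R by rewrite gt_eqF.
pose p (k : nat) : R := t * k%:R / n%:R.
pose g x := Num.min x d.
have dp k : p k.+1 = p k + t / n%:R by rewrite /p -natr1; field.
have tn0 : 0 < t / n%:R by rewrite divr_gt0.
rewrite -lerBlDr -mulrBr.
have -> : Num.min t d - Num.min 0 d = \sum_(k < n) (g (p k.+1) - g (p k)).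
  have -> : \sum_(k < n) (g (p k.+1) - g (p k)) = g (p n) - g (p 0%N).
    by rewrite -(telescope_sumr (g \o p) (leq0n n)) big_mkord.
  by rewrite /g /p mulr0 mul0r mulfK.
rewrite mulr_sumr; apply: ler_sum => k _; rewrite -/(p k).
have pk0 : 0 <= p k by rewrite /p divr_ge0// mulr_ge0// ltW.
have pkt : p k <= t.
  by rewrite /p ler_pdivrMr// ler_wpM2l ?(ltW t0)// ler_nat ltnW.
rewrite /g dp; have [pd|dpk] := ltP (p k) d.
  apply: (@le_trans _ _ (eta * (t / n%:R))).
    rewrite ler_wpM2l// lerBlDl ge_min lexx//.
  by rewrite mulrC ler_wpM2l ?(ltW tn0)// Ne.
rewrite (min_idPr _) ?subrr ?mulr0; last by rewrite (le_trans dpk)// lerDl ltW.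
by rewrite mulr_ge0 ?(ltW tn0)// N0.
Qed.

End expansions.

(** * The contradiction at scale [r^3] and the conclusion *)

Section vanishing.
Context {R : realType}.
Local Notation mu := (@lebesgue_measure R).
Implicit Types f g h : R -> R.

(** The equation is paired with [jump_test r]. The Duhamel sum contributes at least [sg r^3 / 2],
    and the term [t p0 L] coming from the mean of the data has the same sign. The pairings of [u t]
    and [u 0] are [o(r^3)] by their decay, and all other errors are small multiples of [r^3], so the
    identity cannot hold. *)
Lemma jump_absurd (T M : R) (phi : R -> R) (u : R -> R -> R) (t eta d : R) :
  bounded_data T M u -> mild_solution T phi u -> t \in `[0, T] -> 0 < t ->
  L1 phi -> (forall b xi, ft b phi xi = ft b (u 0) xi) ->
  0 <= ft true (u 0) 0 ->
  L1 (fun x => `|x| ^+ 5 * u 0 x ^+ 2) -> L1 (fun x => `|x| ^+ 5 * u t x ^+ 2) ->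
  0 < eta -> 0 < d ->
  (forall c : R, c \in `[0, T] -> c < d -> eta <= \int[mu]_x u c x ^+ 2) -> False.
Proof.
move=> bu mild tT t0 Lphi phiE p00 V0 Vt eta0 d0 Nlow.
have tleT : t <= T by move: tT; rewrite in_itv/= => /andP[].
have subT c : 0 <= c -> c <= t -> c \in `[0, T].
  by move=> c0 ct; rewrite in_itv/= c0 (le_trans ct).
have [m0 _ uM _ _] := bu 0 (subT 0 (lexx _) (ltW t0)).
have [mt _ _ _ _] := bu t tT.
have [L0 Lx0] := moment2_L1 m0; have [Lt _] := moment2_L1 mt.
have M0 : 0 <= M by apply: le_trans uM; apply: int_ge0 => x; exact: sqr_ge0.
(* A lower bound for the Riemann sums of the squared L^2 norm; all errors are measured in units of
   [sg r^3]. *)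
pose sg := eta * Num.min t d.
have sg0 : 0 < sg by rewrite mulr_gt0// lt_min t0.
have e1 : 0 < sg / 16 by rewrite divr_gt0.
have [ra ra0 hra] := jump_test_pairing Lt Vt e1.
have [rb rb0 hrb] := jump_test_pairing L0 V0 e1.
pose W := \int[mu]_x (x ^+ 2 * u 0 x) ^+ 2.
have W0 : 0 <= W by apply: int_ge0 => x; exact: sqr_ge0.
pose A1 := \int[mu]_x `|x * u 0 x|.
pose A0 := \int[mu]_x `|u 0 x|.
have A10 : 0 <= A1 by exact: int_ge0.
have A00 : 0 <= A0 by exact: int_ge0.
have tW : 0 <= t * W by rewrite mulr_ge0// ltW.
(* The parameter [d] of [phase_expand], chosen so that its [xi^2] remainder costs at most
   [sg / 8 r^3]; the [+ 1] keeps the denominator positive. *)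
pose del := sg / (128 * (t * W) + 1).
have del0 : 0 < del by rewrite divr_gt0// ltr_wpDl// mulr_ge0.
have delW : 16 * (t * (del * W)) <= sg / 8.
  have : del * (128 * (t * W) + 1) = sg.
    by rewrite /del mulfVK// gt_eqF// ltr_wpDl// mulr_ge0.
  rewrite mulrDr mulr1; lra.
pose c1 := t ^+ 2 * A1 + t ^+ 3 * A0 + t * pi / del.
have c10 : 0 <= c1.
  rewrite /c1 !addr_ge0 ?mulr_ge0 ?exprn_ge0 ?invr_ge0 ?pi_ge0 ?(ltW t0)//.
  exact: ltW.
pose M' := M * (1 + 3 * t + t ^+ 2).
have M'0 : 0 <= M'.
  by rewrite mulr_ge0// !addr_ge0 ?mulr_ge0 ?exprn_ge0 ?(ltW t0).
(* Collects the coefficients of [r^4] from both expansions; [r c4 <= sg / 16] makes them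
   harmless. *)
pose c4 := 64 * c1 + 32 * (t * M') + 1.
have tM' : 0 <= t * M' by rewrite mulr_ge0// ltW.
have c40 : 0 < c4 by rewrite ltr_wpDl// addr_ge0// mulr_ge0.
(* Halving the minimum makes all four constraints on [r] strict. *)
pose r := Num.min (Num.min ra rb) (Num.min (1 / 12) (sg / 16 / c4)) / 2.
have mn0 : 0 < Num.min (Num.min ra rb) (Num.min (1 / 12) (sg / 16 / c4)).
  by rewrite !lt_min ra0 rb0 !divr_gt0.
have r0 : 0 < r by rewrite divr_gt0.
have : r < Num.min (Num.min ra rb) (Num.min (1 / 12) (sg / 16 / c4)).
  by rewrite /r; lra.
rewrite !lt_min => /andP[/andP[rra rrb] /andP[r12 rc4]].
have r3 : 0 < r ^+ 3 by rewrite exprn_gt0.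
have rc : r * c4 <= sg / 16 by rewrite -ler_pdivlMr// ltW.
have Xb := hra r r0 rra; have Y2b := hrb r r0 rrb.
have Lam := jump_test_theta r0 (ltW r12).
pose h := jump_test r.
have Lh : L1 h by exact: L1_jump_test.
have e0 : 0 < sg / 16 * r ^+ 3 by rewrite mulr_gt0.
have duh := duhamel_pairing bu mild tT Lphi Lh (sq_int_jump_test r)
  (sq_int_ft_jump_test false (ltW r0)) e0.
have [n [n0 hn]] := filter_ex (filterI (nbhs_infty_gt 0) duh).
have np : 0 < n%:R :> R by rewrite ltr0n.
have nn0 : n%:R != 0 :> R by rewrite gt_eqF.
set L := \int[mu]_xi (theta xi * jump_test r xi) in Lam.
pose N c := \int[mu]_x (u c x ^+ 2).
pose S := \sum_(k < n) t / n%:R * N (t * k%:R / n%:R).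
have Sb : sg <= S.
  have := @left_sum_lower _ N t d eta n t0 (ltW eta0) n0 _ _.
  rewrite (min_idPl (ltW d0)) mulr0 addr0; apply.
    by move=> c _ _; apply: int_ge0 => x; exact: sqr_ge0.
  by move=> c c0 ct; apply: Nlow; exact: subT.
move: hn; rewrite (ft_mul false Lt Lh).2.
set X := \int[mu]_x (u t x * _) in Xb *.
set Y := \int[mu]_x (phase_mul _ _ _ _ _ * _).
set Z := \sum_(k < n) _ => hn.
have r20 : 0 <= 2 * r by rewrite mulr_ge0// ltW.
have Lth : L1 (fun xi => theta xi * h xi).
  by apply: (L1_mul_jump_test _ msr_theta) => x; exact: norm_theta.
have Zb : `|Z + S * L| <= t * (8 * r * (M' * (2 * r) ^+ 3)).
  have -> : Z + S * L = \sum_(k < n) t / n%:R *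
      (\int[mu]_xi (duhamel_term false t (t * k%:R / n%:R)
          (fun x => u (t * k%:R / n%:R) x ^+ 2) xi * h xi) + N (t * k%:R / n%:R) * L).
    rewrite /Z /S mulr_suml -big_split; apply: eq_bigr => k _ /=.
    by rewrite mulrDr mulrA.
  rewrite (le_trans (ler_norm_sum _ _ _))//.
  apply: (@le_trans _ _ (\sum_(k < n) t / n%:R * (8 * r * (M' * (2 * r) ^+ 3)))).
    apply: ler_sum => k _; set c := t * k%:R / n%:R.
    have cc0 : 0 <= c by rewrite /c divr_ge0// mulr_ge0// ltW.
    have ct : c <= t.
      by rewrite /c ler_pdivrMr// ler_wpM2l ?(ltW t0)// ler_nat ltnW.
    have [mc _ fM xfM _] := bu c (subT c cc0 ct).
    have [Lc _ _] := moment2_sqr mc.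
    rewrite normrM ger0_norm ?divr_ge0 ?(ltW t0)//.
    rewrite ler_wpM2l ?divr_ge0 ?(ltW t0)//.
    have Ld := L1_duhamel_term false t c Lc Lh.
    have -> : \int[mu]_xi (duhamel_term false t c (fun x => u c x ^+ 2) xi * h xi) + N c * L =
      \int[mu]_xi ((duhamel_term false t c (fun x => u c x ^+ 2) xi + N c * theta xi) * jump_test r xi).
      rewrite /L -intZ// -intD//; last exact: L1Z.
      by apply: int_eq => xi; rewrite /h; ring.
    apply: jump_test_bound.
    - exact: ltW.
    - by rewrite mulr_ge0// exprn_ge0.
    - have := L1D Ld (L1Z (N c) Lth).
      by congr L1; apply/funext => xi; rewrite /h; ring.
    - move=> xi xi0 xir; rewrite (le_trans (duhamel_term_expand mc fM xfM cc0 ct xi0))//.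
      by rewrite ler_wpM2l// lerXn2r ?nnegrE.
  rewrite sumr_const card_ord -mulr_natl le_eqVlt; apply/orP; left; apply/eqP.
  by field.
have LSh : L1 (fun xi => ft false (u 0) xi * h xi) by exact: (ft_mul false L0 Lh).1.
have LY : L1 (fun xi => phase_mul false (cos (t * theta xi)) (sin (t * theta xi))
    (ft true (u 0) xi) (ft false (u 0) xi) * h xi).
  have mth := @msr_theta R.
  apply: L1_phase_mul_ft => //; [by solve_msr|by solve_msr| |].
    by move=> x; exact: cos_max.
  by move=> x; exact: sin_max.
pose p0 := ft true (u 0) 0.
pose Y1 := \int[mu]_xi ((phase_mul false (cos (t * theta xi)) (sin (t * theta xi))
      (ft true (u 0) xi) (ft false (u 0) xi)
    - (ft false (u 0) xi + t * theta xi * p0)) * jump_test r xi).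
pose Y2 := \int[mu]_x (u 0 x * ft false (jump_test r) x).
(* The free evolution splits into the remainder of [phase_expand], the sine transform of [u 0], and
   the mean term, whose sign is favourable. *)
have YE : Y = Y1 + Y2 + t * p0 * L.
  rewrite /Y2 -(ft_mul false L0 Lh).2 /L -(intZ _ Lth) /Y /Y1.
  rewrite -addrA -intD//; last exact: L1Z.
  rewrite -intD; last 2 first.
  - have := L1B LY (L1D LSh (L1Z (t * p0) Lth)).
    by congr L1; apply/funext => xi; rewrite /h; ring.
  - by apply: L1D => //; exact: L1Z.
  by apply: int_eq => xi; rewrite !phiE /h; ring.
have Y1b : `|Y1| <= 8 * r * ((2 * r) ^+ 2 * (t * (del * W / 2) + 2 * r * c1)).
  apply: jump_test_bound; first exact: ltW.
  - apply: mulr_ge0; first exact: sqr_ge0.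
    apply: addr_ge0; last exact: mulr_ge0.
    by rewrite mulr_ge0 ?(ltW t0)// divr_ge0// mulr_ge0// ltW.
  - have := L1B LY (L1D LSh (L1Z (t * p0) Lth)).
    by congr L1; apply/funext => xi; rewrite /h; ring.
  - move=> xi xi0 xir; rewrite (le_trans (phase_expand m0 (ltW t0) xi0 del0))//.
    have dW : 0 <= t * (del * W / 2).
      by rewrite mulr_ge0 ?(ltW t0)// divr_ge0// mulr_ge0// ltW.
    rewrite ler_pM ?sqr_ge0//.
    + by rewrite addr_ge0// mulr_ge0.
    + by rewrite lerXn2r ?nnegrE.
    + by rewrite lerD2l ler_wpM2r.
have e16 : sg / 16 * r ^+ 3 = sg * r ^+ 3 / 16 by field.
have q1 : 8 * r * ((2 * r) ^+ 2 * (t * (del * W / 2) + 2 * r * c1)) =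
    16 * (t * (del * W)) * r ^+ 3 + 64 * c1 * r * r ^+ 3 by field.
have q2 : t * (8 * r * (M' * (2 * r) ^+ 3)) = 2 * (32 * (t * M') * r * r ^+ 3) by ring.
have q3 : 16 * (t * (del * W)) * r ^+ 3 <= sg / 8 * r ^+ 3 by rewrite ler_wpM2r// ltW.
have q4 : (64 * c1 * r + 32 * (t * M') * r) * r ^+ 3 <= sg / 16 * r ^+ 3.
  rewrite ler_wpM2r ?(ltW r3)//; move: rc; rewrite /c4.
  have := ltW r0; lra.
have q5 : sg * r ^+ 3 <= S * L by apply: ler_pM => //; exact: ltW.
have q6 : 0 <= t * p0 * L by rewrite !mulr_ge0 ?(ltW t0)// (le_trans (ltW r3)).
have q7 : 0 < sg * r ^+ 3 by rewrite mulr_gt0.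
(* Budget in units of [sg r^3]: 1/16 each for the Riemann error, [X] and [Y2], 2/16 for the
   quadratic part of [Y1], and 1/16 for the [r^4] terms. The total 6/16 is less than the 8/16
   supplied by [S * L / 2]. *)
move: hn Xb Y2b Y1b Zb; rewrite YE q1 q2 -/Y2.
rewrite !ler_norml => /andP[h1 h1'] /andP[h2 h2'] /andP[h3 h3'] /andP[h4 h4'] /andP[h5 h5'].
move: h1 h1' h2 h2' h3 h3' h4 h4' h5 h5' q3 q4 q5 q6 q7.
set E := r ^+ 3; set a := S * L; set b := t * p0 * L.
set a1 := 16 * (t * _) * E; set a2 := 64 * c1 * r * E; set a3 := 32 * (t * M') * r * E.
rewrite (_ : (64 * c1 * r + 32 * (t * M') * r) * E = a2 + a3); last by rewrite /a2 /a3; ring.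
set s := sg * E.
rewrite (_ : sg / 16 * E = s / 16); last by rewrite /s; field.
rewrite (_ : sg / 8 * E = s / 8); last by rewrite /s; field.
lra.
Qed.

Lemma L2w_half_L1 f : L2w (5 / 2) f -> L1 (fun x => `|x| ^+ 5 * f x ^+ 2).
Proof.
move=> [_ /L2P[_]]; congr L1; apply/funext => x.
rewrite exprMn -(powR_mulrn 2 (powR_ge0 _ _)) -powRrM.
by rewrite (_ : 5 / 2 * 2 = 5%:R) ?powR_mulrn//; field.
Qed.

End vanishing.

Theorem theorem1p3 (R : realType) (s T : R) (phi : R -> R) (u : R -> R -> R)
    (t2 : R) :
  1 / 2 < s -> 0 < T ->
  continuous_Hsr s 2 T u ->
  mild_solution T phi u ->
  0 <= \int[@lebesgue_measure R]_x phi x ->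
  0 < t2 < T ->
  Hsr s (5 / 2) (u 0) ->
  Hsr s (5 / 2) (u t2) ->
  forall t : R, t \in `[0, T] ->
    {ae @lebesgue_measure R, forall x, u t x = 0}.
Proof.
move=> s2 T0 cu mild phi0 /andP[t20 t2T] [_ u0w] [_ ut2w].
have [M M0 bu] := continuous_Hsr_bounded s2 cu.
have [uphi sol] := mild.
have zT : 0 \in `[0, T] by rewrite in_itv/= lexx ltW.
have tT : t2 \in `[0, T] by rewrite in_itv/= !ltW.
have [m0 _ _ _ _] := bu 0 zT; have [Lu0 _] := moment2_L1 m0.
(* Measurability of [phi] is read off the multiplier relation at time 0, which places [phi] in
   L^2. *)
have mphi : msr phi.
  have [v [F [w [[fh [gh [[/L2P[] ]]]]]]]] := sol 0 zT.
  by [].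
have Lphi : L1 phi by apply: L1_ae_eq Lu0 mphi uphi.
have phiE b xi : ft b phi xi = ft b (u 0) xi by rewrite (ft_ae_eq b xi Lu0 mphi uphi).
have p0 : 0 <= ft true (u 0) 0.
  rewrite -phiE; move: phi0; congr (_ <= _); apply: int_eq => x.
  by rewrite mulr0 /= cos0 mulr1.
have N00 : \int[lebesgue_measure]_x (u 0 x ^+ 2) = 0.
  apply/eqP; rewrite eq_le int_ge0 ?andbT; last by move=> x; exact: sqr_ge0.
  rewrite leNgt; apply/negP => N0.
  (* If [u 0] were nonzero, the squared norm would stay above a quarter of its initial value for a
     short time, which is the positive lower bound that [jump_absurd] refutes. *)
  have [d d0 hd] := continuous_Hsr_lower_bound s2 (ltW T0) cu N0.
  apply: (jump_absurd bu mild tT t20 Lphi phiE p0 (L2w_half_L1 u0w) (L2w_half_L1 ut2w) _ d0 hd).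
  by rewrite divr_gt0.
have u00 : {ae lebesgue_measure, forall x, u 0 x = 0}.
  apply: ae_imp (int_eq0_ae m0.1.2 (fun x => sqr_ge0 _) N00) => x /= /eqP.
  by rewrite sqrf_eq0 => /eqP.
apply: (mild_solution_zero M0 bu mild Lphi) => b xi.
by rewrite phiE ft_zero//; exact: msr_L1.
Qed.
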